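(* Let $M^7$ be a contact Calabi--Yau manifold with contact form $\theta$, transverse Calabi--Yau structure $(\omega,\Upsilon)$ and Reeb vector field $\xi$, let $h:M\to\mathbb{R}_{\ge0}$ be a function with $\xi(h)=0$, and let $\varphi=h\theta\wedge\omega+\mathrm{Re}\Upsilon$ be the corresponding $\mathrm{G}_2$-structure where $h>0$. Regard $h$ as a function on the leaf space $N=M/\langle\xi\rangle$, and let $d(\cdot,\cdot)$ be the distance on $N$. Then: (i) $|d^*\varphi|$ is bounded if, and only if, $|d(\ln h)|$ is bounded. (ii) If $h(p)=0$, $h$ is continuous at $p$, and $h$ is differentiable and positive on a punctured neighbourhood of $p$, then $|d(\ln h)|$ cannot be bounded. (iii) If $h(x)=O(r^k)$ for $r=d(p,x)$ sufficiently small, $k\ne0$, then $|d^*\varphi|=O(r^{-1})$.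
   Context: A contact Calabi--Yau manifold is a 7-manifold $M$ with a nowhere-vanishing 1-form $\theta$ and a transverse torsion-free $\mathrm{SU}(3)$-structure $(\omega,\Upsilon)$ on $\ker\theta$ (basic forms with $\omega\wedge\Upsilon=0$, $\frac16\omega^3=\frac14\mathrm{Re}\Upsilon\wedge\mathrm{Im}\Upsilon$, $d\omega=0$, $d\Upsilon=0$), such that $d\theta=\omega$. The Reeb vector field $\xi$ satisfies $\theta(\xi)=1$, $\mathcal{L}_\xi\theta=0$, and has compact orbits, so that $N$ is a Riemannian orbifold with metric $g_{CY}$ induced by $(\omega,\Upsilon)$. The $\mathrm{G}_2$-structure $\varphi=h\theta\wedge\omega+\mathrm{Re}\Upsilon$ has $*\varphi=\frac12\omega^2-h\theta\wedge\mathrm{Im}\Upsilon$ and induces the metric $g=g_{CY}+h^2\theta^2$; norms are taken with respect to $g$, and $d^*\varphi=-*d*\varphi$.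
   Formalization: In (iii), ''h = O(r^k)'' is read as: near p, off p, h is differentiable, c r^k ≤ h ≤ C r^k with c > 0, and |dh| ≤ C r^(k-1); with only an upper bound the claim fails, e.g. for h = exp(-1/r^2). *)

(* Defs.v *)
From HB Require Import structures.
From mathcomp Require Import all_boot all_order all_algebra all_fingroup.
From mathcomp Require Import all_classical all_reals all_analysis.
Set Implicit Arguments.
Unset Strict Implicit.
Unset Printing Implicit Defensive.
Import Order.TTheory GRing.Theory Num.Theory.
Import numFieldNormedType.Exports.
Local Open Scope classical_set_scope.
Local Open Scope ring_scope.

(* Smooth 7-manifolds are given by charts, and tensor fields by their components
   in every chart, related by the Jacobians of the coordinate changes. *)

Section Tensors.
Variable R : realType.

(* Multi-indices (i_1, ..., i_k) with values in {0, ..., 6}. *)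
Definition ix (k : nat) := {ffun 'I_k -> 'I_7}.

(* Components of a covariant k-tensor with respect to a basis of a
   7-dimensional vector space; k-forms are the antisymmetric ones. *)
Definition tens (k : nat) := ix k -> R.

Definition ix1 (a : 'I_7) : ix 1 := [ffun=> a].
Definition ix2 (a b : 'I_7) : ix 2 :=
  [ffun l : 'I_2 => if l == ord0 then a else b].
Definition ix_cat k l (a : ix k) (b : ix l) : ix (k + l) :=
  [ffun x : 'I_(k + l) => match fintype.split x with inl i => a i | inr j => b j end].
Definition ix_set k (a : ix k) (l : 'I_k) (b : 'I_7) : ix k :=
  [ffun x : 'I_k => if x == l then b else a x].

Definition antisym k (T : tens k) : Prop :=
  forall (s : 'S_k) (a : ix k), T [ffun x => a (s x)] = (-1) ^+ s * T a.

Definition alt k (T : tens k) : tens k :=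
  fun a => \sum_(s : 'S_k) (-1) ^+ s * T [ffun x => a (s x)].

(* Normalised so that (alpha /\ beta)(u, v)
   = alpha(u) beta(v) - alpha(v) beta(u) for 1-forms. *)
Definition wedge k l (S : tens k) (T : tens l) : tens (k + l) :=
  fun a => ((k`! * l`!)%:R)^-1 *
    alt (fun b : ix (k + l) => S [ffun i => b (lshift l i)] *
                               T [ffun j => b (rshift k j)]) a.

(* Interior product: the vector is inserted in the first slot. *)
Definition iprod k (X : 'rV[R]_7) (T : tens k.+1) : tens k :=
  fun a => \sum_(b < 7) X 0 b * T (ix_cat (ix1 b) a).

Definition gram (g : tens 2) : 'M[R]_7 := \matrix_(a, b) g (ix2 a b).

(* All indices raised with the metric g. *)
Definition raise k (g : tens 2) (T : tens k) : tens k :=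
  fun a => \sum_(b : ix k) (\prod_(l < k) invmx (gram g) (a l) (b l)) * T b.

(* Norm on k-forms: e^{i_1} /\ ... /\ e^{i_k} has norm 1 for an orthonormal
   coframe and i_1 < ... < i_k. *)
Definition fnorm k (g : tens 2) (T : tens k) : R :=
  Num.sqrt ((k`!%:R)^-1 * \sum_(a : ix k) T a * raise g T a).

(* Riemannian volume form of g, oriented by the nonzero 7-form o. *)
Definition volume (g : tens 2) (o : tens 7) : tens 7 :=
  fun a => Num.sg (o [ffun i => i]) * Num.sqrt (\det (gram g)) *
           \det (\matrix_(i, j) (a i == j)%:R : 'M[R]_7).

(* Hodge star: alpha /\ star alpha = |alpha|^2 vol. *)
Definition hodge k l (h7 : (k + l = 7)%N) (g : tens 2) (o : tens 7)
    (T : tens k) : tens l :=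
  fun a => (k`!%:R)^-1 * \sum_(b : ix k) raise g T b *
    volume g o [ffun i => ix_cat b a (cast_ord (esym h7) i)].

End Tensors.

Section Manifolds.
Variable R : realType.

Definition ebase (a : 'I_7) : 'rV[R]_7 := delta_mx 0 a.

Fixpoint Ck (n : nat) (U : set 'rV[R]_7) (f : 'rV[R]_7 -> R) : Prop :=
  match n with
  | 0 => forall x, U x -> {for x, continuous f}
  | n'.+1 => (forall x, U x -> {for x, continuous f}) /\
      forall a, (forall x, U x -> derivable f x (ebase a)) /\
                Ck n' U (fun x => 'D_(ebase a) f x)
  end.

Definition smooth_on (U : set 'rV[R]_7) (f : 'rV[R]_7 -> R) : Prop :=
  forall n, Ck n U f.

(* A homeomorphism from the open set dom of M to the open set cod of R^7;
   coord and point are only meaningful on dom and cod respectively. *)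
Record chart (M : topologicalType) := Chart {
  dom : set M;
  cod : set 'rV[R]_7;
  coord : M -> 'rV[R]_7;
  point : 'rV[R]_7 -> M;
  dom_open : open dom;
  cod_open : open cod;
  coord_cod : forall p, dom p -> cod (coord p);
  point_dom : forall x, cod x -> dom (point x);
  coordK : forall p, dom p -> point (coord p) = p;
  pointK : forall x, cod x -> coord (point x) = x;
  coord_cont : forall p, dom p -> {for p, continuous coord};
  point_cont : forall x, cod x -> {for x, continuous point} }.

Record manifold := Manifold {
  carrier :> topologicalType;
  mhausdorff : hausdorff_space carrier;
  msecond : @second_countable carrier;
  cidx : Type;
  atlas : cidx -> chart carrier;
  chart_at : carrier -> cidx;
  chart_atP : forall p, dom (atlas (chart_at p)) p;
  atlas_compat : forall (i j : cidx) (b : 'I_7),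
    smooth_on (cod (atlas i) `&` point (atlas i) @^-1` dom (atlas j))
      (fun x => coord (atlas j) (point (atlas i) x) 0 b) }.

Variable M : manifold.

Definition cdom (i : cidx M) : set M := dom (atlas i).
Definition ccod (i : cidx M) : set 'rV[R]_7 := cod (atlas i).
Definition cmap (i : cidx M) : M -> 'rV[R]_7 := coord (atlas i).
Definition cinv (i : cidx M) : 'rV[R]_7 -> M := point (atlas i).

(* jac i j p a b = d y^b / d x^a at p, for x (resp. y) the coordinates of the
   chart i (resp. j). *)
Definition jac (i j : cidx M) (p : M) : 'M[R]_7 :=
  \matrix_(a, b) 'D_(ebase a) (fun x => cmap j (cinv i x) 0 b) (cmap i p).

(* pd i a f p = d f / d x^a at p, in the coordinates x of the chart i. *)
Definition pd (i : cidx M) (a : 'I_7) (f : M -> R) (p : M) : R :=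
  'D_(ebase a) (fun x => f (cinv i x)) (cmap i p).

Definition smooth_in (i : cidx M) (f : M -> R) : Prop :=
  smooth_on (ccod i) (fun x => f (cinv i x)).

Definition differentiable_at (f : M -> R) (p : M) : Prop :=
  forall i, cdom i p -> differentiable (fun x => f (cinv i x)) (cmap i p).

Definition vfield := cidx M -> M -> 'rV[R]_7.
Definition tfield (k : nat) := cidx M -> M -> tens R k.

Definition is_vfield (X : vfield) : Prop :=
  (forall i j p, cdom i p -> cdom j p -> X j p = X i p *m jac i j p) /\
  (forall i b, smooth_in i (fun p => X i p 0 b)).

Definition is_form k (T : tfield k) : Prop :=
  [/\ forall i p, cdom i p -> antisym (T i p),
      forall i j p, cdom i p -> cdom j p -> forall a : ix k,
        T i p a = \sum_(b : ix k) (\prod_(l < k) jac i j p (a l) (b l)) * T j p b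
    & forall i a, smooth_in i (fun p => T i p a) ].

Definition form0 (f : M -> R) : tfield 0 := fun _ p _ => f p.

(* (d T)_{a_0 ... a_k} = 1/k! sum_s sgn(s) d_{a_s(0)} T_{a_s(1) ... a_s(k)} *)
Definition ext_d k (T : tfield k) : tfield k.+1 :=
  fun i p a => (k`!%:R)^-1 *
    alt (fun b : ix k.+1 =>
      pd i (b ord0) (fun q => T i q [ffun l => b (lift ord0 l)]) p) a.

Definition lie k (X : vfield) (T : tfield k) : tfield k :=
  fun i p a =>
    \sum_(b < 7) X i p 0 b * pd i b (fun q => T i q a) p +
    \sum_(l < k) \sum_(b < 7)
      T i p (ix_set a l b) * pd i (a l) (fun q => X i q 0 b) p.

Definition basic k (X : vfield) (T : tfield k.+1) : Prop :=
  forall i p, cdom i p ->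
    (forall a, iprod (X i p) (T i p) a = 0) /\ (forall a, lie X T i p a = 0).

Definition integral_curve (X : vfield) (s t : R) (c : R -> M) : Prop :=
  forall u, s < u < t -> {for u, continuous c} /\
    forall i, cdom i (c u) -> is_derive u 1 (cmap i \o c) (X i (c u)).

(* The image of the maximal integral curve through p. *)
Definition flow_orbit (X : vfield) (p : M) : set M :=
  [set q | exists (s t u v : R) (c : R -> M),
    [/\ integral_curve X s t c, s < u < t, s < v < t, c u = p & c v = q] ].

(* X(f) = 0, as a derivative along the flow of X; no differentiability of f
   in the other directions is presupposed. *)
Definition constant_along (X : vfield) (f : M -> R) : Prop :=
  forall (s t : R) (c : R -> M), integral_curve X s t c ->
    forall u, s < u < t -> is_derive u 1 (f \o c) 0.

(* Not necessarily immersed, so that corners can be absorbed by slowing down. *)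
Definition C1_curve (c : R -> M) : Prop :=
  continuous c /\
  forall i u, cdom i (c u) ->
    derivable (cmap i \o c) u 1 /\ {for u, continuous (derive1 (cmap i \o c))}.

Definition velocity (c : R -> M) (u : R) : 'rV[R]_7 :=
  derive1 (cmap (chart_at (c u)) \o c) u.

(* Norm at p of the value of a form, computed in a chart around p. *)
Definition pnorm k (g : tfield 2) (T : tfield k) (p : M) : R :=
  fnorm (g (chart_at p) p) (T (chart_at p) p).

End Manifolds.

Section ContactCalabiYau.
Variable R : realType.

Record contactCY := ContactCY {
  cyM :> manifold R;
  theta : tfield cyM 1;
  omega : tfield cyM 2;
  ReU : tfield cyM 3;
  ImU : tfield cyM 3;
  xi : vfield cyM;
  (* Transverse complex structure u |-> u *m acs i p in the chart i, extended
     by 0 on xi; the conditions below determine it from Upsilon. *)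
  acs : cidx cyM -> cyM -> 'M[R]_7;
  theta_form : is_form theta;
  omega_form : is_form omega;
  ReU_form : is_form ReU;
  ImU_form : is_form ImU;
  xi_vfield : is_vfield xi;
  theta_xi : forall i p, cdom i p -> \sum_(a < 7) xi i p 0 a * theta i p (ix1 a) = 1;
  lie_theta : forall i p a, cdom i p -> lie xi theta i p a = 0;
  omega_basic : basic xi omega;
  ReU_basic : basic xi ReU;
  ImU_basic : basic xi ImU;
  acs_xi : forall i p, cdom i p -> xi i p *m acs i p = 0;
  acs_ker : forall i p, cdom i p -> forall (u : 'rV[R]_7),
    \sum_(a < 7) (u *m acs i p) 0 a * theta i p (ix1 a) = 0;
  acs_sqr : forall i p, cdom i p -> forall (u : 'rV[R]_7),
    \sum_(a < 7) u 0 a * theta i p (ix1 a) = 0 ->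
    u *m acs i p *m acs i p = - u;
  (* Upsilon (J u, ., .) = 'i Upsilon (u, ., .): Upsilon has type (3, 0). *)
  ReU_acs : forall i p, cdom i p -> forall (u : 'rV[R]_7) (a : ix 2),
    iprod (u *m acs i p) (ReU i p) a = - iprod u (ImU i p) a;
  ImU_acs : forall i p, cdom i p -> forall (u : 'rV[R]_7) (a : ix 2),
    iprod (u *m acs i p) (ImU i p) a = iprod u (ReU i p) a;
  omega_acs_pos : forall i p, cdom i p -> forall (u : 'rV[R]_7),
    \sum_(a < 7) u 0 a * theta i p (ix1 a) = 0 -> u != 0 ->
    0 < \sum_(a < 7) \sum_(b < 7)
          u 0 a * (u *m acs i p) 0 b * omega i p (ix2 a b);
  omega_ReU : forall i p a, cdom i p -> wedge (omega i p) (ReU i p) a = 0;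
  omega_ImU : forall i p a, cdom i p -> wedge (omega i p) (ImU i p) a = 0;
  omega_ReU_ImU : forall i p (a : ix 6), cdom i p ->
    6%:R^-1 * wedge (omega i p) (wedge (omega i p) (omega i p)) a =
    4%:R^-1 * wedge (ReU i p) (ImU i p) a;
  d_omega : forall i p a, cdom i p -> ext_d omega i p a = 0;
  d_ReU : forall i p a, cdom i p -> ext_d ReU i p a = 0;
  d_ImU : forall i p a, cdom i p -> ext_d ImU i p a = 0;
  d_theta : forall i p a, cdom i p -> ext_d theta i p a = omega i p a;
  orbit_compact : forall p : cyM, compact (flow_orbit xi p) }.

Variable M : contactCY.

(* g_CY(u, v) = omega(u, J v), as a degenerate metric on M with kernel xi. *)
Definition gCY : tfield M 2 :=
  fun i p a => \sum_(c < 7)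
    omega i p (ix2 (a ord0) c) * acs i p (a ord_max) c.

Definition gmetric (h : M -> R) : tfield M 2 :=
  fun i p a => gCY i p a +
    h p ^+ 2 * (theta i p (ix1 (a ord0)) * theta i p (ix1 (a ord_max))).

Definition varphi (h : M -> R) : tfield M 3 :=
  fun i p a => h p * wedge (theta i p) (omega i p) a + ReU i p a.

(* The orientation for which
   star varphi = 1/2 omega^2 - h theta /\ Im Upsilon when h > 0. *)
Definition orientation : tfield M 7 :=
  fun i p => wedge (theta i p)
               (wedge (omega i p) (wedge (omega i p) (omega i p))).

Definition star (h : M -> R) k l (h7 : (k + l = 7)%N) (T : tfield M k)
    : tfield M l :=
  fun i p => hodge h7 (gmetric h i p) (orientation i p) (T i p).

Definition codiff_varphi (h : M -> R) : tfield M 2 :=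
  fun i p a =>
    - star h (k := 5) (l := 2) erefl
        (ext_d (star h (k := 3) (l := 4) erefl (varphi h))) i p a.

Definition norm_dstar_varphi (h : M -> R) (p : M) : R :=
  pnorm (gmetric h) (codiff_varphi h) p.

Definition norm_d (h f : M -> R) (p : M) : R :=
  pnorm (gmetric h) (ext_d (form0 f)) p.

Definition norm_dln (h : M -> R) (p : M) : R := norm_d h (fun q => ln (h q)) p.

Definition bounded_over (A : set M) (f : M -> R) : Prop :=
  exists C : R, forall p, A p -> `|f p| <= C.

(* Points of the leaf space N = M/<xi> are orbits; points of M stand for their
   orbits. Open sets of N (quotient topology) are the saturated open sets. *)
Definition leaf_open (U : set M) : Prop :=
  open U /\ forall p q, U p -> flow_orbit (@xi M) p q -> U q.

Definition leaf_continuous_at (h : M -> R) (p : M) : Prop :=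
  forall e : R, 0 < e -> exists U, [/\ leaf_open U, U p &
    forall q, U q -> `|h q - h p| < e].

Definition transverse_speed (c : R -> M) (u : R) : R :=
  Num.sqrt (\sum_(a < 7) \sum_(b < 7) velocity c u 0 a * velocity c u 0 b *
              gCY (chart_at (c u)) (c u) (ix2 a b)).

(* Distance on (N, g_CY): infimum of the g_CY-lengths of the projections to N
   of the C^1 curves of M joining the two orbits (+oo if there is none). *)
Definition leaf_dist (p q : M) : \bar R :=
  ereal_inf [set L | exists c : R -> M,
    [/\ C1_curve c, flow_orbit (@xi M) p (c 0), flow_orbit (@xi M) q (c 1) &
      L = (\int[lebesgue_measure]_(u in `[0%R, 1%R])
             (transverse_speed c u)%:E)%E] ].

(* h = O(r^k) near p, r = d(p, .), read as in an asymptotic expansion: r^k is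
   the exact order of h and dh is of the differentiated order O(r^(k-1)). An
   upper bound on h alone says nothing about d(ln h): e.g. exp(-1/r^2) is O(r^k)
   for every k, but its logarithmic derivative is of order r^(-3). *)
Definition has_order (h : M -> R) (p : M) (k : R) : Prop :=
  exists c C d : R, [/\ 0 < c, 0 < d &
    forall (x : M) (r : R), leaf_dist p x = r%:E -> 0 < r < d ->
      [/\ differentiable_at h x, c * r `^ k <= h x, h x <= C * r `^ k
        & norm_d h h x <= C * r `^ (k - 1)] ].

End ContactCalabiYau.

(* Main.v *)
(* Where h > 0, a unitary frame for (theta, omega, Upsilon) reduces the Hodge star
   to a finite computation: star varphi = 1/2 omega^2 - h theta /\ Im Upsilon, so
   d star varphi = - dh /\ theta /\ Im Upsilon, since omega^2 and
   theta /\ Im Upsilon are closed. Applying the star once more contracts dh with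
   Re Upsilon and gives |d^* varphi| = sqrt 2 |dh restricted to ker theta| / h. As h is
   constant along the integral curves of xi, dh(xi) = 0, hence
   |d^* varphi| = sqrt 2 |d ln h|, which yields (i) and (iii).

   For (ii), the orbit of p meets a segment transverse to xi in countably many
   points, so some segment issued from p ends outside the orbit. Beyond the last
   point x of the segment on the orbit, h is positive, and the segment has bounded
   speed near x because g = g_CY + h^2 theta^2 does not blow up as h tends to 0. If
   |d ln h| were bounded, ln h would be Lipschitz along the segment and h would stay
   away from 0 near x. *)
Require Import Defs.
From mathcomp Require Import all_boot all_order all_algebra all_fingroup.
From mathcomp Require Import all_classical all_reals all_analysis.
From mathcomp Require Import ring lra zify.
Set Implicit Arguments.
Unset Strict Implicit.
Unset Printing Implicit Defensive.
Import Order.TTheory GRing.Theory Num.Theory.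
Import numFieldNormedType.Exports.
Local Open Scope classical_set_scope.
Local Open Scope ring_scope.

(** * Alternation and wedge products *)

(** The transverse complex structure [acs] comes with neither smoothness, nor a transformation law,
    nor invariance of omega. Invariance is extracted from omega /\ Upsilon = 0, once the volume
    normalisation has excluded Upsilon = 0; chart independence and local boundedness come from the
    fact that Upsilon determines J. The unitary frame is thus only pointwise and is never
    differentiated: it serves to prove a frame-free formula for star varphi, valid near each point
    where h > 0 and h is differentiable. The frame is normalised up to a phase x + i y, so that the
    identities of the flat model are needed for real and imaginary parts alike. They are decided by
    [vm_compute] over the integers: forms with constant coefficients are lists of signed index
    lists, evaluated at all index lists. Invariance of h is a statement about integral curves:
    dh(xi) = 0 requires that they exist, and the times at which an orbit meets a segment make sense
    only if they are unique. Hence a Picard theorem in charts, where smoothness means iterated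
    partial derivatives. *)

Section Alternation.
Variable R : realType.
Implicit Types (k l : nat).

Lemma alt_perm k (T : tens R k) (r : 'S_k) (a : ix k) :
  alt T [ffun x => a (r x)] = (-1) ^+ r * alt T a.
Proof.
rewrite /alt (reindex_inj (mulIg (r^-1)%g)) /= big_distrr /=.
apply: eq_bigr => s _; rewrite odd_permM odd_permV signr_addb.
rewrite mulrA [_ * (-1) ^+ r]mulrC; congr (_ * T _).
by apply/ffunP => x; rewrite !ffunE permM permKV.
Qed.

Lemma alt_antisym k (T : tens R k) : antisym (alt T).
Proof. by move=> s a; rewrite alt_perm. Qed.

Lemma altE_antisym k (T : tens R k) a : antisym T -> alt T a = k`!%:R * T a.
Proof.
move=> aT; rewrite /alt (eq_bigr (fun=> T a)) => [|s _].
  by rewrite sumr_const card_Sn mulr_natl.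
by rewrite aT mulrA -expr2 sqrr_sign mul1r.
Qed.

Lemma eq_alt k (S T : tens R k) a : S =1 T -> alt S a = alt T a.
Proof. by move=> e; apply: eq_bigr => s _; rewrite e. Qed.

Lemma alt_permr k (T : tens R k) (r : 'S_k) (a : ix k) :
  alt (fun b => T [ffun x => b (r x)]) a = (-1) ^+ r * alt T a.
Proof.
rewrite /alt [in RHS](reindex_inj (mulgI r)) /= big_distrr /=.
apply: eq_bigr => s _; rewrite odd_permM signr_addb !mulrA -expr2 sqrr_sign.
rewrite mul1r; congr (_ * T _).
by apply/ffunP => x; rewrite !ffunE permM.
Qed.

(** The embedding of ['S_k] in ['S_(k + l)] through the first block: alternating one factor of a
    tensor product is a sum over this subgroup, which the full alternation absorbs. *)
Definition lperm_fun k l (r : 'S_k) (x : 'I_(k + l)) : 'I_(k + l) :=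
  match fintype.split x with inl i => lshift l (r i) | inr j => rshift k j end.

Lemma lperm_inj k l (r : 'S_k) : injective (@lperm_fun k l r).
Proof.
apply: (@can_inj _ _ _ (lperm_fun (r^-1)%g)) => x.
rewrite /lperm_fun -[x]splitK; case: (fintype.split x) => j /=.
  by rewrite !(unsplitK (inl _)) permK.
by rewrite !(unsplitK (inr _)).
Qed.

Definition lperm k l (r : 'S_k) : 'S_(k + l) := perm (@lperm_inj k l r).

Lemma lperm_lshift k l (r : 'S_k) i : lperm l r (lshift l i) = lshift l (r i).
Proof. by rewrite permE /lperm_fun (unsplitK (inl _)). Qed.

Lemma lperm_rshift k l (r : 'S_k) j : lperm l r (rshift k j) = rshift k j.
Proof. by rewrite permE /lperm_fun (unsplitK (inr _)). Qed.

(** The sign is read off as a determinant, the permutation matrix being block diagonal with an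
    identity block. *)
Lemma sign_lperm k l (r : 'S_k) : (-1) ^+ lperm l r = (-1) ^+ r :> R.
Proof.
rewrite -!det_perm.
have -> : perm_mx (lperm l r) = block_mx (perm_mx r) 0 0 1%:M :> 'M[R]_(k + l).
  apply/matrixP => i j; rewrite -[i]splitK -[j]splitK.
  case: (fintype.split i) => i'; case: (fintype.split j) => j' /=.
  - by rewrite block_mxEul !mxE lperm_lshift (inj_eq (@lshift_inj _ _)).
  - by rewrite block_mxEur !mxE lperm_lshift eq_lrshift.
  - by rewrite block_mxEdl !mxE lperm_rshift eq_rlshift.
  - by rewrite block_mxEdr !mxE lperm_rshift (inj_eq (@rshift_inj _ _)).
by rewrite det_ublock det1 mulr1.
Qed.

Definition rperm_fun k l (r : 'S_l) (x : 'I_(k + l)) : 'I_(k + l) :=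
  match fintype.split x with inl i => lshift l i | inr j => rshift k (r j) end.

Lemma rperm_inj k l (r : 'S_l) : injective (@rperm_fun k l r).
Proof.
apply: (@can_inj _ _ _ (rperm_fun (r^-1)%g)) => x.
rewrite /rperm_fun -[x]splitK; case: (fintype.split x) => j /=.
  by rewrite !(unsplitK (inl _)).
by rewrite !(unsplitK (inr _)) permK.
Qed.

Definition rperm k l (r : 'S_l) : 'S_(k + l) := perm (@rperm_inj k l r).

Lemma rperm_lshift k l (r : 'S_l) i : rperm k r (lshift l i) = lshift l i.
Proof. by rewrite permE /rperm_fun (unsplitK (inl _)). Qed.

Lemma rperm_rshift k l (r : 'S_l) j : rperm k r (rshift k j) = rshift k (r j).
Proof. by rewrite permE /rperm_fun (unsplitK (inr _)). Qed.

Lemma sign_rperm k l (r : 'S_l) : (-1) ^+ rperm k r = (-1) ^+ r :> R.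
Proof.
rewrite -!det_perm.
have -> : perm_mx (rperm k r) = block_mx 1%:M 0 0 (perm_mx r) :> 'M[R]_(k + l).
  apply/matrixP => i j; rewrite -[i]splitK -[j]splitK.
  case: (fintype.split i) => i'; case: (fintype.split j) => j' /=.
  - by rewrite block_mxEul !mxE rperm_lshift (inj_eq (@lshift_inj _ _)).
  - by rewrite block_mxEur !mxE rperm_lshift eq_lrshift.
  - by rewrite block_mxEdl !mxE rperm_rshift eq_rlshift.
  - by rewrite block_mxEdr !mxE rperm_rshift (inj_eq (@rshift_inj _ _)).
by rewrite det_ublock det1 mul1r.
Qed.

Definition tprod k l (S : tens R k) (T : tens R l) : tens R (k + l) :=
  fun b => S [ffun i => b (lshift l i)] * T [ffun j => b (rshift k j)].

(** Each inner permutation contributes one full alternation: its sign cancels the sign by which it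
    changes the outer one. *)
Lemma alt_tprodl k l (S : tens R k) (T : tens R l) a :
  alt (tprod (alt S) T) a = k`!%:R * alt (tprod S T) a.
Proof.
transitivity (\sum_(r : 'S_k) alt (tprod S T) a); last first.
  by rewrite sumr_const card_Sn mulr_natl.
transitivity (\sum_(r : 'S_k) (-1) ^+ r *
   alt (fun b => tprod S T [ffun x => b (lperm l r x)]) a); last first.
  apply: eq_bigr => r _.
  by rewrite alt_permr sign_lperm mulrA -expr2 sqrr_sign mul1r.
rewrite /alt; under [RHS]eq_bigr do rewrite big_distrr /=.
rewrite exchange_big /=; apply: eq_bigr => s _.
rewrite {1}/tprod big_distrl big_distrr /=; apply: eq_bigr => r _.
rewrite /tprod [in RHS]mulrCA -(mulrA _ (S _)); congr (_ * (_ * (S _ * T _))).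
  by apply/ffunP => x; rewrite !ffunE lperm_lshift.
by apply/ffunP => x; rewrite !ffunE lperm_rshift.
Qed.

Lemma alt_tprodr k l (S : tens R k) (T : tens R l) a :
  alt (tprod S (alt T)) a = l`!%:R * alt (tprod S T) a.
Proof.
transitivity (\sum_(r : 'S_l) alt (tprod S T) a); last first.
  by rewrite sumr_const card_Sn mulr_natl.
transitivity (\sum_(r : 'S_l) (-1) ^+ r *
   alt (fun b => tprod S T [ffun x => b (rperm k r x)]) a); last first.
  apply: eq_bigr => r _.
  by rewrite alt_permr sign_rperm mulrA -expr2 sqrr_sign mul1r.
rewrite /alt; under [RHS]eq_bigr do rewrite big_distrr /=.
rewrite exchange_big /=; apply: eq_bigr => s _.
rewrite {1}/tprod !big_distrr /=; apply: eq_bigr => r _.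
rewrite /tprod [S _ * (_ * _)]mulrCA [in RHS]mulrCA.
congr (_ * (_ * (S _ * T _))).
  by apply/ffunP => x; rewrite !ffunE rperm_lshift.
by apply/ffunP => x; rewrite !ffunE rperm_rshift.
Qed.

Definition ix_cons k (x : 'I_7) (b : ix k) : ix k.+1 :=
  [ffun j => if unlift ord0 j is Some i then b i else x].

Lemma ix_cons0 k x (b : ix k) : ix_cons x b ord0 = x.
Proof. by rewrite ffunE unlift_none. Qed.

Lemma ix_consS k x (b : ix k) j : ix_cons x b (lift ord0 j) = b j.
Proof. by rewrite ffunE liftK. Qed.

Lemma sum_perm_lift k (F : 'S_k.+1 -> R) :
  \sum_s F s = \sum_j \sum_s F (lift_perm ord0 j s).
Proof.
rewrite pair_big /=.
pose h (p : 'I_k.+1 * 'S_k) := lift_perm ord0 p.1 p.2.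
have hI : injective h.
  move=> [j s] [j' s'] /permP e.
  have := e ord0; rewrite !lift_perm_id /= => ej; subst j'.
  congr pair; apply/permP => x; have := e (lift ord0 x).
  by rewrite !lift_perm_lift => /lift_inj.
rewrite (reindex h) //.
by apply/onW_bij/inj_card_bij => //; rewrite card_prod card_ord !card_Sn factS.
Qed.

(** Laplace expansion: permutations are grouped by the image [j] of the first slot, and [lift_perm]
    contributes the sign [(-1) ^+ j]. *)
Lemma alt_expand k (T : tens R k.+1) (a : ix k.+1) :
  alt T a = \sum_(j < k.+1) (-1) ^+ j *
    alt (fun b => T (ix_cons (a j) b)) [ffun i => a (lift j i)].
Proof.
rewrite /alt sum_perm_lift; apply: eq_bigr => j _.
rewrite big_distrr; apply: eq_bigr => s _ /=.
rewrite mulrA odd_lift_perm addFb signr_addb signr_odd; congr (_ * T _).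
apply/ffunP => x; rewrite !ffunE.
by case: unliftP => [i|] ->; rewrite ?lift_perm_lift ?lift_perm_id ?ffunE.
Qed.

Lemma wedgeE k l (S : tens R k) (T : tens R l) a :
  wedge S T a = ((k`! * l`!)%:R)^-1 * alt (tprod S T) a.
Proof. by []. Qed.

Lemma wedge_antisym k l (S : tens R k) (T : tens R l) : antisym (wedge S T).
Proof. by move=> s a; rewrite !wedgeE alt_perm mulrCA. Qed.

Lemma factr_neq0 k : k`!%:R != 0 :> R.
Proof. by rewrite pnatr_eq0 -lt0n fact_gt0. Qed.

Lemma antisym_eq0 k (T : tens R k) (a : ix k) i j :
  antisym T -> i != j -> a i = a j -> T a = 0.
Proof.
move=> aT nij e; have := aT (tperm i j) a.
have -> : [ffun x => a (tperm i j x)] = a.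
  by apply/ffunP => x; rewrite ffunE; case: tpermP => // ->.
rewrite odd_tperm nij expr1 mulN1r => /eqP.
by rewrite -addr_eq0 -mulr2n mulrn_eq0 /= => /eqP.
Qed.

(** An index with a repetition gives 0 on both sides; any other one is sorted by a permutation,
    which changes both sides by the same sign. *)
Lemma antisym_ext k (S T : tens R k) : antisym S -> antisym T ->
  (forall a : ix k, (forall i j : 'I_k, (i < j)%N -> (a i < a j)%N) -> S a = T a) ->
  S =1 T.
Proof.
move=> aS aT H a.
have [aI|/injectivePn [i [j nij e]]] := boolP (injectiveb a); last first.
  by rewrite (antisym_eq0 aS nij e) (antisym_eq0 aT nij e).
pose t := [tuple nat_of_ord (a i) | i < k].
have /tuple_permP [s es] : perm_eq (sort_tuple leq t) t by rewrite /= perm_sort.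
have tn i : tnth t i = a i by rewrite tnth_mktuple.
pose b : ix k := [ffun x => a (s x)].
have bE i : nat_of_ord (b i) = tnth (sort_tuple leq t) i.
  have -> : sort_tuple leq t = [tuple tnth t (s i) | i < k] by apply: val_inj.
  by rewrite ffunE tnth_mktuple tn.
have so : sorted leq (sort_tuple leq t) by apply: sort_sorted; apply: leq_total.
have Hb : S b = T b.
  apply: H => i j ij; rewrite ltn_neqAle; apply/andP; split.
    apply/eqP => /val_inj; rewrite !ffunE => /(injectiveP _ aI) /perm_inj eij.
    by rewrite eij ltnn in ij.
  rewrite !bE !(tnth_nth 0%N).
  apply: (sorted_leq_nth leq_trans leqnn) => //; rewrite ?inE ?size_tuple //.
  exact: ltnW.
by apply: (mulfI (_ : (-1) ^+ s != 0)); rewrite ?signr_eq0 // -aS -aT.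
Qed.

End Alternation.

(** * Change of frame *)

Section Frames.
Variable R : realType.
Implicit Types (k l : nat) (P Q : 'M[R]_7).

(** Components of [T] in the frame formed by the rows of [P]. Raising indices ([P] the inverse Gram
    matrix) and changing charts ([P] a Jacobian) are instances. *)
Definition pull k P (T : tens R k) : tens R k :=
  fun a => \sum_(b : ix k) (\prod_(i < k) P (a i) (b i)) * T b.

Lemma eq_pull k P (S T : tens R k) a : S =1 T -> pull P S a = pull P T a.
Proof. by move=> e; apply: eq_bigr => b _; rewrite e. Qed.

Lemma pullD k P (S T : tens R k) a :
  pull P (fun b => S b + T b) a = pull P S a + pull P T a.
Proof. by rewrite -big_split /=; apply: eq_bigr => b _; rewrite mulrDr. Qed.

Lemma pullZ k P x (T : tens R k) a :
  pull P (fun b => x * T b) a = x * pull P T a.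
Proof. by rewrite big_distrr /=; apply: eq_bigr => b _; rewrite mulrCA. Qed.

Lemma pull_alt k P (T : tens R k) a : pull P (alt T) a = alt (pull P T) a.
Proof.
rewrite /alt /pull; under eq_bigr do rewrite big_distrr /=.
rewrite exchange_big /=; apply: eq_bigr => s _.
rewrite [in RHS](reindex_inj (h := fun b : ix k => [ffun x => b (s x)])) /=; last first.
  move=> b c /ffunP e; apply/ffunP => x.
  by have := e (s^-1%g x); rewrite !ffunE permKV.
rewrite big_distrr /=; apply: eq_bigr => b _; rewrite mulrCA; congr (_ * (_ * _)).
rewrite (reindex_inj (@perm_inj _ s)) /=.
by apply: eq_bigr => i _; rewrite !ffunE.
Qed.

Lemma pull_antisym k P (T : tens R k) : antisym T -> antisym (pull P T).
Proof.
move=> aT s a; apply: (mulfI (factr_neq0 R k)).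
have e b : k`!%:R * pull P T b = alt (pull P T) b.
  by rewrite -pull_alt -pullZ; apply: eq_pull => c; rewrite altE_antisym.
by rewrite mulrCA !e alt_perm.
Qed.

Lemma pull_pull k P Q (T : tens R k) a : pull P (pull Q T) a = pull (P *m Q) T a.
Proof.
rewrite /pull; under eq_bigr do rewrite big_distrr /=.
rewrite exchange_big /=; apply: eq_bigr => c _.
under eq_bigr do rewrite mulrA.
rewrite -big_distrl /=; congr (_ * _).
under [RHS]eq_bigr do rewrite mxE.
rewrite bigA_distr_bigA /=; apply: eq_bigr => b _.
by rewrite -big_split.
Qed.

Lemma pull1 k (T : tens R k) a : pull 1%:M T a = T a.
Proof.
rewrite /pull (bigD1 a) //= [X in _ + X]big1 ?addr0 => [|b nb].
  by rewrite big1 ?mul1r // => i _; rewrite mxE eqxx.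
have /existsP [i ni] : [exists i, a i != b i].
  apply: contra_neqT nb => /existsPn H; apply/ffunP => i.
  by have /negPn/eqP := H i.
by rewrite (bigD1 i) //= mxE (negPf ni) !mul0r.
Qed.

Lemma sum_ix_cat k l (F : ix (k + l) -> R) :
  \sum_c F c = \sum_a \sum_b F (ix_cat a b).
Proof.
rewrite pair_big /=.
rewrite (reindex (fun p : ix k * ix l => ix_cat p.1 p.2)) //=.
exists (fun c : ix (k + l) =>
    ([ffun i => c (lshift l i)] : ix k, [ffun j => c (rshift k j)] : ix l)).
  move=> [a b] _; congr pair; apply/ffunP => i.
    by rewrite !ffunE (unsplitK (inl _)).
  by rewrite !ffunE (unsplitK (inr _)).
move=> c _; apply/ffunP => x; rewrite ffunE -[x in RHS]splitK.
by case: (fintype.split x) => j; rewrite ffunE.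
Qed.

Lemma ix_cat_lshift k l (a : ix k) (b : ix l) i : ix_cat a b (lshift l i) = a i.
Proof. by rewrite ffunE (unsplitK (inl _)). Qed.

Lemma ix_cat_rshift k l (a : ix k) (b : ix l) i : ix_cat a b (rshift k i) = b i.
Proof. by rewrite ffunE (unsplitK (inr _)). Qed.

Lemma tprod_cat k l (S : tens R k) (T : tens R l) a b :
  tprod S T (ix_cat a b) = S a * T b.
Proof.
rewrite /tprod; congr (S _ * T _); apply/ffunP => i.
  by rewrite ffunE ix_cat_lshift.
by rewrite ffunE ix_cat_rshift.
Qed.

Lemma pull_tprod k l P (S : tens R k) (T : tens R l) a :
  pull P (tprod S T) a = tprod (pull P S) (pull P T) a.
Proof.
rewrite /pull sum_ix_cat /tprod big_distrl /=; apply: eq_bigr => b _.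
rewrite big_distrr /=; apply: eq_bigr => c _.
rewrite -/(tprod S T (ix_cat b c)) tprod_cat big_split_ord /= mulrACA.
congr (_ * _ * (_ * _)); apply: eq_bigr => i _.
  by rewrite ix_cat_lshift ffunE.
by rewrite ix_cat_rshift ffunE.
Qed.

Lemma pull_wedge k l P (S : tens R k) (T : tens R l) a :
  pull P (wedge S T) a = wedge (pull P S) (pull P T) a.
Proof.
transitivity (pull P (fun b => ((k`! * l`!)%:R)^-1 * alt (tprod S T) b) a).
  by apply: eq_pull.
by rewrite pullZ pull_alt wedgeE; congr (_ * _); apply: eq_alt => b; rewrite pull_tprod.
Qed.

Lemma sum_ixS k (F : ix k.+1 -> R) :
  \sum_c F c = \sum_x \sum_(b : ix k) F (ix_cons x b).
Proof.
rewrite pair_big /= (reindex (fun p : 'I_7 * ix k => ix_cons p.1 p.2)) //=.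
exists (fun c : ix k.+1 => (c ord0, [ffun i => c (lift ord0 i)] : ix k)).
  move=> [x b] _ /=; rewrite ix_cons0; congr pair.
  by apply/ffunP => i; rewrite !ffunE liftK.
by move=> c _; apply/ffunP => i /=; rewrite ffunE; case: unliftP => [j|] ->; rewrite ?ffunE.
Qed.

Lemma ix0E (b c : ix 0) : b = c.
Proof. by apply/ffunP => -[]. Qed.

Lemma sum_ix0 (F : ix 0 -> R) (b : ix 0) : \sum_c F c = F b.
Proof.
by rewrite (big_pred1 b) // => c; rewrite (ix0E c b) /= eqxx.
Qed.

Lemma ix_cons_ix1 x (b : ix 0) : ix_cons x b = ix1 x.
Proof. by apply/ffunP => i; rewrite !ord1 ix_cons0 ffunE. Qed.

Lemma ix_cons_ix2 x y : ix_cons x (ix1 y) = ix2 x y.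
Proof. by apply/ffunP => i; rewrite !ffunE; case: unliftP => [j|] ->; rewrite ?ffunE. Qed.

Lemma sum_ix1 (F : ix 1 -> R) : \sum_c F c = \sum_x F (ix1 x).
Proof.
rewrite sum_ixS; apply: eq_bigr => x _.
by rewrite (sum_ix0 _ [ffun=> ord0]) ix_cons_ix1.
Qed.

Lemma sum_ix2 (F : ix 2 -> R) : \sum_c F c = \sum_x \sum_y F (ix2 x y).
Proof.
rewrite sum_ixS; apply: eq_bigr => x _; rewrite sum_ix1.
by apply: eq_bigr => y _; rewrite ix_cons_ix2.
Qed.

Lemma pull_ix1 P (T : tens R 1) x :
  pull P T (ix1 x) = \sum_y P x y * T (ix1 y).
Proof.
by rewrite /pull sum_ix1; apply: eq_bigr => y _; rewrite big_ord1 !ffunE.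
Qed.

Lemma pull_ix2 P (T : tens R 2) x y :
  pull P T (ix2 x y) = \sum_c \sum_d P x c * P y d * T (ix2 c d).
Proof.
rewrite /pull sum_ix2; apply: eq_bigr => c _; apply: eq_bigr => d _.
by rewrite !big_ord_recl big_ord0 mulr1 !ffunE.
Qed.

Lemma sum_pull_adj k P (S T : tens R k) :
  \sum_a pull P^T S a * T a = \sum_a S a * pull P T a.
Proof.
rewrite /pull; under eq_bigr do rewrite big_distrl /=.
rewrite exchange_big /=; apply: eq_bigr => b _.
rewrite big_distrr /=; apply: eq_bigr => a _.
rewrite [_ * S b]mulrC -mulrA; congr (_ * (_ * _)).
by apply: eq_bigr => i _; rewrite mxE.
Qed.

(** The Levi-Civita symbol, in the form in which it occurs in [volume]. *)
Definition eps : tens R 7 := fun a => \det (\matrix_(i, j) (a i == j)%:R : 'M[R]_7).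

Lemma epsE a : eps a = alt (fun b : ix 7 => \prod_i (b i == i)%:R) a.
Proof.
rewrite /eps -det_tr; apply: eq_bigr => s _; congr (_ * _).
by apply: eq_bigr => i _; rewrite !mxE ffunE.
Qed.

Lemma eps_antisym : antisym eps.
Proof. by move=> s a; rewrite !epsE alt_perm. Qed.

Lemma eps_id : eps [ffun i => i] = 1.
Proof.
rewrite /eps -[RHS](det1 R 7); congr (\det _).
by apply/matrixP => i j; rewrite !mxE ffunE.
Qed.

(** An injective index of length 7 with values in ['I_7] is a permutation, so that top forms are
    one-dimensional. *)
Lemma antisym7E (T : tens R 7) a : antisym T -> T a = T [ffun i => i] * eps a.
Proof.
move=> aT; have [aI|/injectivePn [i [j nij e]]] := boolP (injectiveb a); last first.
  by rewrite (antisym_eq0 aT nij e) (antisym_eq0 eps_antisym nij e) mulr0.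
have aJ := injectiveP _ aI.
have -> : a = [ffun x => [ffun i => i] (perm aJ x)].
  by apply/ffunP => x; rewrite !ffunE permE.
by rewrite aT eps_antisym eps_id mulr1 mulrC.
Qed.

(** Only the value at the identity index matters, and there the sum is the Leibniz formula for the
    determinant of the transpose of [P]. *)
Lemma pull_eps P a : pull P eps a = \det P * eps a.
Proof.
rewrite (antisym7E _ (pull_antisym P eps_antisym)); congr (_ * _).
rewrite /pull -[in RHS]det_tr; under eq_bigr do rewrite epsE /alt big_distrr.
rewrite exchange_big /=; apply: eq_bigr => s _.
pose c : ix 7 := [ffun i => (s^-1)%g i].
rewrite (bigD1 c) //= [X in _ + X]big1 ?addr0 => [|b nb].
  rewrite mulrC -mulrA; congr (_ * _).
  rewrite [X in X * _]big1 ?mul1r => [|i _]; last by rewrite !ffunE permK eqxx.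
  rewrite (reindex_inj (@perm_inj _ s)) /=; apply: eq_bigr => i _.
  by rewrite mxE !ffunE permK.
have /existsP [i ni] : [exists i, b (s i) != i].
  apply: contra_neqT nb => /existsPn H; apply/ffunP => i.
  by have /negPn/eqP := H ((s^-1)%g i); rewrite permKV ffunE.
by rewrite [X in _ * (_ * X)](bigD1 i) //= ffunE (negPf ni) !(mul0r, mulr0).
Qed.

Section OrthonormalFrame.
Variables (g : tens R 2) (o : tens R 7) (P : 'M[R]_7).
Hypotheses (Pg : P *m gram g *m P^T = 1%:M).

Lemma frame_unit : P \in unitmx.
Proof. by have [] := mulmx1_unit (etrans (mulmxA _ _ _) Pg). Qed.

Lemma frame_invmx : invmx (gram g) = P^T *m P.
Proof.
have e : gram g *m (P^T *m P) = 1%:M.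
  by rewrite mulmxA; apply: mulmx1C; rewrite mulmxA.
have [gu _] := mulmx1_unit e.
by rewrite -[LHS]mulmx1 -e mulKmx.
Qed.

Lemma frame_raise k (T : tens R k) a : raise g T a = pull P^T (pull P T) a.
Proof. by rewrite pull_pull -frame_invmx. Qed.

Lemma frame_fnorm k (T : tens R k) :
  fnorm g T = Num.sqrt ((k`!%:R)^-1 * \sum_(a : ix k) pull P T a ^+ 2).
Proof.
rewrite /fnorm; congr (Num.sqrt (_ * _)).
transitivity (\sum_a pull P^T (pull P T) a * T a).
  by apply: eq_bigr => a _; rewrite frame_raise mulrC.
by rewrite sum_pull_adj; apply: eq_bigr => a _; rewrite expr2.
Qed.

Hypotheses (ao : antisym o) (Po : 0 < pull P o [ffun i => i]).

(** The square root of the Gram determinant is the inverse of [|\det P|]; positivity of [o] on the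
    frame forces the sign of [o] in the chart to be that of [\det P], which removes the absolute
    value. *)
Lemma frame_volume a : pull P (volume g o) a = eps a.
Proof.
have po : pull P o [ffun i => i] = o [ffun i => i] * \det P.
  rewrite (eq_pull _ _ (fun a => antisym7E a ao)) (pullZ P _ eps) pull_eps.
  by rewrite eps_id mulr1.
have dP : \det P != 0 by have := frame_unit; rewrite unitmxE unitfE.
have dg : \det (gram g) = (\det P)^-1 ^+ 2.
  have := congr1 determinant Pg; rewrite !det_mulmx det_tr det1 => e.
  by apply: (mulfI dP); apply: (mulIf dP); rewrite e; field.
rewrite /volume -/(eps _) (pullZ P _ eps) pull_eps mulrA -[RHS]mul1r; congr (_ * _).
rewrite dg sqrtr_sqr normfV.
have -> : Num.sg (o [ffun i => i]) = Num.sg (\det P).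
  move: Po; rewrite po => h; have := gtr0_sg h; rewrite sgrM => e.
  have sd : Num.sg (\det P) * Num.sg (\det P) = 1.
    by rewrite -expr2 sqr_sg dP.
  by rewrite -[LHS]mulr1 -sd mulrA e mul1r.
have nP : `|\det P| != 0 by rewrite normr_eq0.
rewrite -[X in _ * X]mulr_sg_norm mulrACA -expr2 sqr_sg dP mul1r.
by rewrite mulVf.
Qed.

(** Raising with [P^T *m P] leaves one factor [P] on [T] and, by adjunction, one on the contracted
    slots of the volume form, whose free slots receive theirs from the outer [pull]. *)
Lemma frame_hodge k l (h7 : (k + l = 7)%N) (T : tens R k) a :
  pull P (hodge h7 g o T) a = (k`!%:R)^-1 * \sum_(b : ix k) pull P T b *
     eps [ffun i => ix_cat b a (cast_ord (esym h7) i)].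
Proof.
pose W (c : ix (k + l)) : ix 7 := [ffun i => c (cast_ord (esym h7) i)].
have volW (c : ix (k + l)) : \sum_(d : ix (k + l)) (\prod_i P (c i) (d i)) * volume g o (W d) = eps (W c).
  rewrite -frame_volume /pull (reindex (fun d : ix 7 => [ffun i => d (cast_ord h7 i)] : ix (k + l))) /=.
    apply: eq_bigr => d _; congr (_ * volume g o _).
      rewrite (reindex (cast_ord (esym h7))) /=.
        by apply: eq_bigr => i _; rewrite !ffunE cast_ordKV.
      by exists (cast_ord h7) => i _; rewrite ?cast_ordK ?cast_ordKV.
    by apply/ffunP => i; rewrite !ffunE cast_ordKV.
  by exists W => d _; apply/ffunP => i; rewrite !ffunE ?cast_ordK ?cast_ordKV.
rewrite /hodge.
rewrite (pullZ P (k`!%:R)^-1 (fun a => \sum_b raise g T b * volume g o (W (ix_cat b a)))).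
congr (_ * _); rewrite /pull.
under eq_bigr do rewrite big_distrr /=.
rewrite exchange_big /=.
transitivity (\sum_b pull P^T (pull P T) b *
     \sum_(c : ix l) (\prod_i P (a i) (c i)) * volume g o (W (ix_cat b c))).
  apply: eq_bigr => b _; rewrite big_distrr /=; apply: eq_bigr => c _.
  by rewrite frame_raise mulrCA.
rewrite sum_pull_adj; apply: eq_bigr => b _; congr (_ * _).
rewrite -volW sum_ix_cat /pull; apply: eq_bigr => c _.
rewrite big_distrr /=; apply: eq_bigr => d _.
rewrite mulrA big_split_ord /=; congr (_ * _ * _).
  by apply: eq_bigr => i _; rewrite !ix_cat_lshift.
by apply: eq_bigr => i _; rewrite !ix_cat_rshift.
Qed.

End OrthonormalFrame.

End Frames.

(** * Forms with integer coefficients *)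

Section BasisForms.
Variable R : realType.
Implicit Types (k l : nat) (I J s : seq nat).

(** The tensor product of the dual basis vectors listed in [I]. The default 7 is no index, so that a
    list which is too short gives 0. *)
Definition delta k I : tens R k :=
  fun b => \prod_(l < k) (nat_of_ord (b l) == nth 7%N I l)%:R.

Definition eform k I : tens R k := alt (@delta k I).
Arguments delta k I b : clear implicits.
Arguments eform k I a : clear implicits.

Lemma eform_antisym k I : antisym (eform k I).
Proof. exact: alt_antisym. Qed.

Lemma tprod_delta k l I J b : size I = k ->
  tprod (@delta k I) (@delta l J) b = @delta (k + l) (I ++ J) b.
Proof.
move=> sI; rewrite /tprod /delta big_split_ord /=; congr (_ * _).
  by apply: eq_bigr => i _; rewrite ffunE nth_cat sI ltn_ord.
apply: eq_bigr => i _; rewrite ffunE nth_cat sI ltnNge leq_addr /=.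
by rewrite addKn.
Qed.

Lemma wedge_eform k l I J a : size I = k ->
  wedge (eform k I) (eform l J) a = eform (k + l) (I ++ J) a.
Proof.
move=> sI; rewrite wedgeE alt_tprodl alt_tprodr natrM [k`!%:R * (_ * _)]mulrA mulrA mulVf ?mul1r.
  by apply: eq_alt => b; rewrite tprod_delta.
by rewrite mulf_neq0 ?factr_neq0.
Qed.

(** Multi-indices as lists, on which [fdet] and the exhaustive checks compute. *)
Definition lst k (a : ix k) : seq nat := [seq nat_of_ord (a i) | i <- enum 'I_k].

Lemma size_lst k (a : ix k) : size (lst a) = k.
Proof. by rewrite size_map size_enum_ord. Qed.

Lemma nth_lst k (a : ix k) (i : 'I_k) : nth 7%N (lst a) i = a i.
Proof. by rewrite (nth_map i) ?size_enum_ord // nth_ord_enum. Qed.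

Lemma lst_lift k (a : ix k.+1) (j : 'I_k.+1) :
  lst [ffun i => a (lift j i)] = take j (lst a) ++ drop j.+1 (lst a).
Proof.
have szt : size (take j (lst a)) = j by rewrite size_takel // size_lst; apply: ltnW.
have sz : size (take j (lst a) ++ drop j.+1 (lst a)) = k.
  by rewrite size_cat szt size_drop size_lst; have := ltn_ord j; lia.
apply: (@eq_from_nth _ 7%N); rewrite ?size_lst ?sz // => i ik.
rewrite (nth_lst _ (Ordinal ik)) ffunE nth_cat szt.
rewrite -nth_lst /= /bump; case: (ltnP i j) => ij.
  by rewrite nth_take.
by rewrite nth_drop add1n; congr nth; lia.
Qed.

Definition sumz (s : seq int) : int := foldr +%R 0 s.

(* Determinant of the 0/1 matrix with entries [s_l = I_m], by expansion along
   the row of the first entry of [I]; it computes. *)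
Fixpoint fdet I s : int :=
  if I is i :: I' then
    sumz [seq (if nth 7%N s j == i then
                 (if odd j then -1 else 1) * fdet I' (take j s ++ drop j.+1 s)
               else 0) | j <- iota 0 (size s)]
  else 1.

Lemma eformE k I (a : ix k) : size I = k -> eform k I a = (fdet I (lst a))%:~R.
Proof.
elim: I k a => [|i I IH] k a /= sI; subst k.
  rewrite /eform /alt (big_pred1 1%g) => [|s]; last first.
    by rewrite /= permS0 eqxx.
  by rewrite odd_perm1 mul1r /delta big_ord0.
rewrite /eform alt_expand /sumz foldrE big_map size_lst.
have -> : iota 0 (size I).+1 = index_iota 0 (size I).+1 by rewrite /index_iota subn0.
rewrite big_mkord rmorph_sum /=.
apply: eq_bigr => j _; rewrite nth_lst.
transitivity ((-1) ^+ j * ((nat_of_ord (a j) == i)%:R *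
    eform (size I) I [ffun i0 => a (lift j i0)])).
  congr (_ * _); rewrite /eform /alt big_distrr /=.
  apply: eq_bigr => s _; rewrite mulrCA; congr (_ * _).
  rewrite /delta big_ord_recl ix_cons0 /=; congr (_ * _).
  by apply: eq_bigr => l _; rewrite ix_consS.
rewrite IH // lst_lift; case: eqP => _; last by rewrite mul0r mulr0.
rewrite mul1r rmorphM /=; congr (_ * _).
by rewrite -signr_odd; case: (odd j).
Qed.

(* The form with constant coefficients that is the sum of the c e^I for the pairs
   (c, I) of L; [formv] evaluates it on a list of basis vectors, by computation. *)
Definition zform k (L : seq (int * seq nat)) : tens R k :=
  fun a => \sum_(p <- L) p.1%:~R * eform k p.2 a.

Definition formv (L : seq (int * seq nat)) s : int :=
  sumz [seq p.1 * fdet p.2 s | p <- L].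

Definition wf k (L : seq (int * seq nat)) := all (fun p => size p.2 == k) L.

Lemma formE k L (a : ix k) : wf k L -> zform L a = (formv L (lst a))%:~R.
Proof.
move=> /allP wL; rewrite /formv /sumz foldrE big_map rmorph_sum /=.
rewrite /zform !big_seq; apply: eq_bigr => p /wL /eqP sp.
by rewrite rmorphM /= eformE.
Qed.

Lemma form_antisym k L : antisym (@zform k L).
Proof.
move=> s a; rewrite /zform big_distrr /=; apply: eq_bigr => p _.
by rewrite eform_antisym mulrCA.
Qed.

Definition mulL (L L' : seq (int * seq nat)) :=
  [seq (p.1 * q.1, p.2 ++ q.2) | p <- L, q <- L'].

Lemma eq_wedge k l (S S' : tens R k) (T T' : tens R l) a :
  S =1 S' -> T =1 T' -> wedge S T a = wedge S' T' a.
Proof. by move=> /funext -> /funext ->. Qed.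

Lemma wedge_suml k l (A : Type) (r : seq A) (c : A -> R) (S : A -> tens R k)
    (T : tens R l) a :
  wedge (fun b => \sum_(p <- r) c p * S p b) T a = \sum_(p <- r) c p * wedge (S p) T a.
Proof.
rewrite wedgeE /alt [RHS](eq_bigr (fun p => ((k`! * l`!)%:R)^-1 * \sum_(s : 'S_(k + l)) (-1) ^+ s *
   (c p * tprod (S p) T [ffun x => a (s x)]))); last first.
  move=> p _; rewrite wedgeE mulrCA; congr (_ * _); rewrite big_distrr /=.
  by apply: eq_bigr => s _; rewrite mulrCA.
rewrite -big_distrr /=; congr (_ * _).
rewrite exchange_big /=; apply: eq_bigr => s _.
rewrite -big_distrr /= /tprod; congr (_ * _).
by rewrite big_distrl /=; apply: eq_bigr => p _; rewrite mulrA.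
Qed.

Lemma wedge_sumr k l (A : Type) (r : seq A) (c : A -> R) (S : tens R k)
    (T : A -> tens R l) a :
  wedge S (fun b => \sum_(p <- r) c p * T p b) a = \sum_(p <- r) c p * wedge S (T p) a.
Proof.
rewrite wedgeE /alt [RHS](eq_bigr (fun p => ((k`! * l`!)%:R)^-1 * \sum_(s : 'S_(k + l)) (-1) ^+ s *
   (c p * tprod S (T p) [ffun x => a (s x)]))); last first.
  move=> p _; rewrite wedgeE mulrCA; congr (_ * _); rewrite big_distrr /=.
  by apply: eq_bigr => s _; rewrite mulrCA.
rewrite -big_distrr /=; congr (_ * _).
rewrite exchange_big /=; apply: eq_bigr => s _.
rewrite -big_distrr /= /tprod; congr (_ * _).
by rewrite big_distrr /=; apply: eq_bigr => p _; rewrite mulrCA.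
Qed.

Lemma wedge_form k l L L' a : wf k L ->
  wedge (@zform k L) (@zform l L') a = @zform (k + l) (mulL L L') a.
Proof.
move=> /allP wL; rewrite wedge_suml /zform /mulL big_allpairs_dep /=.
rewrite !big_seq; apply: eq_bigr => p /wL /eqP sp.
rewrite wedge_sumr big_distrr /=; apply: eq_bigr => q _.
by rewrite wedge_eform // rmorphM /= mulrA.
Qed.

Definition to_ix k I : ix k := [ffun l : 'I_k => inord (nth 0%N I l)].

Lemma lst_to_ix k I : size I = k -> all (fun x => (x < 7)%N) I -> lst (to_ix k I) = I.
Proof.
move=> sI /allP I7; apply: (@eq_from_nth _ 7%N); rewrite ?size_lst ?sI // => i ik.
rewrite (nth_lst _ (Ordinal ik)) ffunE /= (set_nth_default 7%N) ?sI // inordK //.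
by apply: I7; rewrite mem_nth // sI.
Qed.

Lemma lst_cat k l (a : ix k) (b : ix l) : lst (ix_cat a b) = lst a ++ lst b.
Proof.
apply: (@eq_from_nth _ 7%N); rewrite ?size_cat ?size_lst // => i ik.
rewrite (nth_lst _ (Ordinal ik)) -[Ordinal ik]splitK.
case: fintype.splitP => j /= ej.
  by rewrite ix_cat_lshift nth_cat size_lst ej ltn_ord nth_lst.
rewrite ix_cat_rshift nth_cat size_lst ej ltnNge leq_addr /=.
by rewrite addKn nth_lst.
Qed.

Lemma delta_lst k (a b : ix k) : delta k (lst a) b = (b == a)%:R.
Proof.
rewrite /delta; case: eqP => [->|/eqP nba].
  by rewrite big1 // => i _; rewrite nth_lst eqxx.
have /existsP [i ni] : [exists i, b i != a i].
  apply: contra_neqT nba => /existsPn H; apply/ffunP => i.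
  by have /negPn/eqP := H i.
by rewrite (bigD1 i) //= nth_lst val_eqE (negPf ni) mul0r.
Qed.

Lemma epsF : @eps R =1 @eform 7 (iota 0 7).
Proof.
move=> a; rewrite epsE; apply: eq_alt => b; apply: eq_bigr => i _.
by rewrite nth_iota.
Qed.

(** Only the rearrangements of [I] contribute, all equally: the signs from [eform] and from [E]
    cancel. *)
Lemma sum_eform_antisym k l (E : tens R (k + l)) (I : ix k) (a : ix l) :
  antisym E ->
  (k`!%:R)^-1 * \sum_b eform k (lst I) b * E (ix_cat b a) = E (ix_cat I a).
Proof.
move=> aE; apply: (mulfI (factr_neq0 R k)); rewrite mulrA mulfV ?factr_neq0 // mul1r.
rewrite /eform /alt; under eq_bigr do rewrite big_distrl /=.
rewrite exchange_big /= -[k`! in RHS]card_Sn -sumr_const big_distrl /=.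
apply: eq_bigr => s _; rewrite mul1r.
rewrite (bigD1 [ffun x => I ((s^-1)%g x)]) //= [X in _ + X]big1 ?addr0; last first.
  move=> b nb; rewrite delta_lst; case: eqP => [e|]; last by rewrite mulr0 mul0r.
  by case/eqP: nb; apply/ffunP => x; rewrite -e !ffunE permKV.
rewrite delta_lst; case: eqP => [_|[]]; last first.
  by apply/ffunP => x; rewrite !ffunE permK.
have -> : ix_cat [ffun x => I ((s^-1)%g x)] a =
   [ffun x => ix_cat I a (lperm l (s^-1)%g x)] :> ix (k + l).
  apply/ffunP => x; rewrite [RHS]ffunE -[x]splitK; case: (fintype.split x) => j /=.
    by rewrite lperm_lshift !ix_cat_lshift ffunE.
  by rewrite lperm_rshift !ix_cat_rshift.
by rewrite aE sign_lperm odd_permV mulr1 mulrA -expr2 sqrr_sign mul1r.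
Qed.

Definition wf7 k (L : seq (int * seq nat)) :=
  all (fun p => (size p.2 == k) && all (fun x => (x < 7)%N) p.2) L.

(** The Hodge star of the form [L] in an oriented orthonormal frame: each index list is put in front
    of the arguments of the Levi-Civita symbol. *)
Definition starv (L : seq (int * seq nat)) s : int :=
  sumz [seq p.1 * fdet (iota 0 7) (p.2 ++ s) | p <- L].

Lemma sum_form_eps k l (h7 : (k + l = 7)%N) L (a : ix l) : wf7 k L ->
  (k`!%:R)^-1 * \sum_(b : ix k) zform L b *
     @eps R [ffun i => ix_cat b a (cast_ord (esym h7) i)] = (starv L (lst a))%:~R.
Proof.
move=> /allP wL.
pose E : tens R (k + l) := eform (k + l) (iota 0 7).
have epsE' (c : ix (k + l)) : @eps R [ffun i => c (cast_ord (esym h7) i)] = E c.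
  have s7 : size (iota 0 7) = (k + l)%N by rewrite h7.
  rewrite epsF /E (eformE _ (erefl : size (iota 0 7) = 7%N)) (eformE _ s7).
  congr ((fdet (iota 0 7) _)%:~R).
  apply: (@eq_from_nth _ 7%N); rewrite ?size_lst // => i i7.
  rewrite (nth_lst _ (Ordinal i7)) ffunE.
  by rewrite -(nth_lst c).
under eq_bigr do rewrite epsE' /zform big_distrl /=.
rewrite exchange_big /= big_distrr /= /starv /sumz foldrE big_map rmorph_sum /=.
rewrite !big_seq; apply: eq_bigr => p /wL /andP[/eqP sp p7].
rewrite rmorphM /=; under eq_bigr do rewrite -mulrA.
rewrite -big_distrr /= mulrCA; congr (_ * _).
rewrite -{1}(lst_to_ix sp p7) sum_eform_antisym; last exact: eform_antisym.
by rewrite /E eformE ?lst_cat ?lst_to_ix // h7.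
Qed.

Fixpoint all_ix n : seq (seq nat) :=
  if n is n'.+1 then [seq x :: s | x <- iota 0 7, s <- all_ix n'] else [:: [::]].

Lemma lst_all_ix k (a : ix k) : lst a \in all_ix k.
Proof.
elim: k a => [|k IH] a; first by rewrite (size0nil (size_lst a)).
have -> : lst a = nat_of_ord (a ord0) :: lst [ffun i => a (lift ord0 i)].
  apply: (@eq_from_nth _ 7%N); rewrite /= ?size_lst // => -[|i] ik.
    by rewrite (nth_lst a ord0).
  rewrite (nth_lst a (Ordinal ik)) /= (nth_lst _ (Ordinal (ik : (i < k)%N))) ffunE.
  by congr (nat_of_ord (a _)); apply: val_inj.
apply/allpairsP; exists (nat_of_ord (a ord0), lst [ffun i => a (lift ord0 i)]).
by rewrite mem_iota ltn_ord IH.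
Qed.

End BasisForms.
Arguments eform {R} k I a.
Arguments zform {R k} L a.

(** The flat model: [e^0] is the Reeb direction, and with z_1 = e^1 + i e^2, z_2 = e^3 + i e^4, z_3
    = e^5 + i e^6 the forms [re0] and [im0] are the real and imaginary parts of z_1 /\ z_2 /\
    z_3. *)
Definition om0 : seq (int * seq nat) :=
  [:: (1, [:: 1; 2]%N); (1, [:: 3; 4]%N); (1, [:: 5; 6]%N)].
Definition re0 : seq (int * seq nat) :=
  [:: (1, [:: 1; 3; 5]%N); (-1, [:: 1; 4; 6]%N); (-1, [:: 2; 3; 6]%N); (-1, [:: 2; 4; 5]%N)].
Definition im0 : seq (int * seq nat) :=
  [:: (1, [:: 1; 3; 6]%N); (1, [:: 1; 4; 5]%N); (1, [:: 2; 3; 5]%N); (-1, [:: 2; 4; 6]%N)].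
Definition e0 : seq (int * seq nat) := [:: (1, [:: 0%N])].

(** * Bilinear and trilinear forms on vectors *)

Section Multilinear.
Variable R : realType.
Implicit Types (u v w : 'rV[R]_7).

Definition bil (S : tens R 2) u v : R := (u *m gram S *m v^T) 0 0.

Lemma bilZl S c u v : bil S (c *: u) v = c * bil S u v.
Proof. by rewrite /bil -!scalemxAl mxE. Qed.

Lemma bilDr S u v v' : bil S u (v + v') = bil S u v + bil S u v'.
Proof. by rewrite /bil linearD mulmxDr mxE. Qed.

Lemma bilZr S c u v : bil S u (c *: v) = c * bil S u v.
Proof. by rewrite /bil linearZ -scalemxAr mxE. Qed.

Lemma bilNr S u v : bil S u (- v) = - bil S u v.
Proof. by rewrite -scaleN1r bilZr mulN1r. Qed.

Lemma bilE S u v : bil S u v = \sum_a \sum_b u 0 a * v 0 b * S (ix2 a b).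
Proof.
rewrite /bil mxE exchange_big /=; apply: eq_bigr => b _.
rewrite mxE mxE big_distrl /=; apply: eq_bigr => a _.
by rewrite mxE mulrAC.
Qed.

Definition ix3 a b c : ix 3 := ix_cons a (ix2 b c).

Definition tri (T : tens R 3) u v w : R := bil (iprod u T) v w.

Lemma lift0_rshift k (j : 'I_k) : lift ord0 j = rshift 1 j.
Proof. exact: val_inj. Qed.

Lemma ord0_lshift k : ord0 = lshift k (ord0 : 'I_1).
Proof. exact: val_inj. Qed.

Lemma ix_cat1 k a (b : ix k) : ix_cat (ix1 a) b = ix_cons a b :> ix k.+1.
Proof.
apply/ffunP => i; rewrite [RHS]ffunE; case: unliftP => [j|] ->.
  by rewrite lift0_rshift; exact: (ix_cat_rshift (ix1 a) b j).
rewrite ord0_lshift; apply: etrans (ix_cat_lshift (ix1 a) b ord0) _.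
by rewrite ffunE.
Qed.

Lemma triE T u v w :
  tri T u v w = \sum_a \sum_b \sum_c u 0 a * v 0 b * w 0 c * T (ix3 a b c).
Proof.
rewrite /tri bilE exchange_big [RHS]exchange_big /=.
under [RHS]eq_bigr do rewrite exchange_big /=.
rewrite [RHS]exchange_big /=.
rewrite exchange_big /= [RHS]exchange_big /=; apply: eq_bigr => b _.
apply: eq_bigr => c _; rewrite /iprod big_distrr /=; apply: eq_bigr => a _.
by rewrite ix_cat1 /ix3; ring.
Qed.

Lemma ix2_tperm a b : ix2 b a = [ffun x => ix2 a b (tperm ord0 (lift ord0 ord0) x)].
Proof.
apply/ffunP => x; rewrite !ffunE; case: (unliftP ord0 x) => [j|] -> /=.
  by rewrite !ord1 tpermR.
by rewrite tpermL.
Qed.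

Lemma antisym2 (S : tens R 2) a b : antisym S -> S (ix2 b a) = - S (ix2 a b).
Proof. by move=> aS; rewrite ix2_tperm aS odd_tperm expr1 mulN1r. Qed.

Lemma antisym3r (T : tens R 3) a b c : antisym T -> T (ix3 a c b) = - T (ix3 a b c).
Proof.
move=> aT; rewrite -[RHS]mulN1r.
pose s := rperm 1 (tperm ord0 (lift ord0 ord0) : 'S_2).
have <- : (-1) ^+ s = -1 :> R by rewrite sign_rperm odd_tperm.
rewrite -aT; congr T; apply/ffunP => x; rewrite [RHS]ffunE /ix3.
case: (unliftP ord0 x) => [j|] ->.
  have -> : s (lift ord0 j) = lift ord0 (tperm ord0 (lift ord0 ord0) j).
    by rewrite (lift0_rshift j) [RHS]lift0_rshift; exact: (rperm_rshift 1 (tperm ord0 (lift ord0 ord0)) j).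
  by rewrite !ix_consS ix2_tperm ffunE.
have -> : s ord0 = ord0.
  by rewrite ord0_lshift; exact: (rperm_lshift (tperm ord0 (lift ord0 ord0)) ord0).
by rewrite !ix_cons0.
Qed.

Lemma antisym3l (T : tens R 3) a b c : antisym T -> T (ix3 b a c) = - T (ix3 a b c).
Proof.
move=> aT; rewrite -[RHS]mulN1r.
pose s : 'S_3 := tperm ord0 (lift ord0 ord0).
have <- : (-1) ^+ s = -1 :> R by rewrite odd_tperm.
rewrite -aT; congr T; apply/ffunP => x; rewrite [RHS]ffunE /ix3 /s.
case: (unliftP ord0 x) => [j|] ->; last by rewrite tpermL ix_cons0 ix_consS ffunE.
case: (unliftP ord0 j) => [i|] ->; last by rewrite tpermR ix_cons0 ix_consS ffunE.
by rewrite tpermD // !ix_consS !ffunE.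
Qed.

Lemma bil_antisym S u v : antisym S -> bil S v u = - bil S u v.
Proof.
move=> aS; rewrite !bilE exchange_big -sumrN /=; apply: eq_bigr => a _.
rewrite -sumrN; apply: eq_bigr => b _.
by rewrite (antisym2 a b aS) [v 0 b * _]mulrC mulrN.
Qed.

Lemma tri_swapr T u v w : antisym T -> tri T u w v = - tri T u v w.
Proof.
move=> aT; rewrite !triE -sumrN; apply: eq_bigr => a _.
rewrite exchange_big -sumrN; apply: eq_bigr => b _.
rewrite -sumrN; apply: eq_bigr => c _.
by rewrite (antisym3r a b c aT) [_ * v 0 b]mulrAC mulrN.
Qed.

Lemma tri_swapl T u v w : antisym T -> tri T v u w = - tri T u v w.
Proof.
move=> aT; rewrite !triE exchange_big -sumrN; apply: eq_bigr => a _.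
rewrite -sumrN; apply: eq_bigr => b _.
rewrite -sumrN; apply: eq_bigr => c _.
by rewrite (antisym3l a b c aT) [v 0 b * _]mulrC mulrN.
Qed.

Lemma pull_bil P (S : tens R 2) i j : pull P S (ix2 i j) = bil S (row i P) (row j P).
Proof.
rewrite pull_ix2 bilE; apply: eq_bigr => a _; apply: eq_bigr => b _.
by rewrite !mxE.
Qed.

Lemma sum_ix3 (F : ix 3 -> R) : \sum_c F c = \sum_x \sum_y \sum_z F (ix3 x y z).
Proof. by rewrite sum_ixS; apply: eq_bigr => x _; rewrite sum_ix2. Qed.

Lemma prod_ix3 (P : 'M[R]_7) i j k a b c :
  \prod_(l < 3) P (ix3 i j k l) (ix3 a b c l) = P i a * P j b * P k c.
Proof.
rewrite !big_ord_recl big_ord0 mulr1 mulrA /ix3.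
by rewrite !(ix_cons0, ix_consS) !ffunE.
Qed.

Lemma pull_tri P (T : tens R 3) i j k :
  pull P T (ix3 i j k) = tri T (row i P) (row j P) (row k P).
Proof.
rewrite /pull sum_ix3 triE; apply: eq_bigr => a _; apply: eq_bigr => b _.
by apply: eq_bigr => c _; rewrite prod_ix3 !mxE.
Qed.

Lemma exists_annihilated m (A : 'M[R]_(7, m)) : (m < 7)%N ->
  exists2 u : 'rV[R]_7, u != 0 & u *m A = 0.
Proof.
move=> m7; have r7 : (\rank A < 7)%N by apply: leq_ltn_trans (rank_leq_col A) _.
have : (0 < \rank (kermx A))%N by rewrite mxrank_ker subn_gt0.
case: (eqVneq (kermx A) 0) => [->|/rowV0Pn [u uK nu] _]; first by rewrite mxrank0.
by exists u => //; apply/eqP; rewrite -sub_kermx.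
Qed.

Lemma ix3E (a : ix 3) : a = ix3 (a ord0) (a (lift ord0 ord0)) (a (lift ord0 (lift ord0 ord0))).
Proof.
apply/ffunP => i; rewrite /ix3; case: (unliftP ord0 i) => [j|] ->.
  rewrite ix_consS; case: (unliftP ord0 j) => [l|] ->; rewrite ffunE ?eqxx //.
  by rewrite !ord1 /=.
by rewrite ix_cons0.
Qed.

Lemma ix2E (a : ix 2) : a = ix2 (a ord0) (a (lift ord0 ord0)).
Proof.
by apply/ffunP => i; case: (unliftP ord0 i) => [j|] ->; rewrite ffunE ?eqxx ?ord1.
Qed.

Lemma antisym3_ext (S T : tens R 3) : antisym S -> antisym T ->
  (forall i j k : 'I_7, (i < j < k)%N -> S (ix3 i j k) = T (ix3 i j k)) -> S =1 T.
Proof.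
move=> aS aT H; apply: antisym_ext => // a Ha.
by rewrite (ix3E a) H // !Ha.
Qed.

Lemma antisym2_ext (S T : tens R 2) : antisym S -> antisym T ->
  (forall i j : 'I_7, (i < j)%N -> S (ix2 i j) = T (ix2 i j)) -> S =1 T.
Proof.
move=> aS aT H; apply: antisym_ext => // a Ha.
by rewrite (ix2E a) H // Ha.
Qed.

End Multilinear.

(** * Shuffle expansion of the product of a 2-form and a 3-form *)

Section Expansion.
Variable R : realType.

Lemma skip_cons0 k x (b : ix k) : [ffun i => ix_cons x b (lift ord0 i)] = b.
Proof. by apply/ffunP => i; rewrite ffunE ix_consS. Qed.

Lemma liftSS k (j : 'I_k.+1) (l : 'I_k) :
  lift (lift ord0 j) (lift ord0 l) = lift ord0 (lift j l).
Proof. by apply: val_inj; rewrite /= /bump !leq0n !add1n ltnS addnS. Qed.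

Lemma liftS0 k (j : 'I_k.+1) : lift (lift ord0 j) (ord0 : 'I_k.+1) = ord0.
Proof. exact: val_inj. Qed.

Lemma skip_consS k x (b : ix k.+1) (j : 'I_k.+1) :
  [ffun i => ix_cons x b (lift (lift ord0 j) i)] = ix_cons x [ffun i => b (lift j i)].
Proof.
apply/ffunP => i; rewrite ffunE; case: (unliftP ord0 i) => [l|] ->.
  by rewrite liftSS !ix_consS ffunE.
by rewrite liftS0 !ix_cons0.
Qed.

Lemma tprod_cons2 l (S : tens R 2) (T : tens R l) x y (c : ix l) :
  tprod S T (ix_cons x (ix_cons y c) : ix (2 + l)) = S (ix2 x y) * T c.
Proof.
have l0 : lshift l (ord0 : 'I_2) = (ord0 : 'I_l.+2) by apply: val_inj.
have l1 : lshift l (lift ord0 ord0 : 'I_2) = (lift ord0 ord0 : 'I_l.+2) by apply: val_inj.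
have r2 j : rshift 2 j = (lift ord0 (lift ord0 j) : 'I_l.+2) by apply: val_inj.
rewrite /tprod; congr (S _ * T _); apply/ffunP => i; last first.
  by rewrite ffunE r2 (ix_consS x (ix_cons y c)) ix_consS.
rewrite ffunE; case: (unliftP ord0 i) => [j|] ->.
  by rewrite ord1 l1 (ix_consS x (ix_cons y c)) ix_cons0 ffunE.
by rewrite l0 (ix_cons0 x (ix_cons y c)) ffunE.
Qed.

Lemma alt_tprod_antisym2 k (S : tens R 2) (T : tens R k.+1) (a : ix k.+3) :
  antisym T ->
  @alt R (2 + k.+1) (tprod S T) a = k.+1`!%:R *
   \sum_(j < k.+3) \sum_(i < k.+2) (-1) ^+ j * (-1) ^+ i *
     (S (ix2 (a j) (a (lift j i))) * T [ffun m => a (lift j (lift i m))]).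
Proof.
move=> aT; rewrite (@alt_expand R k.+2) big_distrr; apply: eq_bigr => j _ /=.
rewrite alt_expand !big_distrr; apply: eq_bigr => i _ /=.
transitivity ((-1) ^+ j * ((-1) ^+ i * (S (ix2 (a j) (a (lift j i))) *
   alt T [ffun m => a (lift j (lift i m))]))).
  congr (_ * (_ * _)); rewrite /alt big_distrr; apply: eq_bigr => s _ /=.
  rewrite [RHS]mulrCA; congr (_ * _).
  rewrite -(tprod_cons2 S T); congr (tprod S T (ix_cons _ (ix_cons _ _))).
    by rewrite ffunE.
  by apply/ffunP => m; rewrite !ffunE.
by rewrite altE_antisym //; ring.
Qed.

Definition ix5 x y z t u : ix 5 := ix_cons x (ix_cons y (ix3 z t u)).

Lemma ix5_skip (x y z t u : 'I_7) (j : 'I_5) (i : 'I_4) :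
  [ffun m => ix5 x y z t u (lift j (lift i m))] =
  [ffun m => [ffun l => ix5 x y z t u (lift j l)] (lift i m)].
Proof. by apply/ffunP => m; rewrite !ffunE. Qed.

(** The equation omega /\ Upsilon = 0 is to be evaluated on vectors whose components are unknown,
    out of reach of the list computations. Expanding twice gives 20 terms, which antisymmetry of [S]
    pairs into 10. *)
Lemma wedge23 (S : tens R 2) (T : tens R 3) x y z t u : antisym S -> antisym T ->
  wedge S T (ix5 x y z t u) =
    S (ix2 x y) * T (ix3 z t u) - S (ix2 x z) * T (ix3 y t u)
  + S (ix2 x t) * T (ix3 y z u) - S (ix2 x u) * T (ix3 y z t)
  + S (ix2 y z) * T (ix3 x t u) - S (ix2 y t) * T (ix3 x z u)
  + S (ix2 y u) * T (ix3 x z t) + S (ix2 z t) * T (ix3 x y u)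
  - S (ix2 z u) * T (ix3 x y t) + S (ix2 t u) * T (ix3 x y z).
Proof.
pose c0 : ix 0 := [ffun=> ord0].
move=> aS aT; rewrite wedgeE alt_tprod_antisym2 // !big_ord_recl !big_ord0.
rewrite !ix5_skip /ix5 /ix3 -!ix_cons_ix2 -!(ix_cons_ix1 _ c0).
rewrite !(skip_cons0, skip_consS) !(liftSS, liftS0) !(ix_cons0, ix_consS).
rewrite !lift0 !exprS !expr0 !(ix_cons_ix1, ix_cons_ix2).
rewrite (antisym2 x y aS) (antisym2 x z aS) (antisym2 x t aS) (antisym2 x u aS).
rewrite (antisym2 y z aS) (antisym2 y t aS) (antisym2 y u aS).
rewrite (antisym2 z t aS) (antisym2 z u aS) (antisym2 t u aS).
rewrite (_ : 2`! * 3`! = 12)%N // (_ : 3`! = 6)%N //.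
by field.
Qed.
End Expansion.

(** * Transverse SU(3)-structures at a point *)

Section PointwiseSU3.
Variable R : realType.
Variables (th : tens R 1) (om : tens R 2) (re im : tens R 3).
Variables (X : 'rV[R]_7) (J : 'M[R]_7).
Implicit Types (u v w : 'rV[R]_7).

Definition th1 u : R := \sum_a u 0 a * th (ix1 a).

Hypotheses (aom : antisym om) (are : antisym re) (aim : antisym im).
Hypothesis (thX : th1 X = 1).
Hypothesis (Xom : forall a, iprod X om a = 0).
Hypothesis (Xre : forall a, iprod X re a = 0).
Hypothesis (Xim : forall a, iprod X im a = 0).
Hypothesis (XJ : X *m J = 0).
Hypothesis (thJ : forall u, th1 (u *m J) = 0).
Hypothesis (JJ : forall u, th1 u = 0 -> u *m J *m J = - u).
Hypothesis (reJ : forall u a, iprod (u *m J) re a = - iprod u im a).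
Hypothesis (imJ : forall u a, iprod (u *m J) im a = iprod u re a).
Hypothesis (omJ : forall u, th1 u = 0 -> u != 0 ->
  0 < \sum_a \sum_b u 0 a * (u *m J) 0 b * om (ix2 a b)).
Hypothesis (omre : forall a, wedge om re a = 0).
Hypothesis (omim : forall a, wedge om im a = 0).
Hypothesis (vol6 : forall a : ix 6,
  6%:R^-1 * wedge om (wedge om om) a = 4%:R^-1 * wedge re im a).

Lemma th1D u v : th1 (u + v) = th1 u + th1 v.
Proof. by rewrite -big_split; apply: eq_bigr => a _; rewrite mxE mulrDl. Qed.

Lemma th1Z c u : th1 (c *: u) = c * th1 u.
Proof. by rewrite big_distrr; apply: eq_bigr => a _ /=; rewrite mxE mulrA. Qed.

Lemma eq_bil c (S S' : tens R 2) u v :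
  (forall a, S a = c * S' a) -> bil S u v = c * bil S' u v.
Proof.
move=> e; rewrite !bilE big_distrr; apply: eq_bigr => a _ /=.
by rewrite big_distrr; apply: eq_bigr => b _ /=; rewrite e mulrCA.
Qed.

Lemma tri_reJ u v w : tri re (u *m J) v w = - tri im u v w.
Proof. by rewrite -mulN1r; apply: eq_bil => a; rewrite reJ mulN1r. Qed.

Lemma tri_imJ u v w : tri im (u *m J) v w = tri re u v w.
Proof. by rewrite -[RHS]mul1r; apply: eq_bil => a; rewrite imJ mul1r. Qed.

Lemma tri_reX v w : tri re X v w = 0.
Proof. by rewrite -[RHS](mul0r (bil om v w)); apply: eq_bil => a; rewrite Xre mul0r. Qed.

Lemma tri_imX v w : tri im X v w = 0.
Proof. by rewrite -[RHS](mul0r (bil om v w)); apply: eq_bil => a; rewrite Xim mul0r. Qed.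

Lemma tri_reJ2 u v w : tri re u (v *m J) w = - tri im u v w.
Proof. by rewrite tri_swapl // tri_reJ opprK tri_swapl // opprK. Qed.

Lemma tri_imJ2 u v w : tri im u (v *m J) w = tri re u v w.
Proof. by rewrite tri_swapl // tri_imJ -tri_swapl. Qed.

Lemma tri_reJ3 u v w : tri re u v (w *m J) = - tri im u v w.
Proof. by rewrite tri_swapr // tri_reJ2 opprK tri_swapr // opprK. Qed.

Lemma tri_imJ3 u v w : tri im u v (w *m J) = tri re u v w.
Proof. by rewrite tri_swapr // tri_imJ2 -tri_swapr. Qed.

Lemma bil_omX v : bil om X v = 0.
Proof.
rewrite bilE exchange_big big1 // => b _ /=.
transitivity (v 0 b * iprod X om (ix1 b)); last by rewrite Xom mulr0.
rewrite /iprod big_distrr; apply: eq_bigr => a _ /=.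
by rewrite ix_cat1 ix_cons_ix2 mulrA [v 0 b * _]mulrC.
Qed.

Lemma bil_alt u : bil om u u = 0.
Proof.
have /eqP := bil_antisym u u aom.
by rewrite -addr_eq0 -mulr2n mulrn_eq0 /= => /eqP.
Qed.

(** Rows beyond the end of [r] are 0, so that [pull] also evaluates a form on fewer than seven
    vectors. *)
Definition rows (r : seq 'rV[R]_7) : 'M[R]_7 := \matrix_(i, j) nth 0 r i 0 j.

Lemma row_rows r i : row i (rows r) = nth 0 r i.
Proof. by apply/rowP => j; rewrite !mxE. Qed.

Lemma wedge23_eq0 (T : tens R 3) r0 r1 r2 r3 r4 : antisym T ->
  (forall a, wedge om T a = 0) ->
    bil om r0 r1 * tri T r2 r3 r4 - bil om r0 r2 * tri T r1 r3 r4
  + bil om r0 r3 * tri T r1 r2 r4 - bil om r0 r4 * tri T r1 r2 r3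
  + bil om r1 r2 * tri T r0 r3 r4 - bil om r1 r3 * tri T r0 r2 r4
  + bil om r1 r4 * tri T r0 r2 r3 + bil om r2 r3 * tri T r0 r1 r4
  - bil om r2 r4 * tri T r0 r1 r3 + bil om r3 r4 * tri T r0 r1 r2 = 0.
Proof.
move=> aT H; pose P := rows [:: r0; r1; r2; r3; r4].
pose o k (h : (k < 7)%N) : 'I_7 := Ordinal h.
have : pull P (wedge om T) (ix5 (o 0 isT) (o 1 isT) (o 2 isT) (o 3 isT) (o 4 isT)) = 0.
  by rewrite /pull big1 // => b _; rewrite H mulr0.
rewrite pull_wedge wedge23; try exact: pull_antisym.
by rewrite !pull_bil !pull_tri !row_rows /=.
Qed.

(** Vanishing of [th1] and of the pairings with [s] amounts to at most six linear conditions in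
    dimension 7. *)
Lemma annihilated (s : seq 'rV[R]_7) : (size s < 6)%N ->
  exists u, [/\ th1 u = 0, u != 0 & forall w, w \in s -> bil om w u = 0].
Proof.
move=> s6; pose A : 'M[R]_(7, (size s).+1) := \matrix_(a, j)
  if unlift ord0 j is Some i then \sum_b (s`_i) 0 b * om (ix2 b a) else th (ix1 a).
have [|u nu uA] := exists_annihilated A; first exact: s6.
exists u; split => // [|w].
  have := congr1 (fun B : 'rV_ _ => B 0 ord0) uA; rewrite !mxE => <-.
  by apply: eq_bigr => a _; rewrite mxE unlift_none.
move=> /(nthP 0) [i si <-].
have := congr1 (fun B : 'rV_ _ => B 0 (lift ord0 (Ordinal si))) uA.
rewrite !mxE => <-; rewrite bilE exchange_big; apply: eq_bigr => a _ /=.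
rewrite mxE liftK big_distrr; apply: eq_bigr => b _ /=.
by rewrite mulrA [u 0 a * _]mulrC.
Qed.

Lemma omJ_gt0 u : th1 u = 0 -> u != 0 -> 0 < bil om u (u *m J).
Proof. by move=> /omJ H /H; rewrite bilE. Qed.

Lemma lst_ix2 (i j : 'I_7) : lst (ix2 i j) = [:: nat_of_ord i; nat_of_ord j].
Proof.
apply: (@eq_from_nth _ 7%N); rewrite ?size_lst // => -[|[|]] //= h.
  by rewrite (nth_lst _ (Ordinal h)) ffunE.
by rewrite (nth_lst _ (Ordinal h)) ffunE.
Qed.

Lemma lst_ix3 (i j k : 'I_7) :
  lst (ix3 i j k) = [:: nat_of_ord i; nat_of_ord j; nat_of_ord k].
Proof.
apply: (@eq_from_nth _ 7%N); rewrite ?size_lst // => l h.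
rewrite (nth_lst _ (Ordinal h)) /ix3 -ix_cons_ix2 -(ix_cons_ix1 _ [ffun=> ord0]).
case: l h => [|[|[|]]] //= h.
- by rewrite (_ : Ordinal h = ord0) ?ix_cons0 //; apply: val_inj.
- rewrite (_ : Ordinal h = lift ord0 ord0) ?ix_consS ?ix_cons0 //; exact: val_inj.
- rewrite (_ : Ordinal h = lift ord0 (lift ord0 ord0)) ?ix_consS ?ix_cons0 //.
  exact: val_inj.
Qed.

Lemma symplectic_frame (r : seq 'rV[R]_7) :
  (forall i j : 'I_7, (i < j)%N ->
     bil om (r`_i) (r`_j) = (odd i && (j == i.+1 :> nat))%:R) ->
  forall a, pull (rows r) om a = zform om0 a.
Proof.
move=> H; apply: antisym2_ext => [||i j ij].
- exact: pull_antisym.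
- exact: form_antisym.
rewrite pull_bil !row_rows H // formE // lst_ix2.
have /allP /(_ _ (lst_all_ix (ix2 i j))) : all (fun s => (nth 0 s 0 < nth 0 s 1)%N ==>
   (formv om0 s == (odd (nth 0 s 0) && (nth 0 s 1 == (nth 0 s 0).+1))%N)) (all_ix 2).
  by vm_compute.
by rewrite lst_ix2 /= ij /= => /eqP ->; case: (_ && _).
Qed.

(** The value 6 is 3!: each ordering of the three planes contributes once to omega^3. *)
Lemma pull_om3 P : (forall a, pull P om a = zform om0 a) ->
  pull P (wedge om (wedge om om)) (to_ix 6 (iota 1 6)) = 6.
Proof.
move=> H; rewrite pull_wedge (eq_wedge _ H (T' := zform (mulL om0 om0))).
  by rewrite wedge_form // formE // lst_to_ix //.
by move=> a; rewrite pull_wedge (eq_wedge _ H H) wedge_form.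
Qed.

(** Symplectic Gram-Schmidt. Invariance of [om] under [J] is not yet available, so [J] only supplies
    a vector that pairs positively with the new [F]; it is then made orthogonal to the earlier pairs
    by hand. *)
Lemma symplectic_exists : exists P, forall a, pull P om a = zform om0 a.
Proof.
have [F1 [k1 n1 _]] := annihilated (s := [::]) isT.
have q1 := omJ_gt0 k1 n1; set c1 := bil om F1 (F1 *m J) in q1.
pose G1 := c1^-1 *: (F1 *m J).
have o11 : bil om F1 G1 = 1 by rewrite bilZr mulVf // gt_eqF.
clearbody G1.
have [F2 [k2 n2 a2]] := annihilated (s := [:: F1; G1]) isT.
have o12 : bil om F1 F2 = 0 by rewrite a2 // !inE eqxx ?orbT.
have o12' : bil om G1 F2 = 0 by rewrite a2 // !inE eqxx ?orbT.
have q2 := omJ_gt0 k2 n2; set c2 := bil om F2 (F2 *m J) in q2.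
pose H2 := F2 *m J.
(* The two corrections remove the components of [H2] in the plane of [F1] and [G1]; pairing with
   [F2] ignores them, since [F2] is orthogonal to that plane. *)
pose G2 := c2^-1 *: (H2 + bil om G1 H2 *: F1 - bil om F1 H2 *: G1).
have o11' : bil om G1 F1 = -1 by rewrite bil_antisym // o11.
have o21 : bil om F2 F1 = 0 by rewrite bil_antisym // o12 oppr0.
have o21' : bil om F2 G1 = 0 by rewrite bil_antisym // o12' oppr0.
have o22 : bil om F2 G2 = 1.
  rewrite bilZr !bilDr bilNr !bilZr o21 o21' !mulr0 oppr0 !addr0 mulVf // gt_eqF //.
have p12 : bil om F1 G2 = 0.
  by rewrite bilZr !bilDr bilNr !bilZr bil_alt o11; ring.
have p12' : bil om G1 G2 = 0.
  by rewrite bilZr !bilDr bilNr !bilZr bil_alt o11'; ring.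
clearbody G2.
have [F3 [k3 n3 a3]] := annihilated (s := [:: F1; G1; F2; G2]) isT.
have o13 : bil om F1 F3 = 0 by rewrite a3 // !inE eqxx ?orbT.
have o13' : bil om G1 F3 = 0 by rewrite a3 // !inE eqxx ?orbT.
have o23 : bil om F2 F3 = 0 by rewrite a3 // !inE eqxx ?orbT.
have o23' : bil om G2 F3 = 0 by rewrite a3 // !inE eqxx ?orbT.
have q3 := omJ_gt0 k3 n3; set c3 := bil om F3 (F3 *m J) in q3.
pose H3 := F3 *m J.
pose G3 := c3^-1 *: (H3 + bil om G1 H3 *: F1 - bil om F1 H3 *: G1
                        + bil om G2 H3 *: F2 - bil om F2 H3 *: G2).
have o22' : bil om G2 F2 = -1 by rewrite bil_antisym // o22.
have o31 : bil om F3 F1 = 0 by rewrite bil_antisym // o13 oppr0.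
have o31' : bil om F3 G1 = 0 by rewrite bil_antisym // o13' oppr0.
have o32 : bil om F3 F2 = 0 by rewrite bil_antisym // o23 oppr0.
have o32' : bil om F3 G2 = 0 by rewrite bil_antisym // o23' oppr0.
have p21 : bil om G2 F1 = 0 by rewrite bil_antisym // p12 oppr0.
have p21' : bil om G2 G1 = 0 by rewrite bil_antisym // p12' oppr0.
have o33 : bil om F3 G3 = 1.
  rewrite bilZr !(bilDr, bilNr) !bilZr o31 o31' o32 o32' !mulr0 oppr0 !addr0 mulVf // gt_eqF //.
have p13 : bil om F1 G3 = 0.
  by rewrite bilZr !(bilDr, bilNr) !bilZr bil_alt o11 o12 p12; ring.
have p13' : bil om G1 G3 = 0.
  by rewrite bilZr !(bilDr, bilNr) !bilZr bil_alt o11' o12' p12'; ring.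
have p23 : bil om F2 G3 = 0.
  by rewrite bilZr !(bilDr, bilNr) !bilZr bil_alt o21 o21' o22; ring.
have p23' : bil om G2 G3 = 0.
  by rewrite bilZr !(bilDr, bilNr) !bilZr bil_alt o22' p21 p21'; ring.
clearbody G3.
exists (rows [:: X; F1; G1; F2; G2; F3; G3]); apply: symplectic_frame.
by case=> -[|[|[|[|[|[|[|]]]]]]] //= ?; case=> -[|[|[|[|[|[|[|]]]]]]] //= ? _;
  rewrite ?bil_omX.
Qed.

(* Otherwise the volume normalisation would give omega^3 = 0. *)
Lemma ups_neq0 : exists u v w, tri re u v w ^+ 2 + tri im u v w ^+ 2 != 0.
Proof.
apply: contrapT => H.
have H2 u v w : tri re u v w = 0 /\ tri im u v w = 0.
  have : tri re u v w ^+ 2 + tri im u v w ^+ 2 = 0.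
    by apply: contrapT => /eqP h; apply: H; exists u, v, w.
  by move=> /eqP; rewrite paddr_eq0 ?sqr_ge0 // !sqrf_eq0 => /andP[/eqP ? /eqP ?].
have re0 a : re a = 0.
  by rewrite -[LHS]pull1 (ix3E a) pull_tri; have [] := H2 (row (a ord0) 1%:M) (row (a (lift ord0 ord0)) 1%:M) (row (a (lift ord0 (lift ord0 ord0))) 1%:M).
have [P HP] := symplectic_exists.
have := pull_om3 HP; rewrite /pull big1 => [/eqP|a _].
  by rewrite eq_sym pnatr_eq0.
apply/eqP; rewrite mulf_eq0; apply/orP; right; apply/eqP.
have : wedge re im a = 0.
  by rewrite wedgeE /alt big1 ?mulr0 // => s _; rewrite /tprod re0 mul0r mulr0.
move=> e; have /eqP := vol6 a; rewrite e mulr0 mulf_eq0 invr_eq0 pnatr_eq0 /=.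
by move/eqP.
Qed.

(* Contract omega /\ Upsilon = 0 with a triple on which Upsilon does not vanish
   and the complex vectors u + i J u, v + i J v, which Upsilon annihilates. *)
Lemma bil_omJJ u v : bil om (u *m J) (v *m J) = bil om u v.
Proof.
have [a [b [c nz]]] := ups_neq0.
have R1 := wedge23_eq0 a b c u v are omre.
have R2 := wedge23_eq0 a b c (u *m J) (v *m J) are omre.
have I1 := wedge23_eq0 a b c u v aim omim.
have I2 := wedge23_eq0 a b c (u *m J) (v *m J) aim omim.
have R3 := wedge23_eq0 a b c (u *m J) v are omre.
have R4 := wedge23_eq0 a b c u (v *m J) are omre.
have I3 := wedge23_eq0 a b c (u *m J) v aim omim.
have I4 := wedge23_eq0 a b c u (v *m J) aim omim.
move: R1 R2 R3 R4 I1 I2 I3 I4.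
rewrite !(tri_reJ2, tri_reJ3, tri_imJ2, tri_imJ3).
set A := bil om u v; set B := bil om (u *m J) (v *m J).
set C := bil om (u *m J) v; set D := bil om u (v *m J).
set x := tri re a b c; set y := tri im a b c.
move=> R1 R2 R3 R4 I1 I2 I3 I4.
(* [e1] and [e2] are the real and imaginary parts of (A - B + i (C + D)) (x + i y) = 0. *)
have e1 : (A - B) * x - (C + D) * y = 0.
  by clear R3 R4 I1 I2; lra.
have e2 : (A - B) * y + (C + D) * x = 0.
  by clear R1 R2 I3 I4 e1; lra.
have : (A - B) * (x ^+ 2 + y ^+ 2) = 0.
  transitivity (x * ((A - B) * x - (C + D) * y) + y * ((A - B) * y + (C + D) * x)).
    by ring.
  by rewrite e1 e2 !mulr0 addr0.
by move/eqP; rewrite mulf_eq0 (negPf nz) orbF subr_eq0 => /eqP.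
Qed.

Lemma bil_omJr u v : th1 v = 0 -> bil om u (v *m J) = - bil om (u *m J) v.
Proof. by move=> kv; rewrite -bil_omJJ JJ // bilNr. Qed.

Lemma tri_altl (T : tens R 3) u w : antisym T -> tri T u u w = 0.
Proof.
move=> aT; have /eqP := tri_swapl u u w aT.
by rewrite -addr_eq0 -mulr2n mulrn_eq0 /= => /eqP.
Qed.

Lemma tri_altr (T : tens R 3) u w : antisym T -> tri T u w w = 0.
Proof.
move=> aT; have /eqP := tri_swapr u w w aT.
by rewrite -addr_eq0 -mulr2n mulrn_eq0 /= => /eqP.
Qed.

Lemma iprodZ k c u (T : tens R k.+1) a : iprod (c *: u) T a = c * iprod u T a.
Proof. by rewrite /iprod big_distrr; apply: eq_bigr => b _ /=; rewrite mxE mulrA. Qed.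

Lemma triZl (T : tens R 3) c u v w : tri T (c *: u) v w = c * tri T u v w.
Proof. by apply: eq_bil => a; rewrite iprodZ. Qed.

Lemma unit_annihilated (s : seq 'rV[R]_7) : (size s < 6)%N ->
  exists u, [/\ th1 u = 0, bil om u (u *m J) = 1 & forall w, w \in s -> bil om w u = 0].
Proof.
move=> /annihilated [u [ku nu au]]; have q := omJ_gt0 ku nu.
have sq := sqr_sqrtr (ltW q); set c := Num.sqrt _ in sq.
have c0 : c != 0 by rewrite gt_eqF // sqrtr_gt0.
exists (c^-1 *: u); split.
- by rewrite th1Z ku mulr0.
- by rewrite -scalemxAl bilZl bilZr -sq; field.
- by move=> w /au e; rewrite bilZr e mulr0.
Qed.

(** [gmetric] at one point, up to conversion. Here [h] is an independent real: the value 1 gives a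
    frame even where the function h vanishes, and bounds can be made uniform in it. *)
Definition gtens (h : R) : tens R 2 := fun a =>
  \sum_(c < 7) om (ix2 (a ord0) c) * J (a ord_max) c +
  h ^+ 2 * (th (ix1 (a ord0)) * th (ix1 (a ord_max))).

Lemma bil_gtens h u v :
  bil (gtens h) u v = bil om u (v *m J) + h ^+ 2 * (th1 u * th1 v).
Proof.
pose t : 'cV[R]_7 := \col_a th (ix1 a).
have -> : th1 u = (u *m t) 0 0.
  by rewrite mxE; apply: eq_bigr => a _; rewrite mxE.
have -> : th1 v = (t^T *m v^T) 0 0.
  by rewrite -trmx_mul mxE mxE; apply: eq_bigr => a _; rewrite mxE.
have -> : (u *m t) 0 0 * (t^T *m v^T) 0 0 = (u *m (t *m t^T) *m v^T) 0 0.
  by rewrite mulmxA -mulmxA [RHS]mxE big_ord1.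
have eG : gram (gtens h) = gram om *m J^T + h ^+ 2 *: (t *m t^T).
  apply/matrixP => i j; rewrite !mxE /gtens !ffunE /=; congr (_ + _ * _).
    by apply: eq_bigr => c _; rewrite !mxE.
  by rewrite big_ord1 !mxE.
rewrite /bil eG trmx_mul mulmxDr mulmxDl mxE; congr (_ + _).
  by rewrite !mulmxA.
by rewrite -scalemxAr -scalemxAl mxE.
Qed.

Lemma mulmx_bil (P : 'M[R]_7) S i j :
  (P *m gram S *m P^T) i j = bil S (row i P) (row j P).
Proof.
rewrite /bil [LHS]mxE [RHS]mxE.
by apply: eq_bigr => a _; rewrite -row_mul !mxE.
Qed.

Local Arguments formv : simpl never.

(* The phase x + i y of Upsilon is left free: adjusting it to 1 is not needed. *)
Lemma unitary_frame h : 0 < h -> exists P x y,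
  [/\ P *m gram (gtens h) *m P^T = 1%:M,
      row 0 P = h^-1 *: X /\ (forall a, pull P th a = h^-1 * zform e0 a),
      forall a, pull P om a = zform om0 a,
      (forall a, pull P re a = x * zform re0 a + - y * zform im0 a) /\
      (forall a, pull P im a = y * zform re0 a + x * zform im0 a)
    & x ^+ 2 + y ^+ 2 = 1].
Proof.
move=> h0.
have [E1 [k1 q1 _]] := unit_annihilated (s := [::]) isT.
have [E3 [k3 q3 a3]] := unit_annihilated (s := [:: E1; E1 *m J]) isT.
have o13 : bil om E1 E3 = 0 by rewrite a3 // !inE eqxx ?orbT.
have o23 : bil om (E1 *m J) E3 = 0 by rewrite a3 // !inE eqxx ?orbT.
have [E5 [k5 q5 a5]] :=
  unit_annihilated (s := [:: E1; E1 *m J; E3; E3 *m J]) isT.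
have o15 : bil om E1 E5 = 0 by rewrite a5 // !inE eqxx ?orbT.
have o25 : bil om (E1 *m J) E5 = 0 by rewrite a5 // !inE eqxx ?orbT.
have o35 : bil om E3 E5 = 0 by rewrite a5 // !inE eqxx ?orbT.
have o45 : bil om (E3 *m J) E5 = 0 by rewrite a5 // !inE eqxx ?orbT.
have o14 : bil om E1 (E3 *m J) = 0 by rewrite bil_omJr // o23 oppr0.
have o16 : bil om E1 (E5 *m J) = 0 by rewrite bil_omJr // o25 oppr0.
have o36 : bil om E3 (E5 *m J) = 0 by rewrite bil_omJr // o45 oppr0.
have q2 : bil om (E1 *m J) E1 = -1 by rewrite bil_antisym // q1.
have q4 : bil om (E3 *m J) E3 = -1 by rewrite bil_antisym // q3.
have q6 : bil om (E5 *m J) E5 = -1 by rewrite bil_antisym // q5.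
have o31 : bil om E3 E1 = 0 by rewrite bil_antisym // o13 oppr0.
have o32 : bil om E3 (E1 *m J) = 0 by rewrite bil_antisym // o23 oppr0.
have o41 : bil om (E3 *m J) E1 = 0 by rewrite bil_antisym // o14 oppr0.
have o51 : bil om E5 E1 = 0 by rewrite bil_antisym // o15 oppr0.
have o52 : bil om E5 (E1 *m J) = 0 by rewrite bil_antisym // o25 oppr0.
have o61 : bil om (E5 *m J) E1 = 0 by rewrite bil_antisym // o16 oppr0.
have o53 : bil om E5 E3 = 0 by rewrite bil_antisym // o35 oppr0.
have o54 : bil om E5 (E3 *m J) = 0 by rewrite bil_antisym // o45 oppr0.
have o63 : bil om (E5 *m J) E3 = 0 by rewrite bil_antisym // o36 oppr0.
have oE := (q1, q2, q3, q4, q5, q6, o13, o23, o15, o25, o35, o45, o14, o16, o36,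
  o31, o32, o41, o51, o52, o61, o53, o54, o63).
clear a3 a5.
(* [X] has length [h] for this metric, whence the factor [h^-1]; the other rows are three pairs (E,
   J E). *)
pose r := [:: h^-1 *: X; E1; E1 *m J; E3; E3 *m J; E5; E5 *m J].
pose P := rows r.
have Pom : forall a, pull P om a = zform om0 a.
  apply: symplectic_frame.
  by case=> -[|[|[|[|[|[|[|]]]]]]] //= ?; case=> -[|[|[|[|[|[|[|]]]]]]] //= ? _;
    rewrite ?bil_omJJ ?oE // bilZl bil_omX mulr0.
pose x := tri re E1 E3 E5; pose y := tri im E1 E3 E5.
have J3 := (tri_reJ, tri_imJ, tri_reJ2, tri_reJ3, tri_imJ2, tri_imJ3).
have A3 := (fun u w => tri_altl u w are, fun u w => tri_altl u w aim,
  fun u w => tri_altr u w are, fun u w => tri_altr u w aim).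
have comb_antisym c d L L' : antisym (fun a : ix 3 => c * @zform R 3 L a + d * zform L' a).
  by move=> s a; rewrite !form_antisym mulrDr; congr (_ + _); rewrite mulrCA.
have Pre : forall a, pull P re a = x * zform re0 a + - y * zform im0 a.
  apply: antisym3_ext; [exact: pull_antisym|exact: comb_antisym|].
  move=> i j k ijk; rewrite pull_tri !row_rows !formE // lst_ix3; move: i j k ijk.
  case=> -[|[|[|[|[|[|[|]]]]]]] //= ?; case=> -[|[|[|[|[|[|[|]]]]]]] //= ?;
  case=> -[|[|[|[|[|[|[|]]]]]]] //= ? _;
  rewrite ?triZl ?tri_reX ?J3 ?A3 ?opprK ?oppr0 ?mulr0;
  try rewrite -/x; try rewrite -/y;
  try (first [rewrite (_ : formv re0 _ = 1); last by vm_compute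
         |rewrite (_ : formv re0 _ = -1); last by vm_compute]);
  try (first [rewrite (_ : formv im0 _ = 1); last by vm_compute
         |rewrite (_ : formv im0 _ = -1); last by vm_compute]);
  by rewrite ?(mulr0z, mulr1z, mulrN1z); ring.
have Pim : forall a, pull P im a = y * zform re0 a + x * zform im0 a.
  apply: antisym3_ext; [exact: pull_antisym|exact: comb_antisym|].
  move=> i j k ijk; rewrite pull_tri !row_rows !formE // lst_ix3; move: i j k ijk.
  case=> -[|[|[|[|[|[|[|]]]]]]] //= ?; case=> -[|[|[|[|[|[|[|]]]]]]] //= ?;
  case=> -[|[|[|[|[|[|[|]]]]]]] //= ? _;
  rewrite ?triZl ?tri_imX ?J3 ?A3 ?opprK ?oppr0 ?mulr0;
  try rewrite -/x; try rewrite -/y;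
  try (first [rewrite (_ : formv re0 _ = 1); last by vm_compute
         |rewrite (_ : formv re0 _ = -1); last by vm_compute]);
  try (first [rewrite (_ : formv im0 _ = 1); last by vm_compute
         |rewrite (_ : formv im0 _ = -1); last by vm_compute]);
  by rewrite ?(mulr0z, mulr1z, mulrN1z); ring.
exists P, x, y; split => //.
- apply/matrixP => i j; rewrite mulmx_bil !row_rows bil_gtens mxE.
  have t0 : th1 (h^-1 *: X) = h^-1 by rewrite th1Z thX mulr1.
  have X0 u : bil om (h^-1 *: X) u = 0 by rewrite bilZl bil_omX mulr0.
  have XJ0 u : bil om u ((h^-1 *: X) *m J) = 0.
    by rewrite -scalemxAl XJ scaler0 -(scale0r (0 : 'rV_7)) bilZr mul0r.
  move: i j.
  case=> -[|[|[|[|[|[|[|]]]]]]] //= ?; case=> -[|[|[|[|[|[|[|]]]]]]] //= ?;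
    rewrite ?XJ0 ?X0 ?t0 ?thJ ?k1 ?k3 ?k5 ?(JJ k1) ?(JJ k3) ?(JJ k5)
      ?bilNr ?bil_omJJ ?oE ?bil_alt ?(mulr0, mul0r, oppr0, addr0, add0r, opprK) //.
  by field; rewrite gt_eqF.
- split; first by rewrite row_rows.
  move=> a; rewrite (_ : a = ix1 (a ord0)); last first.
    by apply/ffunP => l; rewrite ffunE ord1.
  have -> : pull P th (ix1 (a ord0)) = th1 (row (a ord0) P).
    by rewrite pull_ix1; apply: eq_bigr => b _; rewrite !mxE.
  rewrite row_rows formE // (_ : lst _ = [:: nat_of_ord (a ord0)]); last first.
    apply: (@eq_from_nth _ 7%N); rewrite ?size_lst // => -[|] //= h1.
    by rewrite (nth_lst _ (Ordinal h1)) ffunE.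
  case: (a ord0) => -[|[|[|[|[|[|[|]]]]]]] //= ?;
   rewrite ?thJ ?k1 ?k3 ?k5 ?th1Z ?thX ?mulr0 ?mulr1 //.
(* The volume normalisation fixes the modulus of the phase: [re0] /\ [im0] is 4 e^123456, hence 6 =
   6/4 * (4 x^2 + 4 y^2). *)
- have := pull_om3 Pom.
  rewrite (eq_pull (S := wedge om (wedge om om)) (T := fun a => 6 * (4%:R^-1 * wedge re im a)) P (to_ix 6 (iota 1 6))); last first.
    by move=> a; rewrite -vol6 mulrA mulfV ?mul1r ?pnatr_eq0.
  rewrite (pullZ _ _ (fun a => 4%:R^-1 * wedge re im a)) (pullZ _ _ (wedge re im)) pull_wedge.
  pose S c d (a : ix 3) := \sum_(p <- [:: (c, re0); (d, im0)]) p.1 * @zform R 3 p.2 a.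
  have SE c d : S c d =1 (fun a => c * zform re0 a + d * zform im0 a).
    by move=> a; rewrite /S !big_cons big_nil addr0.
  rewrite (eq_wedge (S' := S x (- y)) (T' := S y x)); last 2 first.
  + by move=> a; rewrite Pre SE.
  + by move=> a; rewrite Pim SE.
  rewrite /S wedge_suml !big_cons big_nil !wedge_sumr !big_cons !big_nil /=.
  rewrite !wedge_form // !formE // !lst_to_ix //.
  rewrite (_ : formv (mulL re0 re0) _ = 0) // (_ : formv (mulL re0 im0) _ = 4) //.
  rewrite (_ : formv (mulL im0 re0) _ = - 4) // (_ : formv (mulL im0 im0) _ = 0) //.
  move=> e; apply: (mulfI (_ : (6 : R) != 0)); first by rewrite pnatr_eq0.
  by rewrite mulr1 -[RHS]e; field.
Qed.

End PointwiseSU3.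

(** * The Hodge star in a unitary frame *)

(** The stars of [re0] and [im0] both enter, since in the frame Re Upsilon is a combination of the
    two. *)
Lemma star_form34 : all (fun s => [&&
    starv re0 s == - formv (mulL e0 im0) s, starv im0 s == formv (mulL e0 re0) s
  & 2 * starv (mulL e0 om0) s == formv (mulL om0 om0) s]) (all_ix 4).
Proof. by vm_compute. Qed.

(** Multiplication by [e^i] becomes contraction with the vector [e_i] after the star; at [i = 0]
    both sides vanish. *)
Lemma star_form52 : all (fun i => all (fun s =>
    (starv (mulL [:: (1, [:: i])] (mulL e0 im0)) s == - formv re0 (i :: s)) &&
    (starv (mulL [:: (1, [:: i])] (mulL e0 re0)) s == formv im0 (i :: s)))
  (all_ix 2)) (iota 0 7).
Proof. by vm_compute. Qed.

(** Origin of the factor sqrt 2: contracting [re0] with one of e_1, ..., e_6 leaves two basis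
    2-forms, each counted in two orders, hence 4, and the norm of 2-forms divides by 2!. The
    cancellation of the mixed terms makes the result independent of the phase. *)
Lemma form_contraction : all (fun i => all (fun j =>
  [&& sumz [seq formv re0 (i :: s) * formv re0 (j :: s) | s <- all_ix 2] ==
        (if (i == j) && (i != 0%N) then 4 else 0),
      sumz [seq formv im0 (i :: s) * formv im0 (j :: s) | s <- all_ix 2] ==
        (if (i == j) && (i != 0%N) then 4 else 0)
    & sumz [seq formv re0 (i :: s) * formv im0 (j :: s) | s <- all_ix 2] +
      sumz [seq formv im0 (i :: s) * formv re0 (j :: s) | s <- all_ix 2] == 0])
  (iota 0 7)) (iota 0 7).
Proof. by vm_compute. Qed.

Section StarInFrame.
Local Arguments mulL : simpl never.
Local Arguments formv : simpl never.
Local Arguments starv : simpl never.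
Variable R : realType.

Lemma wedgeZl k l c (S : tens R k) (T : tens R l) a :
  wedge (fun b => c * S b) T a = c * wedge S T a.
Proof.
have := wedge_suml [:: tt] (fun=> c) (fun=> S) T a; rewrite big_seq1 => <-.
by congr wedge; apply/funext => b; rewrite big_seq1.
Qed.

Lemma wedgeZr k l c (S : tens R k) (T : tens R l) a :
  wedge S (fun b => c * T b) a = c * wedge S T a.
Proof.
have := wedge_sumr [:: tt] (fun=> c) S (fun=> T) a; rewrite big_seq1 => <-.
by congr wedge; apply/funext => b; rewrite big_seq1.
Qed.

Lemma wedge_lin k l c d (S : tens R k) (T T' : tens R l) a :
  wedge S (fun b => c * T b + d * T' b) a = c * wedge S T a + d * wedge S T' a.
Proof.
have := wedge_sumr [:: (c, T); (d, T')] fst S snd a.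
rewrite !big_cons big_nil addr0 => <-.
by congr wedge; apply/funext => b; rewrite !big_cons big_nil addr0.
Qed.

Lemma pull_inj k (P : 'M[R]_7) (S T : tens R k) : P \in unitmx ->
  (forall a, pull P S a = pull P T a) -> S =1 T.
Proof.
move=> Pu H a; rewrite -[S a]pull1 -[T a]pull1 -(mulVmx Pu) -!pull_pull.
exact: eq_pull.
Qed.

(** Lagrange's identity: the sum of the squares of the 2x2 minors, over ordered pairs, is twice the
    defect in the Cauchy-Schwarz inequality. *)
Lemma sum_sqr_le (I : finType) (c d : I -> R) :
  (\sum_i c i * d i) ^+ 2 <= (\sum_i c i ^+ 2) * (\sum_i d i ^+ 2).
Proof.
rewrite -subr_ge0.
have : 0 <= \sum_i \sum_j (c i * d j - c j * d i) ^+ 2.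
  by apply: sumr_ge0 => i _; apply: sumr_ge0 => j _; apply: sqr_ge0.
have -> : \sum_i \sum_j (c i * d j - c j * d i) ^+ 2 =
   ((\sum_i c i ^+ 2) * (\sum_i d i ^+ 2) - (\sum_i c i * d i) ^+ 2) *+ 2.
  have e f g : (\sum_i f i) * (\sum_i g i) = \sum_i \sum_j f i * g j :> R.
    by rewrite big_distrl; apply: eq_bigr => i _; rewrite big_distrr.
  rewrite expr2 !e mulr2n.
  have ex : \sum_i \sum_j c i ^+ 2 * d j ^+ 2 = \sum_i \sum_j c j ^+ 2 * d i ^+ 2.
    exact: exchange_big.
  rewrite [X in _ = _ + X](congr1 (fun t => t - _) ex).
  rewrite -!sumrB -!big_split /=; apply: eq_bigr => i _.
  rewrite -!sumrB -!big_split /=; apply: eq_bigr => j _; ring.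
by rewrite pmulrn_lge0.
Qed.

Variables (th : tens R 1) (om : tens R 2) (re im : tens R 3) (g : tens R 2).
Variables (X : 'rV[R]_7) (h : R) (P : 'M[R]_7) (x y : R).
Hypothesis (h0 : 0 < h).
Hypothesis (Pg : P *m gram g *m P^T = 1%:M).
Hypothesis (P0 : row 0 P = h^-1 *: X).
Hypothesis (Pth : forall a, pull P th a = h^-1 * zform e0 a).
Hypothesis (Pom : forall a, pull P om a = zform om0 a).
Hypothesis (Pre : forall a, pull P re a = x * zform re0 a + - y * zform im0 a).
Hypothesis (Pim : forall a, pull P im a = y * zform re0 a + x * zform im0 a).
Hypothesis (xy1 : x ^+ 2 + y ^+ 2 = 1).

Let o : tens R 7 := wedge th (wedge om (wedge om om)).

Lemma orientation_antisym : antisym o.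
Proof. exact: (@wedge_antisym R 1 6). Qed.

Lemma orientation_pos : 0 < pull P o [ffun i => i].
Proof.
have om3 a : pull P (wedge om (wedge om om)) a = zform (mulL om0 (mulL om0 om0)) a.
  rewrite pull_wedge (eq_wedge _ Pom (T' := zform (mulL om0 om0))).
    by rewrite wedge_form.
  by move=> b; rewrite pull_wedge (eq_wedge _ Pom Pom) wedge_form.
rewrite /o (@pull_wedge R 1 6) (eq_wedge _ Pth om3).
rewrite wedgeZl wedge_form // formE // (_ : lst _ = iota 0 7).
  by rewrite (_ : formv _ _ = 6) // mulr_gt0 ?invr_gt0 // ltr0n.
apply: (@eq_from_nth _ 7%N); rewrite ?size_lst // => i i7.
by rewrite (nth_lst _ (Ordinal i7)) ffunE nth_iota.
Qed.

Lemma star_varphi (a : ix 4) :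
  hodge (erefl : (3 + 4 = 7)%N) g o (fun b => h * wedge th om b + re b) a =
  2^-1 * wedge om om a - h * wedge th im a.
Proof.
move: a; apply: (pull_inj (frame_unit Pg)) => a.
rewrite (frame_hodge Pg orientation_antisym orientation_pos).
(* In the frame, h theta is [e^0]: the function h disappears from varphi. *)
have phiE (b : ix 3) : pull P (fun b => h * wedge th om b + re b) b =
    @zform R 3 (mulL e0 om0) b + x * zform re0 b + - y * zform im0 b.
  rewrite (pullD P (fun b => h * wedge th om b) re) (pullZ P h (wedge th om)) Pre addrA.
  rewrite pull_wedge (eq_wedge _ Pth Pom) wedgeZl (wedge_form _ _ _ (isT : wf 1 e0)).
  have hn : h != 0 by rewrite gt_eqF.
  by rewrite mulVKf.
under eq_bigr do rewrite phiE !mulrDl -!(mulrA x) -!(mulrA (- y)).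
rewrite !big_split /= -!big_distrr /= !mulrDr (mulrCA _ x) (mulrCA _ (- y)).
have SE L (wL : wf7 3 L) := sum_form_eps R (erefl : (3 + 4 = 7)%N) a wL.
rewrite /= in SE; rewrite (SE (mulL e0 om0) isT) (SE re0 isT) (SE im0 isT).
rewrite (pullD P (fun a => 2^-1 * wedge om om a) (fun a => - (h * wedge th im a))).
rewrite (pullZ P 2^-1 (wedge om om)).
rewrite (eq_pull (S := fun a => - (h * wedge th im a)) (T := fun a => - h * wedge th im a) P a);
  last by move=> b; rewrite mulNr.
rewrite (pullZ P (- h) (wedge th im)) !pull_wedge (eq_wedge _ Pom Pom).
rewrite (eq_wedge _ Pth Pim) wedgeZl wedge_lin.
rewrite !(wedge_form _ _ _ (isT : wf 1 e0)) (wedge_form _ _ _ (isT : wf 2 om0)).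
rewrite (formE _ _ (isT : wf 4 (mulL om0 om0))) (formE _ _ (isT : wf 4 (mulL e0 re0))).
rewrite (formE _ _ (isT : wf 4 (mulL e0 im0))).
have /allP /(_ _ (lst_all_ix a)) /and3P [/eqP -> /eqP -> /eqP <-] := star_form34.
by rewrite rmorphM rmorphN /=; field; rewrite gt_eqF.
Qed.

Lemma pull_ix1E (A : tens R 1) a :
  pull P A a = \sum_(i < 7) pull P A (ix1 i) * zform [:: (1, [:: nat_of_ord i])] a.
Proof.
have -> : a = ix1 (a ord0) by apply/ffunP => l; rewrite ffunE ord1.
have E (i j : 'I_7) : zform [:: (1, [:: nat_of_ord i])] (ix1 j) = (i == j)%:R :> R.
  rewrite /zform big_seq1 mul1r /eform /alt (big_pred1 1%g) => [|s]; last first.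
    by rewrite /= permS1 eqxx.
  by rewrite odd_perm1 mul1r /delta big_ord1 !ffunE /= eq_sym.
rewrite (bigD1 (a ord0) isT) /= E eqxx mulr1 [X in _ + X]big1 => [|i ni].
  by rewrite addr0.
by rewrite E (negPf ni) mulr0.
Qed.

(** Minus the contraction of Re Upsilon = x [re0] - y [im0] with the frame vector [e_i]. *)
Let f (i : nat) (s : seq nat) : R :=
  y * (formv im0 (i :: s))%:~R - x * (formv re0 (i :: s))%:~R.

Lemma sum_all_ix2 (F : seq nat -> int) :
  \sum_(a : ix 2) (F (lst a))%:~R = (sumz [seq F s | s <- all_ix 2])%:~R :> R.
Proof.
have -> : all_ix 2 = [seq [:: i; j] | i <- iota 0 7, j <- iota 0 7] by [].
rewrite sum_ix2 /sumz foldrE big_map rmorph_sum big_allpairs_dep.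
have io : iota 0 7 = index_iota 0 7 by [].
rewrite io big_mkord; apply: eq_bigr => i _; rewrite big_mkord.
by apply: eq_bigr => j _; rewrite lst_ix2.
Qed.

Lemma sum_ff (i j : 'I_7) : \sum_(a : ix 2) f i (lst a) * f j (lst a) =
  if (i == j) && (nat_of_ord i != 0)%N then 4 else 0.
Proof.
have iI (k : 'I_7) : nat_of_ord k \in iota 0 7 by rewrite mem_iota ltn_ord.
have /allP /(_ _ (iI i)) /allP /(_ _ (iI j)) /and3P [/eqP Cr /eqP Ci /eqP Cm] := form_contraction.
pose S L L' : R := \sum_(a : ix 2) (formv L (nat_of_ord i :: lst a) * formv L' (nat_of_ord j :: lst a))%:~R.
transitivity (x ^+ 2 * S re0 re0 + y ^+ 2 * S im0 im0 - x * y * (S re0 im0 + S im0 re0)).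
  rewrite /S mulrDr !big_distrr /= opprD -!sumrN -!big_split /=.
  apply: eq_bigr => a _; rewrite /f.
  have G (k l m n : int) : (y * l%:~R - x * k%:~R) * (y * n%:~R - x * m%:~R) =
    x ^+ 2 * (k * m)%:~R + y ^+ 2 * (l * n)%:~R + (- (x * y * (k * n)%:~R) - x * y * (l * m)%:~R).
    by ring.
  exact: G.
rewrite /S !(sum_all_ix2 (fun s => formv _ (nat_of_ord i :: s) * formv _ (nat_of_ord j :: s))).
rewrite -rmorphD Cm Cr Ci val_eqE mulr0 subr0 -mulrDl xy1 mul1r.
by case: ifP.
Qed.

Lemma sum_ix1_frame (A : tens R 1) :
  fnorm g A = Num.sqrt (\sum_i pull P A (ix1 i) ^+ 2).
Proof. by rewrite (frame_fnorm Pg) invr1 mul1r sum_ix1. Qed.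

Lemma frame_ix0 (A : tens R 1) :
  pull P A (ix1 ord0) = h^-1 * \sum_b X 0 b * A (ix1 b).
Proof.
rewrite pull_ix1 big_distrr; apply: eq_bigr => b _ /=.
by have := congr1 (fun r : 'rV_7 => r 0 b) P0; rewrite !mxE mulrA => ->.
Qed.

(** [A] stands for dh. Its component along [e^0] is killed by theta, hence the sum over [i != ord0];
    theta brings the factor [h^-1]. *)
Lemma hodge_contraction (A : tens R 1) :
  fnorm g (fun a => - hodge (erefl : (5 + 2 = 7)%N) g o
                        (fun b => - wedge A (wedge th im) b) a) =
  Num.sqrt (2 * h^-1 ^+ 2 * \sum_(i | i != ord0) pull P A (ix1 i) ^+ 2).
Proof.
pose al i := pull P A (ix1 i).
have pullN k (T : tens R k) a : pull P (fun b => - T b) a = - pull P T a.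
  by rewrite -mulN1r -pullZ; apply: eq_pull => b; rewrite mulN1r.
rewrite (frame_fnorm Pg).
have H (a : ix 2) : pull P (fun a => - hodge (erefl : (5 + 2 = 7)%N) g o
     (fun b => - wedge A (wedge th im) b) a) a = \sum_(i < 7) (al i * h^-1) * f i (lst a).
  rewrite pullN (frame_hodge Pg orientation_antisym orientation_pos).
  have TE (b : ix 5) : pull P (fun b => - wedge A (wedge th im) b) b =
    \sum_(i < 7) - (al i * h^-1) * (y * zform (mulL [:: (1, [:: nat_of_ord i])] (mulL e0 re0)) b
       + x * zform (mulL [:: (1, [:: nat_of_ord i])] (mulL e0 im0)) b).
    rewrite pullN pull_wedge (eq_wedge _ (pull_ix1E A) (fun c => pull_wedge P th im c)).
    rewrite wedge_suml -sumrN; apply: eq_bigr => i _.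
    rewrite (eq_wedge (S' := zform [:: (1, [:: nat_of_ord i])]) _ (fun=> erefl)
      (fun c => eq_wedge c Pth Pim)).
    rewrite (eq_wedge (S' := zform [:: (1, [:: nat_of_ord i])]) _ (fun=> erefl)
      (fun c => wedgeZl _ _ _ c)) wedgeZr.
    rewrite (eq_wedge (S' := zform [:: (1, [:: nat_of_ord i])]) _ (fun=> erefl)
      (fun c => wedge_lin _ _ _ _ _ c)) wedge_lin.
    rewrite !(eq_wedge (S' := zform [:: (1, [:: nat_of_ord i])]) _ (fun=> erefl)
      (fun c => wedge_form _ _ _ (isT : wf 1 e0))).
    rewrite !(wedge_form _ _ _ (isT : wf 1 [:: (1, [:: nat_of_ord i])])).
    by rewrite mulNr -mulrA.
  under eq_bigr do rewrite TE big_distrl /=.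
  rewrite exchange_big /= big_distrr -sumrN; apply: eq_bigr => i _ /=.
  under eq_bigr do rewrite -mulrA mulrDl -!(mulrA x) -!(mulrA y).
  rewrite -big_distrr big_split /= -!big_distrr /= mulrCA mulrDr.
  rewrite (mulrCA _ y) (mulrCA _ x).
  have iI : nat_of_ord i \in iota 0 7 by rewrite mem_iota ltn_ord.
  have i7 L : wf7 3 L -> wf7 5 (mulL [:: (1, [:: nat_of_ord i])] (mulL e0 L)).
    move=> /allP wL; apply/allP => _ /allpairsP [[p q] [/= pI qI ->]] /=.
    move: pI; rewrite inE => /eqP -> /=.
    move: qI => /allpairsP [[p' q'] [/= pI' qI' ->]] /=.
    move: pI'; rewrite inE => /eqP -> /=.
    by have /andP[/eqP -> ->] := wL _ qI'; rewrite ltn_ord.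
  have SE L (wL : wf7 5 L) := sum_form_eps R (erefl : (5 + 2 = 7)%N) a wL.
  rewrite /= in SE; rewrite (SE _ (i7 re0 isT)) (SE _ (i7 im0 isT)).
  have /allP /(_ _ iI) /allP /(_ _ (lst_all_ix a)) /andP [/eqP -> /eqP ->] := star_form52.
  by rewrite /f rmorphN /=; ring.
under eq_bigr do rewrite H.
congr Num.sqrt.
transitivity (2^-1 * \sum_(i < 7) \sum_(j < 7) (al i * h^-1) * (al j * h^-1) *
   \sum_(a : ix 2) f i (lst a) * f j (lst a)).
  congr (_ * _).
  under eq_bigr do rewrite expr2 big_distrl /=.
  rewrite exchange_big /=; apply: eq_bigr => i _.
  under eq_bigr do rewrite big_distrr /=.
  rewrite exchange_big /=; apply: eq_bigr => j _.
  by rewrite big_distrr /=; apply: eq_bigr => a _; ring.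
under eq_bigr do under eq_bigr do rewrite sum_ff.
rewrite [in RHS]big_mkcond !big_distrr; apply: eq_bigr => i _.
rewrite (bigD1 i isT) /= [X in _ + X]big1 => [|j nj]; last first.
  by rewrite eq_sym (negPf nj) mulr0.
rewrite addr0 eqxx -val_eqE /= -/(al i).
have hn : h != 0 by rewrite gt_eqF.
by case: ifP => _; [field | rewrite !mulr0].
Qed.

Lemma fnorm1_split (A : tens R 1) : fnorm g A ^+ 2 =
  (h^-1 * \sum_b X 0 b * A (ix1 b)) ^+ 2 + \sum_(i | i != ord0) pull P A (ix1 i) ^+ 2.
Proof.
rewrite sum_ix1_frame sqr_sqrtr; last by apply: sumr_ge0 => i _; apply: sqr_ge0.
by rewrite (bigD1 ord0 isT) /= frame_ix0.
Qed.

Lemma fnorm1_cauchy (A : tens R 1) (v : 'rV[R]_7) :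
  (\sum_a v 0 a * A (ix1 a)) ^+ 2 <= fnorm g A ^+ 2 * bil g v v.
Proof.
have Pu := frame_unit Pg; pose c := v *m invmx P.
have vE : v = c *m P by rewrite mulmxKV.
clearbody c.
have -> : \sum_a v 0 a * A (ix1 a) = \sum_i c 0 i * pull P A (ix1 i).
  rewrite vE; under eq_bigr do rewrite mxE big_distrl /=.
  rewrite exchange_big /=; apply: eq_bigr => i _.
  by rewrite pull_ix1 big_distrr /=; apply: eq_bigr => a _; rewrite mulrA.
have -> : bil g v v = \sum_i c 0 i ^+ 2.
  rewrite /bil vE trmx_mul -!mulmxA (mulmxA P) (mulmxA (P *m _)) Pg mul1mx.
  by rewrite mxE; apply: eq_bigr => i _; rewrite mxE expr2.
rewrite sum_ix1_frame sqr_sqrtr; last by apply: sumr_ge0 => i _; apply: sqr_ge0.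
by rewrite mulrC; apply: sum_sqr_le.
Qed.

End StarInFrame.

(** * Exterior derivatives *)

Section AlternationOfInsertions.
Variable R : realType.

Lemma altD k (S T : tens R k) a : alt (fun b => S b + T b) a = alt S a + alt T a.
Proof. by rewrite -big_split /=; apply: eq_bigr => s _; rewrite mulrDr. Qed.

Lemma altZ k c (T : tens R k) a : alt (fun b => c * T b) a = c * alt T a.
Proof. by rewrite big_distrr /=; apply: eq_bigr => s _; rewrite mulrCA. Qed.

Lemma alt_alt k (T : tens R k) a : alt (alt T) a = k`!%:R * alt T a.
Proof. by rewrite altE_antisym //; apply: alt_antisym. Qed.

Lemma alt_head k (G : 'I_7 -> tens R k) (a : ix k.+1) :
  alt (fun b : ix k.+1 => alt (G (b ord0)) [ffun i => b (lift ord0 i)]) a =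
  k`!%:R * alt (fun b : ix k.+1 => G (b ord0) [ffun i => b (lift ord0 i)]) a.
Proof.
rewrite !alt_expand big_distrr; apply: eq_bigr => j _ /=.
rewrite mulrCA; congr (_ * _).
rewrite (eq_alt (T := alt (G (a j)))) ?alt_alt => [|b]; last first.
  by rewrite ix_cons0 skip_cons0.
by congr (_ * _); apply: eq_alt => b; rewrite ix_cons0 skip_cons0.
Qed.

Lemma alt_cast m n (e : m = n) (T : tens R m) (a : ix n) :
  alt (fun b : ix n => T [ffun i => b (cast_ord e i)]) a =
  alt T [ffun i => a (cast_ord e i)].
Proof.
move: a; case: _ / e => a; rewrite (_ : [ffun i => a (cast_ord _ i)] = a).
  by apply: eq_alt => b; congr T; apply/ffunP => i; rewrite ffunE cast_ord_id.
by apply/ffunP => i; rewrite ffunE cast_ord_id.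
Qed.

(** This is the term S /\ dT of the Leibniz rule, up to sign: [r] moves the slot of differentiation,
    which comes first, past the [k] slots of [S] to stand before those of [T]. *)
Lemma alt_tprod_insert k l (S : tens R k) (D : tens R l.+1) (a : ix (k + l).+1) :
  (forall c, alt D c = 0) ->
  alt (fun b : ix (k + l).+1 =>
    S [ffun i => b (lift ord0 (lshift l i))] *
    D (ix_cons (b ord0) [ffun j => b (lift ord0 (rshift k j))])) a = 0.
Proof.
move=> aD; pose e : (k + l.+1 = (k + l).+1)%N := addnS k l.
pose r : 'S_(k + l).+1 := lift_perm (cast_ord e (rshift k ord0)) ord0 1%g.
pose W (b : ix (k + l).+1) := tprod S D [ffun i => b (cast_ord e i)].
have r1 i : r (cast_ord e (lshift l.+1 i)) = lift ord0 (lshift l i).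
  rewrite (_ : cast_ord e _ = lift (cast_ord e (rshift k ord0)) (lshift l i)).
    by rewrite lift_perm_lift perm1.
  by apply: val_inj; rewrite /= /bump addn0 leqNgt ltn_ord.
have r2 : r (cast_ord e (rshift k ord0)) = ord0 by rewrite lift_perm_id.
have r3 j : r (cast_ord e (rshift k (lift ord0 j))) = lift ord0 (rshift k j).
  rewrite (_ : cast_ord e _ = lift (cast_ord e (rshift k ord0)) (rshift k j)).
    by rewrite lift_perm_lift perm1.
  by apply: val_inj; rewrite /= /bump addn0 leq_addr /= addnCA.
rewrite (eq_alt (T := fun b => W [ffun x => b (r x)])) => [|b].
  rewrite alt_permr alt_cast.
  have : alt (tprod S (alt D)) [ffun i => a (cast_ord e i)] = 0.
    by rewrite /alt big1 // => s _; rewrite /tprod -/(alt D _) aD !mulr0.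
  rewrite alt_tprodr => /eqP; rewrite mulf_eq0 (negPf (factr_neq0 _ _)) /=.
  by move=> /eqP ->; rewrite mulr0.
rewrite /W /tprod; congr (S _ * D _); apply/ffunP => i; rewrite !ffunE ?r1 //.
by case: (unliftP ord0 i) => [j|] ->; rewrite ?r2 ?r3 ?ffunE.
Qed.

End AlternationOfInsertions.

(** * Partial derivatives in charts and the Leibniz rule *)

Section Differential.
Variables (R : realType) (M : manifold R).
Implicit Types (i : cidx M) (p : M) (b : 'I_7).

(** Unlike a value of [pd], this includes the existence of the derivative. *)
Definition has_pd i p b (f : M -> R) (df : R) :=
  is_derive (cmap i p) (ebase R b) (fun x => f (cinv i x)) df.

Lemma smooth_has_pd i p b f : cdom i p -> smooth_in i f -> has_pd i p b f (pd i b f p).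
Proof.
move=> ip /(_ 1%N) [_ /(_ b) [H _]]; apply: derivableP.
by apply: H; apply: coord_cod.
Qed.

Lemma pdE i p b f df : has_pd i p b f df -> pd i b f p = df.
Proof. by case. Qed.

Lemma has_pdD i p b f g df dg : has_pd i p b f df -> has_pd i p b g dg ->
  has_pd i p b (fun q => f q + g q) (df + dg).
Proof. by move=> hf hg; apply: (is_deriveD (f := fun x => f (cinv i x))). Qed.

Lemma has_pdM i p b f g df dg : cdom i p -> has_pd i p b f df -> has_pd i p b g dg ->
  has_pd i p b (fun q => f q * g q) (df * g p + f p * dg).
Proof.
move=> ip hf hg.
have := is_deriveM (f := fun x => f (cinv i x)) (g := fun x => g (cinv i x)).
move=> /(_ _ _ _ _ hf hg) H; apply: is_derive_eq H _.
have -> : cinv i (cmap i p) = p by apply: coordK.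
by rewrite addrC; congr (_ + _); rewrite /GRing.scale /= mulrC.
Qed.

Lemma has_pd_cst i p b c : has_pd i p b (fun=> c) 0.
Proof. exact: is_derive_cst. Qed.

Lemma has_pdZ i p b c f df : cdom i p -> has_pd i p b f df ->
  has_pd i p b (fun q => c * f q) (c * df).
Proof.
move=> ip hf; have := has_pdM ip (has_pd_cst i p b c) hf.
by rewrite mul0r add0r.
Qed.

Lemma has_pd_sum (I : Type) (r : seq I) i p b (f : I -> M -> R) df :
  (forall j, has_pd i p b (f j) (df j)) ->
  has_pd i p b (fun q => \sum_(j <- r) f j q) (\sum_(j <- r) df j).
Proof.
move=> H; elim: r => [|j r IH].
  rewrite big_nil (_ : (fun=> _) = fun=> 0); first exact: has_pd_cst.
  by apply/funext => q; rewrite big_nil.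
rewrite big_cons (_ : (fun=> _) = fun q => f j q + \sum_(j <- r) f j q).
  exact: has_pdD.
by apply/funext => q; rewrite big_cons.
Qed.

Lemma has_pd_near i p b f g df :
  (\forall x \near cmap i p, f (cinv i x) = g (cinv i x)) ->
  has_pd i p b g df -> has_pd i p b f df.
Proof.
move=> fg hg; apply: (near_eq_is_derive (f := fun x => g (cinv i x)) _ hg).
by apply: filterS fg => x; exact: esym.
Qed.

Definition dtens i p k (T : tfield M k) : tens R k.+1 :=
  fun b : ix k.+1 => pd i (b ord0) (fun q => T i q [ffun l => b (lift ord0 l)]) p.

Lemma alt_dtens i p k (T : tfield M k) a : alt (dtens i p T) a = k`!%:R * ext_d T i p a.
Proof. by rewrite /ext_d mulrA mulfV ?factr_neq0 // mul1r. Qed.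

Section Leibniz.
Variables (k l : nat) (S : tfield M k) (T : tfield M l) (i : cidx M) (p : M).
Hypothesis ip : cdom i p.
Hypothesis dS : forall b c, has_pd i p b (fun q => S i q c) (pd i b (fun q => S i q c) p).
Hypothesis dT : forall b c, has_pd i p b (fun q => T i q c) (pd i b (fun q => T i q c) p).

Let G (y : 'I_7) : tens R (k + l) := fun d =>
  pd i y (fun q => S i q [ffun x => d (lshift l x)]) p * T i p [ffun x => d (rshift k x)] +
  S i p [ffun x => d (lshift l x)] * pd i y (fun q => T i q [ffun x => d (rshift k x)]) p.

Lemma has_pd_wedge b c : has_pd i p b (fun q => wedge (S i q) (T i q) c)
  (((k`! * l`!)%:R)^-1 * alt (G b) c).
Proof.
apply: has_pdZ => //; apply: has_pd_sum => s.
by apply: has_pdZ => //; apply: has_pdM.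
Qed.

(** In both products to be differentiated, omega^2 and theta /\ Im Upsilon, the second factor is
    closed, so that only dS /\ T survives. *)
Lemma ext_d_wedge a : (forall c, ext_d T i p c = 0) ->
  ext_d (fun j q => wedge (S j q) (T j q)) i p a =
  ((k`! * l`!)%:R)^-1 * (k.+1`!%:R)^-1 * k`!%:R *
    @alt R (k.+1 + l) (tprod (ext_d S i p) (T i p)) a.
Proof.
move=> dT0; rewrite {1}/ext_d.
rewrite (eq_alt (T := fun b : ix (k + l).+1 => ((k`! * l`!)%:R)^-1 *
   alt (G (b ord0)) [ffun x => b (lift ord0 x)])) => [|b]; last first.
  by rewrite (pdE (has_pd_wedge _ _)).
rewrite altZ alt_head mulrCA mulKf ?factr_neq0 // -!mulrA; congr (_ * _).
rewrite altD -[RHS]addr0; congr (_ + _); last first.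
  apply: etrans (alt_tprod_insert (S i p) (D := dtens i p T) a _); last first.
    by move=> c; rewrite alt_dtens dT0 mulr0.
  apply: eq_alt => b; congr (S i p _ * _).
    by apply/ffunP => x; rewrite !ffunE.
  rewrite /dtens ix_cons0; apply: (congr1 (fun f => pd i (b ord0) f p)).
  apply/funext => q; apply: (congr1 (T i q)).
  by apply/ffunP => x; rewrite !ffunE liftK ffunE.
apply: (mulfI (factr_neq0 R k.+1)); rewrite mulVKf ?factr_neq0 //.
transitivity (@alt R (k.+1 + l) (tprod (alt (dtens i p S)) (T i p)) a).
  rewrite alt_tprodl; congr (_ * _); apply: eq_alt => b; rewrite /tprod /dtens ffunE.
  have e0 : lshift l (ord0 : 'I_k.+1) = (ord0 : 'I_(k + l).+1) by apply: val_inj.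
  rewrite e0; congr (_ * _); last first.
    apply: (congr1 (T i p)); apply/ffunP => x; rewrite !ffunE.
    by congr (b _); apply: val_inj.
  apply: (congr1 (fun f => pd i (b ord0) f p)); apply/funext => q.
  apply: (congr1 (S i q)); apply/ffunP => x; rewrite !ffunE.
  by congr (b _); apply: val_inj.
rewrite -altZ; apply: eq_alt => b.
by rewrite /tprod alt_dtens mulrA.
Qed.

End Leibniz.

Lemma ext_d_form0 (f : M -> R) i p a : ext_d (form0 f) i p a = pd i (a ord0) f p.
Proof.
rewrite /ext_d invr1 mul1r /alt (big_pred1 1%g) => [|s]; last first.
  by rewrite /= permS1 eqxx.
by rewrite odd_perm1 mul1r ffunE perm1.
Qed.

Lemma form_has_pd k (T : tfield M k) i p : is_form T -> cdom i p ->
  forall b c, has_pd i p b (fun q => T i q c) (pd i b (fun q => T i q c) p).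
Proof. by move=> [_ _ sT] ip b c; apply: smooth_has_pd. Qed.

Lemma cmapK i p : cdom i p -> cinv i (cmap i p) = p.
Proof. exact: coordK. Qed.

Lemma differentiable_has_pd i p b f : cdom i p -> differentiable_at f p ->
  has_pd i p b f (pd i b f p).
Proof. by move=> ip /(_ _ ip) H; apply/derivableP/diff_derivable. Qed.

Lemma differentiable_near_gt0 i p f : cdom i p -> differentiable_at f p -> 0 < f p ->
  \forall x \near cmap i p, ccod i x /\ 0 < f (cinv i x).
Proof.
move=> ip /(_ _ ip) /differentiable_continuous cf fp; near=> x; split.
  near: x; apply: open_nbhs_nbhs; split; first exact: cod_open.
  exact: coord_cod.
by near: x; apply: (cvgr_gt _ cf); rewrite cmapK.
Unshelve. all: by end_near. Qed.

End Differential.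

(** * The derivative of star varphi and the norm of its star *)

Section StarVarphi.
Variables (R : realType) (M : contactCY R) (h : M -> R).
Implicit Types (i : cidx M) (p : M).

Lemma cy_frame i p (c : R) : cdom i p -> 0 < c -> exists P x y,
  [/\ P *m gram (gtens (theta i p) (omega i p) (acs i p) c) *m P^T = 1%:M,
      row 0 P = c^-1 *: xi i p /\
      (forall a, pull P (theta i p) a = c^-1 * zform e0 a),
      forall a, pull P (omega i p) a = zform om0 a,
      (forall a, pull P (ReU i p) a = x * zform re0 a + - y * zform im0 a) /\
      (forall a, pull P (ImU i p) a = y * zform re0 a + x * zform im0 a)
    & x ^+ 2 + y ^+ 2 = 1].
Proof.
move=> ip; apply: unitary_frame.
- by have [aT _ _] := @omega_form _ M; apply: aT.
- by have [aT _ _] := @ReU_form _ M; apply: aT.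
- by have [aT _ _] := @ImU_form _ M; apply: aT.
- exact: theta_xi.
- exact: (@omega_basic _ M i p ip).1.
- exact: (@ReU_basic _ M i p ip).1.
- exact: (@ImU_basic _ M i p ip).1.
- exact: acs_xi.
- exact: acs_ker.
- exact: acs_sqr.
- exact: ReU_acs.
- exact: ImU_acs.
- exact: omega_acs_pos.
- by move=> a; apply: omega_ReU.
- by move=> a; apply: omega_ImU.
- by move=> a; apply: omega_ReU_ImU.
Qed.

Lemma star_varphiE i p a : cdom i p -> 0 < h p ->
  star h (erefl : (3 + 4 = 7)%N) (varphi h) i p a =
  2^-1 * wedge (omega i p) (omega i p) a - h p * wedge (theta i p) (ImU i p) a.
Proof.
move=> ip hp; have [P [x [y [Pg [_ Pth] Pom [Pre Pim] _]]]] := cy_frame ip hp.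
exact: star_varphi hp Pg Pth Pom Pre Pim a.
Qed.

Lemma ext_d_omega2 i p a : cdom i p ->
  ext_d (fun j q => wedge (@omega _ M j q) (omega j q)) i p a = 0.
Proof.
move=> ip; rewrite (ext_d_wedge ip); try exact/form_has_pd/ip/omega_form.
  rewrite /alt big1 ?mulr0 // => s _.
  by rewrite /tprod d_omega // mul0r mulr0.
by move=> c; rewrite d_omega.
Qed.

Lemma ext_d_theta_ImU i p a : cdom i p ->
  ext_d (fun j q => wedge (@theta _ M j q) (ImU j q)) i p a = 0.
Proof.
move=> ip; rewrite (ext_d_wedge ip).
- rewrite (eq_alt (T := tprod (omega i p) (ImU i p))) => [|b]; last first.
    by rewrite /tprod d_theta.
  have := omega_ImU a ip.
  rewrite wedgeE => /eqP; rewrite mulf_eq0 invr_eq0 natrM mulf_eq0.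
  by rewrite !(negPf (factr_neq0 _ _)) /= => /eqP ->; rewrite mulr0.
- exact/form_has_pd/ip/theta_form.
- exact/form_has_pd/ip/ImU_form.
- by move=> c; rewrite d_ImU.
Qed.

(** Differentiability makes h continuous, so h > 0 and [star_varphiE] hold on a whole neighbourhood
    of [p]; it is this identity of functions that is differentiated. *)
Lemma ext_d_star_varphi i p a : cdom i p -> 0 < h p -> differentiable_at h p ->
  ext_d (star h (erefl : (3 + 4 = 7)%N) (varphi h)) i p a =
  - wedge (ext_d (form0 h) i p) (wedge (theta i p) (ImU i p)) a.
Proof.
move=> ip hp dh.
have dom b c := form_has_pd (@omega_form _ M) ip b c.
have dth b c := form_has_pd (@theta_form _ M) ip b c.
have dIm b c := form_has_pd (@ImU_form _ M) ip b c.
pose W j q := wedge (@omega _ M j q) (omega j q).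
pose V j q := wedge (@theta _ M j q) (ImU j q).
have dW b c : has_pd i p b (fun q => W i q c) (pd i b (fun q => W i q c) p).
  by have H := has_pd_wedge ip dom dom b c; rewrite (pdE H).
have dV b c : has_pd i p b (fun q => V i q c) (pd i b (fun q => V i q c) p).
  by have H := has_pd_wedge ip dth dIm b c; rewrite (pdE H).
have dstar b c : pd i b (fun q => star h (erefl : (3 + 4 = 7)%N) (varphi h) i q c) p =
   2^-1 * pd i b (fun q => W i q c) p +
   -1 * (pd i b h p * V i p c + h p * pd i b (fun q => V i q c) p).
  apply: pdE; apply: (has_pd_near (g := fun q => 2^-1 * W i q c + -1 * (h q * V i q c))).
    apply: filterS (differentiable_near_gt0 ip dh hp) => x [cx hx].
    by rewrite star_varphiE // ?mulN1r //; apply: point_dom.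
  apply: has_pdD; apply: has_pdZ => //.
  by apply: has_pdM => //; apply: differentiable_has_pd.
have := ext_d_theta_ImU a ip; rewrite -/V => eV.
have := ext_d_omega2 a ip; rewrite -/W => eW.
have eW' : alt (dtens i p W) a = 0 by rewrite alt_dtens eW mulr0.
have eV' : alt (dtens i p V) a = 0 by rewrite alt_dtens eV mulr0.
rewrite {1}/ext_d.
rewrite (eq_alt (T := fun b => 2^-1 * dtens i p W b + (-1 *
  @tprod R 1 4 (ext_d (form0 h) i p) (V i p) b + - h p * dtens i p V b))) => [|b]; last first.
  rewrite dstar /dtens /tprod ext_d_form0 ffunE.
  have -> : lshift 4 (ord0 : 'I_1) = ord0 by apply: val_inj.
  have -> : [ffun j => b (rshift 1 j)] = [ffun l => b (lift ord0 l)].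
    by apply/ffunP => j; rewrite !ffunE; congr (b _); apply: val_inj.
  by ring.
rewrite !altD !altZ eW' eV' !mulr0 add0r addr0 wedgeE mulN1r mulrN.
by rewrite mul1n.
Qed.

Lemma fnormZ k (g : tens R 2) c (T : tens R k) :
  fnorm g (fun a => c * T a) = `|c| * fnorm g T.
Proof.
rewrite /fnorm.
have -> : \sum_a (c * T a) * raise g (fun a => c * T a) a = c ^+ 2 * \sum_a T a * raise g T a.
  rewrite big_distrr; apply: eq_bigr => a _ /=.
  have -> : raise g (fun a => c * T a) a = c * raise g T a.
    by rewrite /raise big_distrr; apply: eq_bigr => b _; rewrite mulrCA.
  by ring.
by rewrite mulrCA sqrtrM ?sqr_ge0 // sqrtr_sqr.
Qed.

Lemma eq_fnorm k (g : tens R 2) (S T : tens R k) : S =1 T -> fnorm g S = fnorm g T.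
Proof. by move=> /funext ->. Qed.

(** [S] is the squared norm of dh on [ker theta], shared by both norms; the other term is the
    derivative of h along the unit Reeb direction. *)
Lemma norm_formula p : 0 < h p -> differentiable_at h p -> exists2 S, 0 <= S &
  norm_d h h p ^+ 2 = ((h p)^-1 * \sum_b xi (chart_at p) p 0 b * pd (chart_at p) b h p) ^+ 2 + S
  /\ norm_dstar_varphi h p = Num.sqrt (2 * (h p)^-1 ^+ 2 * S).
Proof.
move=> hp dh; have ip : cdom (chart_at p) p by apply: chart_atP.
have [P [x [y [Pg [P0 Pth] Pom [Pre Pim] xy1]]]] := cy_frame ip hp.
pose A := ext_d (form0 h) (chart_at p) p.
exists (\sum_(i | i != ord0) pull P A (ix1 i) ^+ 2).
  by apply: sumr_ge0 => i _; apply: sqr_ge0.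
split.
  have := fnorm1_split Pg P0 A; rewrite /norm_d /pnorm -/A => ->.
  congr ((_ * _) ^+ 2 + _); apply: eq_bigr => b _.
  by rewrite /A ext_d_form0 ffunE.
rewrite -(hodge_contraction hp Pg Pth Pom Pim xy1 A) /norm_dstar_varphi /pnorm.
apply: eq_fnorm => a; rewrite /codiff_varphi {1}/star.
congr (- hodge _ _ _ _ _); apply/funext => b.
by rewrite ext_d_star_varphi.
Qed.

Lemma norm_d_ge0 (f : M -> R) p : 0 <= norm_d h f p.
Proof. exact: sqrtr_ge0. Qed.

Lemma derive_ln (V : normedModType R) (f : V -> R) (v x : V) :
  differentiable f x -> 0 < f x ->
  is_derive x v (fun z => ln (f z)) ((f x)^-1 * 'D_v f x).
Proof.
move=> df fx.
have dl : differentiable (@ln R) (f x).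
  by apply/derivable1_diffP; have [] := is_derive1_ln fx.
have dlf : differentiable (fun z => ln (f z)) x by apply: differentiable_comp.
have H : 'D_v (fun z => ln (f z)) x = (f x)^-1 * 'D_v f x.
  rewrite (deriveE _ dlf) (deriveE _ df).
  rewrite (_ : (fun z => ln (f z)) = @ln R \o f) // diff_comp //= diff1E //.
  rewrite derive1E; have [_ ->] := is_derive1_ln fx.
  by rewrite /GRing.scale /= mulrC.
by rewrite -H; apply/derivableP/diff_derivable.
Qed.

Lemma norm_dln_formula p : 0 < h p -> differentiable_at h p ->
  norm_dln h p = (h p)^-1 * norm_d h h p.
Proof.
move=> hp dh; have ip : cdom (chart_at p) p by apply: chart_atP.
rewrite /norm_dln /norm_d /pnorm -[X in X * _]gtr0_norm ?invr_gt0 // -fnormZ.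
apply: eq_fnorm => a; rewrite !ext_d_form0.
apply: pdE; rewrite /has_pd.
have := derive_ln (ebase R (a ord0)) (dh _ ip); rewrite cmapK //.
exact.
Qed.

End StarVarphi.

(** * Integral curves *)

Section RealCurves.
Variable R : realType.

Lemma mvt_le (g dg : R -> R) (a b K : R) :
  (forall x, a <= x <= b -> is_derive x 1 g (dg x)) ->
  (forall x, a <= x <= b -> `|dg x| <= K) ->
  forall x y, a <= x <= b -> a <= y <= b -> `|g x - g y| <= K * `|x - y|.
Proof.
move=> Dg bg.
have H x y : a <= x <= b -> a <= y <= b -> x < y -> `|g y - g x| <= K * `|y - x|.
  move=> /andP[ax xb] /andP[ay yb] xy.
  have inab z : z \in `[x, y]%R -> a <= z <= b.
    rewrite in_itv /= => /andP[xz zy].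
    by rewrite (le_trans ax xz) (le_trans zy yb).
  have [||c cxy ->] := @MVT R g dg x y xy.
  - by move=> z zxy; apply/Dg/inab; apply: subset_itv_oo_cc.
  - apply: derivable_within_continuous => z zxy.
    by have [] := Dg z (inab z zxy).
  by rewrite normrM ler_wpM2r //; apply/bg/inab/subset_itv_oo_cc.
move=> x y xab yab; have [xy|yx|->] := ltgtP x y.
- by rewrite distrC [`|x - y|]distrC; apply: H.
- exact: H.
- by rewrite !subrr normr0 mulr0.
Qed.

Lemma is_derive_line (V W : normedModType R) (f : V -> W) (z e : V) (t : R) :
  derivable f (z + t *: e) e ->
  is_derive t 1 (fun s => f (z + s *: e)) ('D_e f (z + t *: e)).
Proof.
move=> df; set g := fun s => _.
have E : (fun h : R => h^-1 *: ((g \o shift t) (h *: 1) - g t)) =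
         (fun h => h^-1 *: ((f \o shift (z + t *: e)) (h *: e) - f (z + t *: e))).
  apply/funext => h; rewrite /g /= /shift /=; congr (_ *: (f _ - _)).
  by rewrite [h *: 1]mulr1 scalerDl addrCA.
by split; rewrite /derivable /derive E.
Qed.

Lemma rV_normP n (x : 'rV[R]_n) (r : R) : 0 <= r ->
  `|x| <= r <-> forall j, `|x 0 j| <= r.
Proof.
move=> r0; rewrite /Num.norm /= mx_normrE; split=> [/bigmax_leP [_ H] j|H].
  by have := H (0, j) isT.
by apply/bigmax_leP; split => // -[i j] _ /=; rewrite (ord1 i); apply: H.
Qed.

Lemma rV_coord_le n (x : 'rV[R]_n) j : `|x 0 j| <= `|x|.
Proof. by have [H _] := rV_normP x (normr_ge0 x); apply: H. Qed.

Section LipschitzOfPartials.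
Variables (n : nat) (f : 'rV[R]_n -> R) (x0 : 'rV[R]_n) (r K : R).
Hypothesis df : forall z a, `|z - x0| <= r -> derivable f z (delta_mx 0 a).
Hypothesis bf : forall z a, `|z - x0| <= r -> `|'D_(delta_mx 0 a) f z| <= K.

(* Change the coordinates of [x] into those of [y] one at a time. *)
Lemma lipschitz_of_partials x y : `|x - x0| <= r -> `|y - x0| <= r ->
  `|f x - f y| <= n%:R * K * `|x - y|.
Proof.
move=> xr yr; have r0 : 0 <= r by apply: le_trans xr.
pose w k : 'rV[R]_n := \row_j (if (j < k)%N then y 0 j else x 0 j).
have wr k : `|w k - x0| <= r.
  apply/rV_normP => // j; rewrite !mxE.
  have := (rV_normP _ r0).1 xr j; have := (rV_normP _ r0).1 yr j; rewrite !mxE.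
  by case: ifP.
have step (k : 'I_n) : `|f (w k) - f (w k.+1)| <= K * `|x - y|.
  pose d := y 0 k - x 0 k; pose e : 'rV[R]_n := delta_mx 0 k.
  have wS : w k.+1 = w k + d *: e.
    apply/rowP => j; rewrite !mxE eqxx /= ltnS leq_eqVlt val_eqE.
    have [->|nj] /= := eqVneq j k; first by rewrite ltnn mulr1 /d; ring.
    by rewrite mulr0 addr0.
  have seg t : Num.min 0 d <= t <= Num.max 0 d -> `|w k + t *: e - x0| <= r.
    move=> /andP[t1 t2]; apply/rV_normP => // j; rewrite !mxE eqxx /=.
    have := (rV_normP _ r0).1 xr j; have := (rV_normP _ r0).1 yr j; rewrite !mxE.
    have [->|nj] := eqVneq j k; last by rewrite mulr0 addr0; case: ifP.
    rewrite ltnn mulr1 !ler_norml => /andP[y1 y2] /andP[x1 x2].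
    move: t1 t2; rewrite /d ge_min le_max => /orP[] t1 /orP[] t2; lra.
  have m0 : Num.min 0 d <= 0 <= Num.max 0 d by rewrite ge_min le_max lexx.
  have md : Num.min 0 d <= d <= Num.max 0 d by rewrite ge_min le_max lexx !orbT.
  have := @mvt_le (fun t => f (w k + t *: e)) (fun t => 'D_e f (w k + t *: e))
    _ _ K _ _ 0 d m0 md.
  rewrite scale0r addr0 -wS sub0r normrN => H.
  apply: le_trans (H _ _) _ => [t /seg tr|t /seg tr|].
  - by apply: is_derive_line; apply: df.
  - exact: bf.
  rewrite ler_wpM2l //; first exact: le_trans (bf k xr).
  by rewrite /d distrC; have := rV_coord_le (x - y) k; rewrite !mxE.
have -> : f x - f y = \sum_(k < n) (f (w k) - f (w k.+1)).
  rewrite -(big_mkord predT (fun k => f (w k) - f (w k.+1))).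
  have -> : f x - f y = - (f (w n) - f (w 0%N)).
    rewrite opprB; congr (f _ - f _); apply/rowP => j; rewrite !mxE // ltn_ord //.
  rewrite -(telescope_sumr (fun k => f (w k))) // -sumrN.
  by apply: eq_bigr => k _; rewrite opprB.
apply: le_trans (ler_norm_sum _ _ _) _.
apply: le_trans (ler_sum _ (fun k _ => step k)) _.
by rewrite sumr_const card_ord -mulrA mulr_natl.
Qed.

End LipschitzOfPartials.

End RealCurves.

(** * Chain rule along a curve, and primitives *)

Section ChainRule.
Variable R : realType.

Lemma is_derive_coord m n (X : R -> 'M[R]_(m, n)) (u : R) v :
  is_derive u 1 X v <-> forall i j, is_derive u 1 (fun t => X t i j) (v i j).
Proof.
split=> [[dX <-] i j|H].
  have dXij := (derivable_mxP X u 1).1 dX.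
  by split; [exact: dXij|rewrite derive_mx // mxE].
have dX : derivable X u 1 by apply/derivable_mxP => i j; have [] := H i j.
split => //; rewrite derive_mx //; apply/matrixP => i j; rewrite mxE.
by have [] := H i j.
Qed.

Lemma is_derive_entry n (z v : 'rV[R]_n) a :
  is_derive z v (fun x : 'rV[R]_n => x 0 a) (v 0 a).
Proof.
have d : derivable (id : 'rV[R]_n -> 'rV[R]_n) z v by apply: derivable_id.
have dz := (derivable_mxP id z v).1 d 0 a.
split; first exact: dz.
by have := derive_mx d; rewrite derive_id => /rowP /(_ a); rewrite mxE => ->.
Qed.

(** Only continuity of the partial derivatives at [x0] is at hand. Once its linear part at [x0] is
    subtracted, [f] becomes a function [g] whose partial derivatives are small near [x0], hence
    Lipschitz there with an arbitrarily small constant. *)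
Lemma chain_curve n (f : 'rV[R]_n -> R) (x0 : 'rV[R]_n) (X : R -> 'rV[R]_n) (u : R) v :
  (forall a, \forall z \near x0, derivable f z (delta_mx 0 a)) ->
  (forall a, {for x0, continuous (fun z => 'D_(delta_mx 0 a) f z)}) ->
  X u = x0 -> is_derive u 1 X v ->
  is_derive u 1 (fun t => f (X t)) (\sum_a v 0 a * 'D_(delta_mx 0 a) f x0).
Proof.
move=> df cf Xu dX.
pose c a := 'D_(delta_mx 0 a) f x0.
pose g z := f z - \sum_a c a * z 0 a.
have dlin (w : 'rV[R]_n) z : is_derive z w (fun z : 'rV[R]_n => \sum_a c a * z 0 a)
    (\sum_a c a * w 0 a).
  have H a : is_derive z w (fun z : 'rV[R]_n => c a * z 0 a) (c a * w 0 a).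
    have := is_derive_entry z w a.
    by move=> /(@is_deriveZ _ _ _ _ (c a)).
  have := is_derive_sum (h := fun a (z : 'rV[R]_n) => c a * z 0 a) H.
  by congr is_derive; apply/funext => t; rewrite fct_sumE.
have csum a : \sum_j c j * (delta_mx 0 a : 'rV[R]_n) 0 j = c a.
  rewrite (bigD1 a isT) /= mxE !eqxx mulr1 [X in _ + X]big1 => [|j nj].
    by rewrite addr0.
  by rewrite mxE eqxx (negPf nj) mulr0.
have dgX : is_derive u 1 (fun t => g (X t)) 0.
  have H : (fun h : R => h^-1 *: (((fun t => g (X t)) \o shift u) (h *: 1) - g (X u)))
     @ 0^' --> 0.
    apply/cvgrPdist_le => /= e e0.
    pose C := `|v| + 1; have C0 : 0 < C by rewrite ltr_pwDr.
    (* [C] bounds the difference quotients of [X] and [n%:R * K] is the Lipschitz constant of [g];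
       [n.+1] keeps the denominator nonzero when n = 0. *)
    pose K := e / (n.+1%:R * C).
    have K0 : 0 < K by rewrite divr_gt0 // mulr_gt0.
    have nearx : \forall z \near x0, forall a, derivable f z (delta_mx 0 a) /\
        `|'D_(delta_mx 0 a) f z - c a| <= K.
      apply: (@filter_forall _ _ (fun a => [set z | derivable f z (delta_mx 0 a) /\
        `|'D_(delta_mx 0 a) f z - c a| <= K]) (nbhs x0)) => a.
      apply: filterI; first exact: df.
      have /cvgrPdist_le /(_ _ K0) := cf a.
      by apply: filterS => z; rewrite distrC.
    have /nbhs_ballP [r /= r0 Br] := nearx.
    have lip := @lipschitz_of_partials R n g x0 (r / 2) K.
    have {}lip x y : `|x - x0| <= r / 2 -> `|y - x0| <= r / 2 ->
        `|g x - g y| <= n%:R * K * `|x - y|.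
      have inB z : `|z - x0| <= r / 2 -> ball x0 r z.
        rewrite -ball_normE /= distrC => h; apply: le_lt_trans h _.
        by rewrite ltr_pdivrMr // ltr_pMr // ltr1n.
      have dg z a : `|z - x0| <= r / 2 ->
          is_derive z (delta_mx 0 a) g ('D_(delta_mx 0 a) f z - c a).
        move=> /inB /Br /(_ a) [dfz _].
        have := is_deriveB (derivableP dfz) (dlin (delta_mx 0 a) z).
        by rewrite csum.
      apply: lip => z a zr; have [dgz vg] := dg z a zr; first exact: dgz.
      by rewrite vg; have [_] := Br z (inB z zr) a.
    have cX : {for u, continuous X}.
      by apply/differentiable_continuous/derivable1_diffP; case: dX.
    have qX : (fun h : R => h^-1 *: ((X \o shift u) (h *: 1) - X u)) @ 0^' --> v.
      case: dX => dX; rewrite /derive => <-; exact: dX.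
    have r20 : 0 < r / 2 by rewrite divr_gt0.
    have H0 : \forall h \near (0 : R), `|(X \o shift u) (h *: 1) - x0| <= r / 2.
      have /cvgrPdist_le /(_ _ r20) := cX; rewrite Xu => cXu.
      have := near_shift 0 u (fun t => `|x0 - X t| <= r / 2).
      have {}cXu : \forall t \near u, `|x0 - X t| <= r / 2 by [].
      move=> E; move: cXu; rewrite E; apply: filterS => t.
      by rewrite /= subr0 distrC [t *: 1]mulr1.
    near=> h.
    rewrite sub0r normrN normrZ.
    have h0 : h != 0 by near: h; exact: nbhs_dnbhs_neq.
    have hX : `|(X \o shift u) (h *: 1) - x0| <= r / 2.
      by near: h; apply: cvg_within H0.
    have hq : `|h^-1 *: ((X \o shift u) (h *: 1) - X u)| <= C.
      near: h; have /cvgrPdist_le /(_ _ ltr01) := qX.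
      apply: filterS => h hv; rewrite -[_ *: _](subKr v) /C.
      by apply: le_trans (ler_normB _ _) _; rewrite lerD2l.
    have /lip H := hX.
    have := H x0; rewrite subrr normr0 => /(_ (ltW r20)) {}H.
    rewrite /= Xu; apply: le_trans (ler_wpM2l (normr_ge0 _) H) _.
    rewrite mulrCA; move: hq; rewrite normrZ Xu => hq.
    apply: le_trans (ler_wpM2l _ hq) _; first by rewrite mulr_ge0 // ltW.
    have n1 : n.+1%:R != 0 :> R by rewrite pnatr_eq0.
    have C1 : C != 0 by rewrite gt_eqF.
    have -> : n%:R * K * C = e * (n%:R / n.+1%:R).
      by rewrite /K; move: (n.+1%:R) n1 => m m0; field; rewrite m0 C1.
    rewrite ler_piMr ?(ltW e0) // ler_pdivrMr ?ltr0n // mul1r ler_nat.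
    exact: leqnSn.
  by split; [apply/cvg_ex; exists 0|exact: cvg_lim H].
have dl := (dlin).
have dlX : is_derive u 1 (fun t => \sum_a c a * X t 0 a) (\sum_a c a * v 0 a).
  have H a : is_derive u 1 (fun t => c a * X t 0 a) (c a * v 0 a).
    have := (is_derive_coord X u v).1 dX 0 a.
    by move=> /(@is_deriveZ _ _ _ _ (c a)).
  have := is_derive_sum (h := fun a t => c a * X t 0 a) H.
  by congr is_derive; apply/funext => t; rewrite fct_sumE.
have := is_deriveD dgX dlX; rewrite add0r.
rewrite (_ : (fun t => g (X t)) + _ = fun t => f (X t)); last first.
  by apply/funext => t; rewrite /g /= /GRing.add /= subrK.
by congr is_derive; apply: eq_bigr => a _; rewrite mulrC.
Unshelve. all: by end_near. Qed.

Lemma primitive_exists (f : R -> R) : continuous f ->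
  exists g : R -> R, g 0 = 0 /\ forall t : R, -1 < t < 1 -> is_derive t 1 g (f t).
Proof.
move=> cf.
have fi : (@lebesgue_measure R).-integrable `[-1, 1] (EFin \o f).
  apply: continuous_compact_integrable; first exact: segment_compact.
  exact: continuous_subspaceT.
pose F x := (\int[@lebesgue_measure R]_(t in [set` `[-1, x]]) (f t))%R.
exists (fun x => F x - F 0); split=> [|t /andP[t1 t2]]; first by rewrite subrr.
have [dF vF] := continuous_FTC1_closed t2 fi t1 (cf t).
have d1 : is_derive t 1 F (f t) by split; [exact: dF|rewrite -derive1E; exact: vF].
have := is_deriveB d1 (is_derive_cst (F 0) t 1); rewrite subr0.
exact.
Qed.

End ChainRule.

(** * Picard iteration for a globally Lipschitz field *)

Section Picard.
Variable R : realType.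

Lemma lipschitz_continuous (V W : normedModType R) (f : V -> W) (K : R) :
  (forall x y, `|f x - f y| <= K * `|x - y|) -> continuous f.
Proof.
move=> Hf x; apply/cvgrPdist_le => e e0.
pose d := e / (`|K| + 1).
have K1 : 0 < `|K| + 1 by rewrite ltr_wpDl.
have d0 : 0 < d by rewrite divr_gt0.
near=> y; apply: le_trans (Hf x y) _.
have xy : `|x - y| <= d.
  near: y; apply: filterS (nbhsx_ballx x _ d0) => y.
  by rewrite -ball_normE /=; apply: ltW.
apply: le_trans (ler_wpM2r (normr_ge0 _) (ler_norm K)) _.
apply: le_trans (ler_wpM2l (normr_ge0 _) xy) _.
rewrite /d mulrCA ler_piMr ?(ltW e0) // ler_pdivrMr // mul1r.
by rewrite lerDl.
Unshelve. all: by end_near. Qed.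

Lemma rV_continuous (T : topologicalType) n (X : T -> 'rV[R]_n) (t : T) :
  (forall j, {for t, continuous (fun s => X s 0 j)}) -> {for t, continuous X}.
Proof.
move=> cX; apply/cvgrPdist_le => e e0.
have H : \forall s \near t, forall j, `|X t 0 j - X s 0 j| <= e.
  apply: (@filter_forall _ _ (fun j => [set s | `|X t 0 j - X s 0 j| <= e]) (nbhs t)) => j.
  by have /cvgrPdist_le /(_ _ e0) := cX j.
apply: filterS H => s H; apply/rV_normP; first exact: ltW.
by move=> j; rewrite !mxE.
Qed.

Lemma coord_continuous_at (T : topologicalType) n (X : T -> 'rV[R]_n) (t : T) j :
  {for t, continuous X} -> {for t, continuous (fun s => X s 0 j)}.
Proof.
move=> /cvgrPdist_le cX; apply/cvgrPdist_le => e e0.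
apply: filterS (cX e e0) => s; apply: le_trans.
by have := rV_coord_le (X t - X s) j; rewrite !mxE.
Qed.

Lemma geometric_small (M e : R) : 0 < e -> exists n : nat, M / 2 ^+ n <= e.
Proof.
move=> e0; have [M0|M0] := leP M 0.
  by exists 0%N; rewrite expr0 divr1 (le_trans M0) // ltW.
exists (Num.bound (M / e)).
rewrite ler_pdivrMr ?exprn_gt0 // mulrC -ler_pdivrMr //.
apply: le_trans (ltW (archi_boundP _)) _; first by rewrite divr_ge0 // ltW.
by rewrite -natrX ler_nat ltnW // ltn_expl.
Qed.

(** The intervals [[u n - e n, u n + e n]] are nested, and the supremum of their left ends lies in
    all of them. *)
Lemma limit_of_contracting (u e : nat -> R) : (forall n, 0 <= e n) ->
  (forall n, `|u n.+1 - u n| <= e n - e n.+1) ->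
  exists x, forall n, `|x - u n| <= e n.
Proof.
move=> e0 ue.
have up m n : (m <= n)%N -> u m - e m <= u n - e n /\ u n + e n <= u m + e m.
  elim: n => [|n IH]; first by rewrite leqn0 => /eqP ->.
  rewrite leq_eqVlt => /orP[/eqP -> //|/IH [h1 h2]].
  by have := ue n; rewrite ler_norml => /andP[h3 h4]; split; lra.
have ab m n : u m - e m <= u n + e n.
  have [h1 _] := up m _ (leq_maxl m n); have [_ h2] := up n _ (leq_maxr m n).
  by have := e0 (maxn m n); lra.
pose A := range (fun n => u n - e n).
have supA : has_sup A.
  split; first by exists (u 0%N - e 0%N); exists 0%N.
  by exists (u 0%N + e 0%N) => _ [n _ <-].
exists (sup A) => n; rewrite ler_norml; apply/andP; split.
  by rewrite lerBrDr addrC; apply: sup_upper_bound => //; exists n.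
rewrite lerBlDr addrC; apply: ge_sup; first by case: supA.
by move=> _ [m _ <-].
Qed.

(** Retraction onto [[a - r, a + r]]. Composing with it extends a local object to all of R without
    increasing its Lipschitz constant. *)
Definition clamp (a r : R) (t : R) : R := Num.max (a - r) (Num.min (a + r) t).

Lemma clamp_bound a r t : 0 <= r -> a - r <= clamp a r t <= a + r.
Proof. by move=> r0; rewrite /clamp le_max lexx ge_max ge_min lexx andbT /=; lra. Qed.

Lemma clamp_id a r t : a - r <= t <= a + r -> clamp a r t = t.
Proof. by move=> /andP[h1 h2]; rewrite /clamp; rewrite min_r // max_r. Qed.

Lemma clamp_lipschitz a r s t : `|clamp a r s - clamp a r t| <= `|s - t|.
Proof.
rewrite /clamp; wlog st : s t / s <= t.
  by move=> H; have [/H //|/ltW /H] := leP s t; rewrite distrC [leRHS]distrC.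
rewrite distrC [leRHS]distrC [leRHS]ger0_norm ?subr_ge0 // ler_norml.
rewrite !maxEle !minEle.
case: (leP (a + r) s) => h1; case: (leP (a + r) t) => h2;
  do ?[case: (leP (a - r) (a + r)) => h3]; do ?[case: (leP (a - r) s) => h4];
  do ?[case: (leP (a - r) t) => h5]; lra.
Qed.

Lemma picard n (F : 'rV[R]_n -> 'rV[R]_n) (L : R) (x0 : 'rV[R]_n) : 0 <= L ->
  (forall x y, `|F x - F y| <= L * `|x - y|) ->
  exists2 d : R, 0 < d & exists2 X : R -> 'rV[R]_n, X 0 = x0 &
    forall t, - d < t < d -> is_derive t 1 X (F (X t)).
Proof.
move=> L0 FL.
(* A primitive is chosen for every function at once, with a property only for continuous ones, so
   that the Picard operator is total. *)
have /choice [prim primP] : forall f : R -> R, exists g : R -> R, continuous f ->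
    g 0 = 0 /\ forall t : R, -1 < t < 1 -> is_derive t 1 g (f t).
  move=> f; have [cf|ncf] := pselect (continuous f); last by exists f.
  by have [g Hg] := primitive_exists cf; exists g.
(* [d * L <= 1/2] makes the iteration halve distances, and [d < 1] keeps times inside the domain of
   the primitives. *)
pose d := (2 * (L + 1))^-1.
have L1 : 0 < L + 1 by rewrite ltr_wpDl.
have d0 : 0 < d by rewrite invr_gt0 mulr_gt0.
have dL : d * (L + 1) = 2^-1.
  by rewrite /d invfM -mulrA mulVf ?mulr1 // gt_eqF.
have dLp : 0 <= d * L by rewrite mulr_ge0 // ltW.
have dLe : d * L + d = 2^-1 by rewrite -dL; ring.
have d1 : d < 1 by clear -dLp dLe; lra.
have cF : continuous F := lipschitz_continuous FL.
pose c := clamp 0 d.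
have cB t : - d <= c t <= d by have := clamp_bound 0 t (ltW d0); rewrite sub0r add0r.
have c1 t : -1 < c t < 1 by have := cB t; lra.
have cc : continuous c.
  by apply: (@lipschitz_continuous _ _ _ 1) => s t; rewrite mul1r clamp_lipschitz.
pose f (X : R -> 'rV[R]_n) j s := F (X s) 0 j.
have cf X j : continuous X -> continuous (f X j).
  move=> cX s; apply: (coord_continuous_at (X := fun s => F (X s))).
  by apply: continuous_comp; [exact: cX|exact: cF].
(* The Picard operator with time clamped to [[-d, d]]: the iterates are continuous on all of R and
   their distances are controlled everywhere. *)
pose T (X : R -> 'rV[R]_n) t : 'rV[R]_n := x0 + \row_j prim (f X j) (c t).
have Tj X t j : T X t 0 j = x0 0 j + prim (f X j) (c t) by rewrite !mxE.
have cT X : continuous X -> continuous (T X).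
  move=> cX t; apply: rV_continuous => j.
  have [_ dg] := primP _ (cf X j cX).
  rewrite (_ : (fun s => T X s 0 j) = (fun s => x0 0 j + prim (f X j) (c s))); last first.
    by apply/funext => s.
  apply: (@cvgD _ _ _ _ _ (fun=> x0 0 j)); first exact: cvg_cst.
  apply: continuous_comp; first exact: cc.
  apply/differentiable_continuous/derivable1_diffP.
  by have [] := dg _ (c1 t).
have Tclose X Y K : continuous X -> continuous Y -> 0 <= K ->
    (forall t, `|F (X t) - F (Y t)| <= K) -> forall t, `|T X t - T Y t| <= d * K.
  move=> cX cY K0 XY t; apply/rV_normP; first by rewrite mulr_ge0 // ltW.
  move=> j; rewrite mxE [(- T Y t) 0 j]mxE !Tj.
  have [X0 dX] := primP _ (cf X j cX); have [Y0 dY] := primP _ (cf Y j cY).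
  have H := @mvt_le R (fun t => prim (f X j) t - prim (f Y j) t)
    (fun t => f X j t - f Y j t) (- d) d K _ _ (c t) 0 (cB t).
  have d00 : - d <= 0 <= d by lra.
  have {H} := H _ _ d00; rewrite X0 Y0 !subr0 => H.
  rewrite opprD addrACA subrr add0r; apply: le_trans (H _ _) _.
  - move=> s sd; have s1 : -1 < s < 1 by lra.
    exact: is_deriveB (dX s s1) (dY s s1).
  - move=> s _; have := rV_coord_le (F (X s) - F (Y s)) j; rewrite !mxE => h.
    exact: le_trans h (XY s).
  - by rewrite mulrC ler_wpM2r // ler_norml; have := cB t.
pose X := fix X k := if k is k'.+1 then T (X k') else fun=> x0.
have cX k : continuous (X k).
  by elim: k => [|k IH] /=; [move=> t; exact: cvg_cst|exact: cT].
pose M := `|F x0| + 1.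
have M0 : 0 < M by rewrite ltr_pwDr.
(* [e k] is the sum of all later bounds [e l], [l > k], so that [e k - e k.+1 = e k.+1], the shape
   required by [limit_of_contracting]. *)
pose e k : R := 2 * M / 2 ^+ k.
have e0 k : 0 < e k by rewrite divr_gt0 ?mulr_gt0 ?exprn_gt0.
have eS k : e k.+1 = e k / 2.
  by rewrite /e exprS invfM mulrA mulrAC.
have XS k t : `|X k.+1 t - X k t| <= e k.+1.
  elim: k t => [|k IH] t.
    rewrite eS /e expr0 divr1 mulrAC mulfV ?mul1r // /=.
    have [|tM] := leP `|T (fun=> x0) t - x0| M => //.
    have : `|T (fun=> x0) t - x0| <= M; last by move=> /le_lt_trans /(_ tM); rewrite ltxx.
    apply/rV_normP; first exact: ltW.
    move=> j; rewrite mxE Tj [(- x0) 0 j]mxE addrAC subrr add0r.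
    have cst0 : continuous (fun _ : R => x0) by move=> s; exact: cvg_cst.
    have [X0 dX] := primP _ (cf _ j cst0).
    have d00 : - d <= 0 <= d by lra.
    have := @mvt_le R _ _ (- d) d `|F x0| _ _ (c t) 0 (cB t) d00.
    move=> /(_ (prim (f (fun=> x0) j)) (f (fun=> x0) j)); rewrite X0 !subr0 => H.
    apply: le_trans (H _ _) _.
    - by move=> s sd; apply: dX; lra.
    - by move=> s _; apply: rV_coord_le.
    apply: (@le_trans _ _ `|F x0|); last by rewrite lerDl.
    by rewrite ler_piMr // ler_norml; have := cB t; lra.
  rewrite eS /=; apply: le_trans (Tclose _ _ (L * e k.+1) (cT _ (cX k)) (cX k) _ _ t) _.
  - by rewrite mulr_ge0 // ltW.
  - by move=> s; apply: le_trans (FL _ _) _; rewrite ler_wpM2l // IH.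
  rewrite mulrA mulrC ler_wpM2l ?(ltW (e0 _)) //; nra.
have /choice [x Hx] : forall tj : R * 'I_n, exists x : R, forall k,
    `|x - X k tj.1 0 tj.2| <= e k.
  move=> [t j] /=; apply: (limit_of_contracting (u := fun k => X k t 0 j)).
    by move=> k; apply: ltW.
  move=> k; rewrite (_ : e k - e k.+1 = e k.+1); last by rewrite eS; field.
  by apply: le_trans (XS k t); have := rV_coord_le (X k.+1 t - X k t) j; rewrite !mxE.
pose Y t : 'rV[R]_n := \row_j x (t, j).
have YX k t : `|Y t - X k t| <= e k.
  apply/rV_normP; first exact: ltW.
  by move=> j; rewrite !mxE; apply: (Hx (t, j) k).
have cY : continuous Y.
  move=> t; apply/cvgrPdist_le => eps eps0.
  have eps3 : 0 < eps / 3 by rewrite divr_gt0.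
  have [k ek] := geometric_small (2 * M) eps3.
  have /cvgrPdist_le /(_ _ eps3) := cX k t; apply: filterS => s Hs.
  have -> : Y t - Y s = (Y t - X k t) + (X k t - X k s) - (Y s - X k s).
    by rewrite opprB !addrA !subrK.
  apply: le_trans (ler_normB _ _) _; apply: le_trans (lerD (ler_normD _ _) (lexx _)) _.
  have := YX k t; have := YX k s; rewrite /e in ek *.
  by move: ek Hs; lra.
have TY t : T Y t = Y t.
  apply/eqP; rewrite -subr_eq0 -normr_le0; apply/ler_addgt0Pr => eps eps0.
  rewrite add0r; have eps3 : 0 < eps / 3 by rewrite divr_gt0.
  have [k ek] := geometric_small (2 * M) eps3.
  have -> : T Y t - Y t = (T Y t - X k.+1 t) - (Y t - X k.+1 t).
    by rewrite opprB subrKA.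
  apply: le_trans (ler_normB _ _) _.
  have h1 : `|T Y t - X k.+1 t| <= d * (L * e k).
    apply: (Tclose _ _ _ cY (cX k)); first by rewrite mulr_ge0 // ltW.
    by move=> s; apply: le_trans (FL _ _) _; rewrite ler_wpM2l.
  have h2 := YX k.+1 t; rewrite eS in h2.
  have h3 : d * (L * e k) <= e k / 2.
    rewrite mulrA mulrC ler_wpM2l ?(ltW (e0 _)) //; nra.
  have h4 : e k <= eps / 3 := ek.
  by have := e0 k; lra.
exists d => //; exists Y.
  rewrite -TY; apply/rowP => j; rewrite Tj.
  have [+ _] := primP _ (cf Y j cY).
  by rewrite /c clamp_id ?sub0r ?add0r; [move=> ->; rewrite addr0|lra].
move=> t td.
have near_eq : \forall s \near t, x0 + \row_j prim (f Y j) s = Y s.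
  have /open_nbhs_nbhs : open_nbhs t (`]- d, d[%classic : set R).
    by split; [exact: interval_open|rewrite /= in_itv].
  apply: filterS => s; rewrite /= in_itv /= => sd.
  by rewrite -[RHS]TY /T /c clamp_id // sub0r add0r; lra.
apply: (near_eq_is_derive near_eq).
apply/is_derive_coord => i j; rewrite (ord1 i).
have [_ dg] := primP _ (cf Y j cY).
rewrite (_ : (fun s => _) = (fun s => x0 0 j + prim (f Y j) s)); last first.
  by apply/funext => s; rewrite !mxE.
have t1 : -1 < t < 1 by lra.
have := is_deriveD (is_derive_cst (x0 0 j) t 1) (dg t t1); rewrite add0r.
exact.
Qed.

End Picard.

(** * Existence of integral curves *)

Section Flow.
Variables (R : realType) (M : manifold R) (X : vfield M).
Hypothesis vX : is_vfield X.
Implicit Types (i j : cidx M) (p q : M) (c : R -> M).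

Lemma cinvK i (x : 'rV[R]_7) : ccod i x -> cmap i (cinv i x) = x.
Proof. exact: pointK. Qed.

Lemma near_ccod i x : ccod i x -> \forall z \near x, ccod i z.
Proof. by move=> ix; apply: open_nbhs_nbhs; split; [exact: cod_open|]. Qed.

Lemma near_cdom i x j : ccod i x -> cdom j (cinv i x) -> \forall z \near x, cdom j (cinv i z).
Proof.
move=> ix jx; have /(_ (cdom j)) := @point_cont _ _ (atlas i) x ix.
by apply; apply: open_nbhs_nbhs; split; [exact: dom_open|].
Qed.

Lemma local_lipschitz i x0 : ccod i x0 -> exists r L, [/\ 0 < r, 0 <= L,
  forall z, `|z - x0| <= r -> ccod i z &
  forall z w, `|z - x0| <= r -> `|w - x0| <= r ->
    `|X i (cinv i z) - X i (cinv i w)| <= L * `|z - w|].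
Proof.
move=> ix; pose f b z := X i (cinv i z) 0 b.
pose K := \sum_b \sum_a `|'D_(ebase R a) (f b) x0| + 1.
have K1 b a : `|'D_(ebase R a) (f b) x0| < K.
  rewrite /K ltr_pwDr // (bigD1 b) //= (bigD1 a) //= -addrA lerDl.
  by rewrite addr_ge0 // ?sumr_ge0 // => *; rewrite sumr_ge0.
have : \forall z \near x0, ccod i z /\ forall b a, `|'D_(ebase R a) (f b) z| <= K.
  apply: filterI; first exact: near_ccod.
  apply: (@filter_forall _ _ (fun b => [set z | forall a, `|'D_(ebase R a) (f b) z| <= K]) (nbhs x0)) => b.
  apply: (@filter_forall _ _ (fun a => [set z | `|'D_(ebase R a) (f b) z| <= K]) (nbhs x0)) => a.
  have [_ /(_ a) [_ cD]] := vX.2 i b 1%N.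
  have /cvg_norm cN := cD x0 ix.
  by apply: filterS (cvgr_lt _ cN _ (K1 b a)) => z /ltW.
move=> /nbhs_ballP [r /= r0 Br].
have inB z : `|z - x0| <= r / 2 -> ball x0 r z.
  rewrite -ball_normE /= distrC => h; apply: le_lt_trans h _.
  by rewrite ltr_pdivrMr // ltr_pMr // ltr1n.
have K0 : 0 <= K by apply: le_trans (ltW (K1 ord0 ord0)).
exists (r / 2), (7%:R * K); split; first by rewrite divr_gt0.
- by rewrite mulr_ge0.
- by move=> z /inB /Br [].
- move=> z w zr wr; apply/rV_normP; first by rewrite !mulr_ge0.
  move=> b; rewrite !mxE.
  apply: (@lipschitz_of_partials R 7 (f b) x0 (r / 2) K) => // y a yr.
    have [_ /(_ a) [dD _]] := vX.2 i b 1%N.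
    by apply: dD; have [] := Br y (inB y yr).
  by have [_ H] := Br y (inB y yr); exact: H.
Qed.

Lemma chart_change i j x (Y : R -> 'rV[R]_7) (u : R) v :
  ccod i x -> cdom j (cinv i x) -> Y u = x -> is_derive u 1 Y v ->
  is_derive u 1 (fun t => cmap j (cinv i (Y t))) (v *m jac i j (cinv i x)).
Proof.
move=> ix jx Yu dY; apply/is_derive_coord => i0 b; rewrite (ord1 i0).
pose V := ccod i `&` cinv i @^-1` cdom j.
have sm := @atlas_compat _ M i j b.
have [_ dD] := sm 1%N.
have nV : \forall z \near x, V z by apply: filterI; [exact: near_ccod|exact: near_cdom].
have := @chain_curve R 7 (fun z => cmap j (cinv i z) 0 b) x Y u v.
rewrite (_ : \sum_a _ = (v *m jac i j (cinv i x)) 0 b); last first.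
  rewrite mxE; apply: eq_bigr => a _; rewrite mxE cinvK //.
apply => //.
- by move=> a; apply: filterS nV => z Vz; apply: (dD a).1.
- by move=> a; apply: (dD a).2; split.
Qed.

Lemma integral_curve_exists p : exists d c,
  [/\ 0 < d, integral_curve X (- d) d c & c 0 = p].
Proof.
pose i := chart_at p; have ip : cdom i p by apply: chart_atP.
pose x0 := cmap i p; have ix : ccod i x0 by apply: coord_cod.
have [r [L [r0 L0 rU FL]]] := local_lipschitz ix.
(* Coordinatewise retraction onto a ball of the sup norm. It makes the field globally Lipschitz; the
   solution is kept only for times at which it stays in the ball, where the field is unchanged. *)
pose cl (z : 'rV[R]_7) : 'rV[R]_7 := \row_j clamp (x0 0 j) r (z 0 j).
have clr z : `|cl z - x0| <= r.
  apply/rV_normP; first exact: ltW.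
  by move=> j; rewrite !mxE ler_norml; have := clamp_bound (x0 0 j) (z 0 j) (ltW r0); lra.
have clid z : `|z - x0| <= r -> cl z = z.
  move=> zr; apply/rowP => j; rewrite mxE clamp_id //.
  have := rV_coord_le (z - x0) j; rewrite !mxE => /le_trans /(_ zr).
  by rewrite ler_norml; lra.
have FL' z w : `|X i (cinv i (cl z)) - X i (cinv i (cl w))| <= L * `|z - w|.
  apply: le_trans (FL _ _ (clr z) (clr w)) _; rewrite ler_wpM2l //.
  apply/rV_normP => // j; rewrite !mxE.
  by apply: le_trans (clamp_lipschitz _ _ _ _) _; have := rV_coord_le (z - w) j; rewrite !mxE.
have [d d0 [Y Y0 dY]] := picard x0 L0 FL'.
have cY t : - d < t < d -> {for t, continuous Y}.
  by move=> td; apply/differentiable_continuous/derivable1_diffP; have [] := dY t td.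
have d00 : - d < 0 < d by lra.
have /cvgrPdist_le /(_ _ r0) := cY 0 d00.
rewrite Y0 => /nbhs_ballP [e /= e0 Be].
pose d' := Num.min d e.
have d'0 : 0 < d' by rewrite lt_min d0.
have d'd t : - d' < t < d' -> - d < t < d.
  by rewrite /d'; move=> /andP[]; rewrite lt_min => h1 /andP[h2 _]; have := ge_min d d e; rewrite lexx /= => h3; apply/andP; split => //; apply: le_lt_trans h1; rewrite lerN2.
have Yr t : - d' < t < d' -> `|Y t - x0| <= r.
  move=> /andP[h1 h2]; rewrite distrC; apply: Be.
  rewrite -ball_normE /= sub0r normrN ltr_norml.
  have h3 : d' <= e by rewrite /d' ge_min lexx orbT.
  by lra.
exists d', (fun t => cinv i (Y t)); split => //; last by rewrite Y0; apply: coordK.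
move=> u ud; have iY := rU _ (Yr u ud); split.
  by apply: continuous_comp; [exact: cY (d'd u ud)|exact: point_cont].
move=> j jc.
have ic : cdom i (cinv i (Y u)) by apply: point_dom.
rewrite (vX.1 i j _ ic jc).
have := chart_change iY jc (erefl _) (dY u (d'd u ud)).
by rewrite clid ?Yr //.
Qed.

End Flow.

(** * Invariance along the flow and uniqueness of integral curves *)

Section Uniqueness.
Variables (R : realType) (M : manifold R) (X : vfield M).
Hypothesis vX : is_vfield X.
Implicit Types (i j : cidx M) (p q : M) (c : R -> M).

(** Differentiate [f] along an integral curve through [p]: its existence turns invariance along
    curves into a condition on the differential at [p]. *)
Lemma pd_along_constant (f : M -> R) i p : constant_along X f -> cdom i p ->
  differentiable_at f p -> \sum_b X i p 0 b * pd i b f p = 0.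
Proof.
move=> fX ip df; have [d [c [d0 ic c0]]] := integral_curve_exists vX p.
have d00 : - d < 0 < d by lra.
have [cc dc] := ic 0 d00; have [_ /= df0] := fX _ _ _ ic 0 d00.
have ic0 : cdom i (c 0) by rewrite c0.
have {}dc := dc i ic0; rewrite c0 in dc.
pose g x := f (cinv i x).
have dg : differentiable g ((cmap i \o c) 0) by rewrite /= c0; apply: df.
have dcd : differentiable (cmap i \o c) 0 by apply/derivable1_diffP; have [] := dc.
have E : 'D_1 (f \o c) 0 = 'D_1 (g \o (cmap i \o c)) 0.
  apply: near_eq_derive.
  have : \forall t \near (0 : R), cdom i (c t).
    by apply: cc; apply: open_nbhs_nbhs; split; [exact: dom_open|].
  by apply: filterS => t ict; rewrite /= /g cmapK.
move: df0; rewrite E deriveE; last exact: differentiable_comp.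
rewrite diff_comp //= -(deriveE _ dcd); have [_ ->] := dc.
rewrite c0 => e0; rewrite -[RHS]e0 [in RHS](row_sum_delta (X i p)) linear_sum /=.
apply: eq_bigr => b _; rewrite linearZ /= /pd deriveE //; exact: df.
Qed.

Lemma integral_curve_shift s t c u :
  integral_curve X s t c -> integral_curve X (s - u) (t - u) (fun v => c (v + u)).
Proof.
move=> ic v vst; have vu : s < v + u < t by lra.
have [cc dc] := ic _ vu; split.
  apply: (continuous_comp (f := fun v => v + u) (g := c)) => //.
  by apply: cvgD; [exact: cvg_id|exact: cvg_cst].
move=> i iv; have [d1 d2] := dc i iv.
have E : (fun h : R => h^-1 *: (((cmap i \o (fun v => c (v + u))) \o shift v) (h *: 1) -
     (cmap i \o (fun v => c (v + u))) v)) =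
   (fun h => h^-1 *: (((cmap i \o c) \o shift (v + u)) (h *: 1) - (cmap i \o c) (v + u))).
  by apply/funext => h; rewrite /= addrA.
by split; [rewrite /derivable E|rewrite /derive E].
Qed.

(** In place of Gronwall's inequality: on a time interval so short that [L * d <= 1/2], each use of
    the mean value theorem halves the bound on the distance of the two curves. *)
Lemma local_unique s1 t1 c1 s2 t2 c2 u :
  integral_curve X s1 t1 c1 -> integral_curve X s2 t2 c2 ->
  s1 < u < t1 -> s2 < u < t2 -> c1 u = c2 u -> \forall t \near u, c1 t = c2 t.
Proof.
move=> ic1 ic2 u1 u2 cu; pose i := chart_at (c1 u).
have iu : cdom i (c1 u) by apply: chart_atP.
pose x0 := cmap i (c1 u); have ix : ccod i x0 by apply: coord_cod.
have [r [L [r0 L0 rU FL]]] := local_lipschitz vX ix.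
have near_good s t c : integral_curve X s t c -> s < u < t -> c u = c1 u ->
   \forall v \near u, [/\ s < v < t, cdom i (c v) & `|cmap i (c v) - x0| <= r].
  move=> ic us e; have [cc dc] := ic u us.
  have icu : cdom i (c u) by rewrite e.
  have n1 : \forall v \near u, s < v < t.
    have /open_nbhs_nbhs : open_nbhs u (`]s, t[%classic : set R).
      by split; [exact: interval_open|rewrite /= in_itv].
    by apply: filterS => v /=; rewrite in_itv.
  have n2 : \forall v \near u, cdom i (c v).
    by apply: cc; apply: open_nbhs_nbhs; split; [exact: dom_open|].
  have n3 : \forall v \near u, `|cmap i (c v) - x0| <= r.
    have : {for u, continuous (cmap i \o c)}.
      by apply: continuous_comp; [exact: cc|exact: coord_cont].
    move=> /cvgrPdist_le /(_ _ r0); apply: filterS => v.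
    by rewrite /= e distrC.
  by apply: filterS3 n1 n2 n3 => v.
have /nbhs_ballP [e /= e0 Be] : \forall v \near u,
  [/\ s1 < v < t1, cdom i (c1 v) & `|cmap i (c1 v) - x0| <= r] /\
  [/\ s2 < v < t2, cdom i (c2 v) & `|cmap i (c2 v) - x0| <= r].
  by apply: filterI; [exact: near_good ic1 u1 _|exact: near_good ic2 u2 _].
pose d := Num.min (e / 2) (2 * (L + 1))^-1.
have L1 : 0 < L + 1 by rewrite ltr_wpDl.
have d0 : 0 < d by rewrite lt_min divr_gt0 // invr_gt0 mulr_gt0.
have dL : L * d <= 2^-1.
  have : d * (L + 1) <= (2 * (L + 1))^-1 * (L + 1).
    by rewrite ler_wpM2r ?(ltW L1) // ge_min lexx orbT.
  by rewrite invfM -mulrA mulVf ?gt_eqF // mulr1; nra.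
have de : d <= e / 2 by rewrite ge_min lexx.
have inB v : u - d <= v <= u + d -> ball u e v.
  move=> ud; rewrite -ball_normE /= ltr_norml; lra.
pose y1 v := cmap i (c1 v); pose y2 v := cmap i (c2 v).
have bound n v : u - d <= v <= u + d -> `|y1 v - y2 v| <= 2 * r / 2 ^+ n.
  elim: n v => [|n IH] v ud.
    have [[_ _ h1] [_ _ h2]] := Be v (inB v ud).
    rewrite expr0 divr1 (_ : y1 v - y2 v = (y1 v - x0) - (y2 v - x0)).
      by apply: le_trans (ler_normB _ _) _; rewrite mulr_natl mulr2n lerD.
    by rewrite opprB subrKA.
  have e2 : 2 * r / 2 ^+ n.+1 = 2 * r / 2 ^+ n / 2.
    by rewrite exprS invfM mulrA mulrAC.
  have p0 : 0 <= 2 * r / 2 ^+ n by rewrite divr_ge0 ?exprn_ge0 ?mulr_ge0 // ltW.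
  apply/rV_normP => [|j]; first by rewrite e2 divr_ge0.
  have ud0 : u - d <= u <= u + d by lra.
  have := @mvt_le R (fun v => y1 v 0 j - y2 v 0 j)
    (fun v => X i (c1 v) 0 j - X i (c2 v) 0 j) (u - d) (u + d)
    (L * (2 * r / 2 ^+ n)) _ _ v u ud ud0.
  have -> : y1 u 0 j - y2 u 0 j = 0 by rewrite /y1 /y2 cu subrr.
  rewrite subr0 => H; rewrite !mxE; apply: le_trans (H _ _) _.
  - move=> w wd; have [[w1 i1 _] [w2 i2 _]] := Be w (inB w wd).
    have [_ /(_ i i1) /is_derive_coord /(_ 0 j) D1] := ic1 w w1.
    have [_ /(_ i i2) /is_derive_coord /(_ 0 j) D2] := ic2 w w2.
    exact: is_deriveB D1 D2.
  - move=> w wd; have [[w1 i1 h1] [w2 i2 h2]] := Be w (inB w wd).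
    have := FL _ _ h1 h2; rewrite !cmapK // => F12.
    have := rV_coord_le (X i (c1 w) - X i (c2 w)) j; rewrite !mxE => /le_trans; apply.
    by apply: le_trans F12 _; rewrite ler_wpM2l // IH.
  - have vd : `|v - u| <= d by rewrite ler_norml; lra.
    apply: (@le_trans _ _ (L * (2 * r / 2 ^+ n) * d)).
      by rewrite ler_wpM2l // mulr_ge0.
    by rewrite mulrAC e2 [leRHS]mulrC ler_wpM2r.
have nd : \forall t \near u, ball u d t by apply: nbhsx_ballx.
apply: filterS nd => t; rewrite -ball_normE /= ltr_norml => td.
have td' : u - d <= t <= u + d by lra.
have [[_ i1 _] [_ i2 _]] := Be t (inB t td').
suff e12 : y1 t = y2 t by rewrite -(cmapK i1) -(cmapK i2) -/(y1 t) e12.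
apply/eqP; rewrite -subr_eq0 -normr_le0; apply/ler_addgt0Pr => eps eps0.
have [n nE] := geometric_small (2 * r) eps0.
by rewrite add0r; apply: le_trans (bound n t td') nE.
Qed.

(** Connectedness of [[0, b]]: if [P] failed somewhere, the infimum [w] of its failures would
    contradict openness, of [P] if [P w] holds and of its negation otherwise. *)
Lemma interval_induction (P : R -> Prop) (b : R) : P 0 ->
  (forall u, 0 <= u <= b -> P u -> \forall v \near u, P v) ->
  (forall u, 0 <= u <= b -> ~ P u -> \forall v \near u, ~ P v) ->
  forall v, 0 <= v <= b -> P v.
Proof.
move=> P0 oP cP v vb; apply: contrapT => nPv.
pose B := [set t | 0 <= t <= v /\ ~ P t].
have infB : has_inf B.
  by split; [exists v; split => //; lra|exists 0 => t [/andP[]]].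
pose w := inf B.
have wv : w <= v by apply: inf_lbound => //; [exact: infB.2|split => //; lra].
have w0 : 0 <= w by apply: lb_le_inf; [exact: infB.1|move=> t [/andP[]]].
have wb : 0 <= w <= b by lra.
have below t : 0 <= t -> t < w -> P t.
  move=> t0 tw; apply: contrapT => nPt.
  have : w <= t by apply: inf_lbound; [exact: infB.2|split => //; lra].
  by lra.
have [Pw|nPw] := pselect (P w).
  have /nbhs_ballP [e /= e0 Be] := oP w wb Pw.
  have [t [/andP[t0 tv] nPt] twe] := inf_adherent e0 infB.
  apply: nPt; have [tw|wt] := ltP t w; first exact: below.
  apply: Be; rewrite -ball_normE /= ltr_norml; move: twe; rewrite -/w; lra.
have /nbhs_ballP [e /= e0 Be] := cP w wb nPw.
have wpos : 0 < w by rewrite lt_neqAle w0 andbT; apply: contra_notN nPw => /eqP <-.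
pose t := Num.max 0 (w - e / 2).
have t0 : 0 <= t by rewrite le_max lexx.
have tw : t < w by rewrite gt_max wpos /=; lra.
have : w - e / 2 <= t by rewrite le_max lexx orbT.
move=> tw'; apply: (Be t); last exact: below.
by rewrite -ball_normE /= ltr_norml; lra.
Qed.

(** Agreement is open by local uniqueness, disagreement is open because M is Hausdorff; negative
    times are treated by reflection. *)
Lemma integral_curve_unique s1 t1 c1 s2 t2 c2 :
  integral_curve X s1 t1 c1 -> integral_curve X s2 t2 c2 ->
  s1 < 0 < t1 -> s2 < 0 < t2 -> c1 0 = c2 0 ->
  forall v, s1 < v < t1 -> s2 < v < t2 -> c1 v = c2 v.
Proof.
move=> ic1 ic2 z1 z2 e0.
have opn u : s1 < u < t1 -> s2 < u < t2 -> c1 u = c2 u -> \forall v \near u, c1 v = c2 v.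
  exact: local_unique ic1 ic2.
have cls u : s1 < u < t1 -> s2 < u < t2 -> c1 u <> c2 u -> \forall v \near u, c1 v <> c2 v.
  move=> u1 u2 ne; have [k1 _] := ic1 u u1; have [k2 _] := ic2 u u2.
  have [[A B] /= [Au Bu] [oA oB AB]] : exists2 AB : set M * set M,
     (c1 u \in AB.1 /\ c2 u \in AB.2) & [/\ open AB.1, open AB.2 & AB.1 `&` AB.2 == set0].
    by have := @mhausdorff _ M; rewrite open_hausdorff => H; apply: H; apply/eqP.
  have nA : \forall v \near u, A (c1 v).
    by apply: k1; apply: open_nbhs_nbhs; split => //; apply/set_mem.
  have nB : \forall v \near u, B (c2 v).
    by apply: k2; apply: open_nbhs_nbhs; split => //; apply/set_mem.
  apply: filterS2 nA nB => v Av Bv e12.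
  by have /eqP/seteqP [/(_ (c1 v)) H _] := AB; apply: H; split => //; rewrite e12.
move=> v v1 v2; have [v0|v0] := leP 0 v.
  apply: (@interval_induction (fun v => c1 v = c2 v) v) => //; last by lra.
    by move=> u uv; apply: opn; lra.
  by move=> u uv; apply: cls; lra.
have nearN (Q : R -> Prop) (u : R) : (\forall w \near - u, Q w) -> \forall w \near u, Q (- w).
  have C : {for u, continuous (-%R : R -> R)} by apply: opp_continuous.
  by move=> H; exact: (C Q H).
rewrite -(opprK v).
apply: (@interval_induction (fun v => c1 (- v) = c2 (- v)) (- v)).
- by rewrite oppr0.
- by move=> u uv H; apply: (nearN (fun w => c1 w = c2 w)); apply: opn => //; lra.
- by move=> u uv H; apply: (nearN (fun w => c1 w <> c2 w)); apply: cls => //; lra.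
- by lra.
Qed.

End Uniqueness.

Lemma continuous_at_sum (R : realType) (T : topologicalType) (I : Type) (r : seq I)
    (f : I -> T -> R) (x : T) :
  (forall i, {for x, continuous (f i)}) ->
  {for x, continuous (fun z => \sum_(i <- r) f i z)}.
Proof.
move=> H; elim: r => [|i r IH].
  rewrite (_ : (fun z => _) = fun=> 0); first exact: cvg_cst.
  by apply/funext => z; rewrite big_nil.
rewrite (_ : (fun z => _) = fun z => f i z + \sum_(j <- r) f j z).
  exact: (cvgD (H i) IH).
by apply/funext => z; rewrite big_cons.
Qed.

(** * Orbits and transverse segments *)

Section OrbitsAreThin.
Variables (R : realType) (M : manifold R) (X : vfield M).
Hypothesis vX : is_vfield X.
Implicit Types (i : cidx M) (p q : M) (c : R -> M).

(** The orbit with a time attached to its points; by uniqueness of integral curves the time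
    determines the point. *)
Definition reach p (v : R) q := exists s t c,
  [/\ integral_curve X s t c, s < 0 < t, s < v < t, c 0 = p & c v = q].

Lemma flow_orbit_reach p q : flow_orbit X p q -> exists v, reach p v q.
Proof.
move=> [s [t [u [v [c [ic us vs cu cv]]]]]]; exists (v - u).
exists (s - u), (t - u), (fun x => c (x + u)); split.
- exact: integral_curve_shift.
- by lra.
- by lra.
- by rewrite add0r.
- by rewrite subrK.
Qed.

Lemma reach_unique p v q s t c : integral_curve X s t c -> s < 0 < t -> s < v < t ->
  c 0 = p -> reach p v q -> c v = q.
Proof.
move=> ic s0 sv cp [s' [t' [c' [ic' s0' sv' cp' <-]]]].
by apply: (integral_curve_unique vX ic ic' s0 s0') => //; rewrite cp cp'.
Qed.

Lemma isolated_zero (k : R -> R) (u a : R) : k u = 0 -> a != 0 -> is_derive u 1 k a ->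
  exists2 e, 0 < e & forall v, `|v - u| < e -> k v = 0 -> v = u.
Proof.
move=> ku a0 [dk vk].
have H : (fun h : R => h^-1 *: ((k \o shift u) (h *: 1) - k u)) @ 0^' --> a.
  by rewrite -vk; exact: dk.
have a1 : 0 < `|a| by rewrite normr_gt0.
have /cvgrPdist_lt /(_ _ a1) := H.
rewrite near_withinE => /nbhs_ballP [e /= e0 Be]; exists e => // v vu kv.
apply/eqP/negPn/negP => nvu.
have vu0 : v - u != 0 by rewrite subr_eq0.
have := Be (v - u); rewrite /ball /= sub0r normrN => /(_ vu vu0).
by rewrite ku subr0 [(v - u) *: 1]mulr1 subrK kv scaler0 subr0 ltxx.
Qed.

(** An injection into pairs of rationals would make the interval countable, hence of Lebesgue
    measure 0. *)
Lemma uncountable_segment (T : R) : 0 < T ->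
  ~ exists r : R -> rat * rat, forall x y, 0 < x < T -> 0 < y < T -> r x = r y -> x = y.
Proof.
move=> T0 [r rI].
have cA : countable (`]0, T[%classic : set R).
  apply/countable_injP; exists (fun x => pickle (r x)) => x y.
  rewrite !inE /= !in_itv /= => xT yT /(pcan_inj pickleK); exact: rI.
have := countable_lebesgue_measure0 cA.
rewrite lebesgue_measure_itv /= lte_fin T0 sube0 => -[e].
by rewrite e ltxx in T0.
Qed.

(* The segment leaves x0 transversally to the flow, so that the times at which the
   orbit meets it are isolated: there are only countably many of them. *)
Lemma orbit_misses_segment p i x0 (w : 'rV[R]_7) (T : R) :
  ccod i x0 -> X i (cinv i x0) != 0 -> w != 0 ->
  \sum_j X i (cinv i x0) 0 j * w 0 j = 0 -> 0 < T ->
  exists2 t, 0 < t < T & ~ flow_orbit X p (cinv i (x0 + t *: w)).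
Proof.
move=> ix X0 w0 Xw T0; set V := X i (cinv i x0) in X0 Xw *.
(* The Euclidean product with [V] in the chart: constant along the segment and strictly increasing
   along the flow near [x0]. *)
pose l (z : 'rV[R]_7) := \sum_j V 0 j * z 0 j.
have lV : 0 < l V.
  rewrite lt_neqAle eq_sym; apply/andP; split; last first.
    by apply: sumr_ge0 => j _; rewrite -expr2 sqr_ge0.
  apply: contra X0 => /eqP H; apply/eqP/rowP => j; rewrite mxE.
  have H0 : V 0 j * V 0 j = 0.
    by apply: (psumr_eq0P _ H) => // k _; rewrite -expr2 sqr_ge0.
  by apply/eqP; rewrite -sqrf_eq0 expr2 H0.
have nearx : \forall z \near x0, ccod i z /\ 0 < l (X i (cinv i z)).
  apply: filterI; first exact: near_ccod.
  have cl : {for x0, continuous (fun z => l (X i (cinv i z)))}.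
    apply: (continuous_at_sum (f := fun j z => V 0 j * X i (cinv i z) 0 j)) => j.
    exact: (cvgM (cvg_cst (V 0 j)) (vX.2 i j 0%N x0 ix)).
  exact: (cvgr_gt _ cl).
have /nbhs_ballP [e /= e0 Be] := nearx.
have w1 : 0 < `|w| by rewrite normr_gt0.
pose T' := Num.min T (e / `|w|).
have T'0 : 0 < T' by rewrite lt_min T0 divr_gt0.
pose sg t := x0 + t *: w.
have sgI : injective sg.
  move=> s t /addrI /eqP; rewrite -subr_eq0 -scalerBl scaler_eq0 (negPf w0) orbF.
  by rewrite subr_eq0 => /eqP.
have sgB (t : R) : 0 < t < T' -> ccod i (sg t) /\ 0 < l (X i (cinv i (sg t))).
  move=> /andP[t0 tT]; apply: Be; rewrite -ball_normE /= /sg opprD addNKr normrN normrZ.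
  rewrite gtr0_norm // -ltr_pdivlMr //; apply: lt_le_trans tT _.
  by rewrite ge_min lexx orbT.
apply: contrapT => H.
have {}H (t : R) : 0 < t < T' -> flow_orbit X p (cinv i (sg t)).
  move=> /andP[t0 tT]; apply: contrapT => Ht; apply: H; exists t => //.
  by rewrite t0 (lt_le_trans tT) // ge_min lexx.
have /choice [v vP] : forall t : R, exists v : R, 0 < t < T' -> reach p v (cinv i (sg t)).
  move=> t; have [tT|nt] := pselect (0 < t < T'); last by exists 0.
  by have [v Hv] := flow_orbit_reach (H t tT); exists v.
apply: (uncountable_segment T'0).
(* The meeting times being isolated, a rational interval around [v t] contains no other one; its two
   ends determine [t]. *)
have /choice [r rP] : forall t : R, exists r : rat * rat, 0 < t < T' ->
    ratr r.1 < v t < ratr r.2 /\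
    forall t', 0 < t' < T' -> ratr r.1 < v t' < ratr r.2 -> t' = t.
  move=> t; have [tT|nt] := pselect (0 < t < T'); last by exists (0, 0).
  have [it lt] := sgB t tT.
  have [s1 [t1 [c [ic s0 sv cp cv]]]] := vP t tT.
  have icv : cdom i (c (v t)) by rewrite cv; apply: point_dom.
  have [_ /(_ i icv) dc] := ic _ sv.
  pose k u := l (cmap i (c u)) - l x0.
  have lsg t' : l (sg t') = l x0.
    rewrite /l /sg; under eq_bigr do rewrite !mxE mulrDr mulrCA.
    by rewrite big_split /= -big_distrr /= Xw mulr0 addr0.
  have kz t' u : ccod i (sg t') -> c u = cinv i (sg t') -> k u = 0.
    by move=> it' cu; rewrite /k cu cinvK // lsg subrr.
  have dk : is_derive (v t) 1 k (l (X i (c (v t)))).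
    have H1 j : is_derive (v t) 1 (fun u => V 0 j * cmap i (c u) 0 j)
        (V 0 j * X i (c (v t)) 0 j).
      have := (is_derive_coord (cmap i \o c) _ _).1 dc 0 j.
      by move=> /(@is_deriveZ _ _ _ _ (V 0 j)).
    have := is_deriveB (is_derive_sum (h := fun j u => V 0 j * cmap i (c u) 0 j) H1)
       (is_derive_cst (l x0) (v t) 1).
    rewrite subr0; congr is_derive; apply/funext => u.
    by rewrite /k /l fct_sumE.
  have [|d d0 Hd] := isolated_zero (kz t (v t) it cv) _ dk.
    by rewrite cv gt_eqF.
  have [s1v vt1] := andP sv.
  (* Within [d'] the time stays in the domain of [c], so that by uniqueness [c] itself passes
     through the other meeting point. *)
  pose d' := Num.min d (Num.min (v t - s1) (t1 - v t)).
  have d'0 : 0 < d' by rewrite !lt_min d0 !subr_gt0 s1v.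
  have [qa Ha] : exists q : rat, ratr q \in `]v t - d', v t[ by apply: rat_in_itvoo; lra.
  have [qb Hb] : exists q : rat, ratr q \in `]v t, v t + d'[ by apply: rat_in_itvoo; lra.
  move: Ha Hb; rewrite !in_itv /= => /andP[a1 a2] /andP[b1 b2].
  exists (qa, qb) => _; split; first by rewrite /= a2 b1.
  move=> t' tT' /andP[/= h1 h2]; have [it' _] := sgB t' tT'.
  have dd : d' <= d by rewrite ge_min lexx.
  have ds : d' <= v t - s1 by rewrite !ge_min lexx orbT.
  have dt : d' <= t1 - v t by rewrite !ge_min lexx !orbT.
  have st' : s1 < v t' < t1 by lra.
  have cv' := reach_unique ic s0 st' cp (vP t' tT').
  have vv : v t' = v t.
    by apply: Hd (kz t' _ it' cv'); rewrite ltr_norml; lra.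
  apply: sgI; rewrite -(cinvK it') -(cinvK it); congr (cmap i _).
  by rewrite -cv' vv cv.
exists r => x y xT yT rxy; have [rx _] := rP x xT; have [_ ry] := rP y yT.
by apply: ry => //; rewrite -rxy.
Qed.

End OrbitsAreThin.

(** * The metric in different charts *)

Section ContractionInjective.
Variable R : realType.

Lemma lst_cons k x (b : ix k) : lst (ix_cons x b) = nat_of_ord x :: lst b.
Proof.
apply: (@eq_from_nth _ 7%N); rewrite /= ?size_lst // => -[|i] ik.
  by rewrite (nth_lst _ (Ordinal ik)) (_ : Ordinal ik = ord0) ?ix_cons0 //; apply: val_inj.
rewrite (nth_lst _ (Ordinal ik)) /= (nth_lst _ (Ordinal (ik : (i < k)%N))).
by rewrite (_ : Ordinal ik = lift ord0 (Ordinal (ik : (i < k)%N))) ?ix_consS //; apply: val_inj.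
Qed.

Lemma prod_ix_cons k (P : 'M[R]_7) x y (a b : ix k) :
  \prod_(l < k.+1) P (ix_cons x a l) (ix_cons y b l) = P x y * \prod_(l < k) P (a l) (b l).
Proof.
rewrite big_ord_recl !ix_cons0; congr (_ * _).
by apply: eq_bigr => l _; rewrite !ix_consS.
Qed.

Lemma iprod_pull k (P : 'M[R]_7) (u : 'rV[R]_7) (T : tens R k.+1) a :
  iprod u (pull P T) a = pull P (iprod (u *m P) T) a.
Proof.
rewrite /iprod /pull; under eq_bigr do rewrite sum_ixS big_distrr /=.
rewrite exchange_big /=; under [RHS]eq_bigr do rewrite big_distrr /=.
rewrite [RHS]exchange_big /=; apply: eq_bigr => x _.
under eq_bigr do rewrite big_distrr /=.
rewrite exchange_big /=; apply: eq_bigr => e _.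
rewrite mxE big_distrl big_distrr /=; apply: eq_bigr => b _.
by rewrite !ix_cat1 prod_ix_cons; ring.
Qed.

Lemma bil_pull (P : 'M[R]_7) (S : tens R 2) (u v : 'rV[R]_7) :
  bil (pull P S) u v = bil S (u *m P) (v *m P).
Proof.
have -> : bil (pull P S) u v = (u *m (P *m gram S *m P^T) *m v^T) 0 0.
  rewrite /bil; congr ((u *m _ *m _) 0 0); apply/matrixP => i j.
  by rewrite mulmx_bil mxE pull_bil.
by rewrite /bil trmx_mul !mulmxA.
Qed.

Lemma th1_pull (P : 'M[R]_7) (th : tens R 1) (u : 'rV[R]_7) :
  th1 (pull P th) u = th1 th (u *m P).
Proof.
rewrite /th1; under eq_bigr do rewrite pull_ix1 big_distrr /=.
rewrite exchange_big /=; apply: eq_bigr => a _.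
by rewrite mxE big_distrl; apply: eq_bigr => b _ /=; rewrite mulrA.
Qed.

(** By [sum_ff] the contractions of Re Upsilon with the frame vectors of [ker theta] are orthogonal
    and of equal norm: the squared norm of the contraction with [u] is a multiple of the squared
    length of [u]. *)
Lemma contraction_injective (th : tens R 1) (re : tens R 3) (P : 'M[R]_7) (h x y : R)
    (u : 'rV[R]_7) :
  P \in unitmx -> h != 0 -> (forall a, pull P th a = h^-1 * zform e0 a) ->
  (forall a, pull P re a = x * zform re0 a + - y * zform im0 a) ->
  x ^+ 2 + y ^+ 2 = 1 -> th1 th u = 0 -> (forall a, iprod u re a = 0) -> u = 0.
Proof.
move=> Pu h0 Pth Pre xy1 thu ure; pose c := u *m invmx P.
have uE : u = c *m P by rewrite mulmxKV.
clearbody c; subst u.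
have c0 : c 0 ord0 = 0.
  move: thu; rewrite -th1_pull /th1 (bigD1 ord0) //= big1 => [|i ni].
    rewrite addr0 Pth formE // (_ : formv _ _ = 1) => [|].
      by rewrite mulr1 => /eqP; rewrite mulf_eq0 invr_eq0 (negPf h0) orbF => /eqP.
    by rewrite -(ix_cons_ix1 ord0 [ffun=> ord0]) lst_cons (size0nil (size_lst _)).
  rewrite Pth formE // -(ix_cons_ix1 i [ffun=> ord0]) lst_cons (size0nil (size_lst _)).
  rewrite (_ : formv _ _ = 0) ?mulr0z ?mulr0 //.
  by move: i ni => [[|i] hi].
pose f (i : 'I_7) (s : seq nat) : R :=
  y * (formv im0 (nat_of_ord i :: s))%:~R - x * (formv re0 (nat_of_ord i :: s))%:~R.
have H (a : ix 2) : \sum_i c 0 i * f i (lst a) = 0.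
  have : iprod c (pull P re) a = 0.
    by rewrite iprod_pull /pull big1 // => b _; rewrite ure mulr0.
  move=> e0; transitivity (- iprod c (pull P re) a); last by rewrite e0 oppr0.
  rewrite /iprod -sumrN.
  apply: eq_bigr => i _; rewrite ix_cat1 Pre (formE R (ix_cons i a) (isT : wf 3 re0)).
  rewrite (formE R (ix_cons i a) (isT : wf 3 im0)) lst_cons /f.
  set A := (formv re0 _)%:~R; set B := (formv im0 _)%:~R; ring.
have S0 : \sum_(i < 7) \sum_(j < 7) c 0 i * c 0 j *
    (\sum_(a : ix 2) f i (lst a) * f j (lst a)) = 0.
  transitivity (\sum_(a : ix 2) (\sum_i c 0 i * f i (lst a)) ^+ 2); last first.
    by rewrite big1 // => a _; rewrite H expr0n.
  under [RHS]eq_bigr do rewrite expr2 big_distrl /=.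
  rewrite [RHS]exchange_big /=; apply: eq_bigr => i _.
  under [RHS]eq_bigr do rewrite big_distrr /=.
  rewrite [RHS]exchange_big /=; apply: eq_bigr => j _.
  rewrite big_distrr /=; apply: eq_bigr => a _; ring.
have S1 : \sum_(i < 7) (if (nat_of_ord i != 0)%N then 4 * c 0 i ^+ 2 else 0) = 0.
  rewrite -[RHS]S0; apply: eq_bigr => i _.
  rewrite (bigD1 i isT) /= [X in _ = _ + X]big1 => [|j nj].
    rewrite addr0 (sum_ff xy1) eqxx /=; case: ifP => _; last by rewrite mulr0.
    by ring.
  by rewrite (sum_ff xy1) eq_sym (negPf nj) mulr0.
have ci (i : 'I_7) : c 0 i = 0.
  have [->//|ni] := eqVneq i ord0.
  have : (if (nat_of_ord i != 0)%N then 4 * c 0 i ^+ 2 else 0) = 0.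
    apply: (psumr_eq0P _ S1) => // j _; case: ifP => // _.
    by rewrite mulr_ge0 // sqr_ge0.
  have -> : (nat_of_ord i != 0)%N by move: ni; rewrite -val_eqE.
  by move=> /eqP; rewrite mulf_eq0 pnatr_eq0 /= sqrf_eq0 => /eqP.
by rewrite (_ : c = 0) ?mul0mx //; apply/rowP => i; rewrite ci mxE.
Qed.

End ContractionInjective.

Section ChartIndependence.
Variables (R : realType) (M : contactCY R).
Implicit Types (i j : cidx M) (p : M).

(** Carry a coordinate line of the chart [i] to the chart [j] and back, and compare its two
    velocities. *)
Lemma jac_inv i j p : cdom i p -> cdom j p -> jac i j p *m jac j i p = 1%:M.
Proof.
move=> ip jp; apply/row_matrixP => a; rewrite row_mul row1.
have ix : ccod i (cmap i p) by apply: coord_cod.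
have jx : ccod j (cmap j p) by apply: coord_cod.
pose Y (t : R) : 'rV[R]_7 := cmap i p + t *: ebase R a.
have dY : is_derive (0 : R) 1 Y (ebase R a).
  have := @is_derive_line R _ _ (fun z : 'rV[R]_7 => z) (cmap i p) (ebase R a) 0.
  by rewrite derive_id; apply; apply: derivable_id.
have Y0 : Y 0 = cmap i p by rewrite /Y scale0r addr0.
have jci : cdom j (cinv i (cmap i p)) by rewrite cmapK.
have := chart_change ix jci Y0 dY; rewrite cmapK // => dZ.
have Z0 : cmap j (cinv i (Y 0)) = cmap j p by rewrite Y0 cmapK.
have icj : cdom i (cinv j (cmap j p)) by rewrite cmapK.
have := chart_change jx icj Z0 dZ; rewrite cmapK // => dW.
have e : is_derive (0 : R) 1 Y (ebase R a *m jac i j p *m jac j i p).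
  apply: near_eq_is_derive dW.
  have cY : {for 0, continuous Y}.
    by apply/differentiable_continuous/derivable1_diffP; case: dY.
  have nY : \forall t \near (0 : R), ccod i (Y t) /\ cdom j (cinv i (Y t)).
    have nY0 : \forall z \near Y 0, ccod i z /\ cdom j (cinv i z).
      by rewrite Y0; apply: filterI; [exact: near_ccod|exact: near_cdom].
    exact: (cY _ nY0).
  by apply: filterS nY => t [it jt]; rewrite cmapK // cinvK.
have [_ eY] := dY; have [_ eY'] := e.
by rewrite rowE -[RHS]eY eY'.
Qed.

(** Since J is determined by theta and Upsilon, it inherits their transformation law. *)
Lemma acs_unique i p (u v : 'rV[R]_7) : cdom i p -> th1 (@theta _ M i p) v = 0 ->
  (forall a, iprod v (ReU i p) a = - iprod u (ImU i p) a) -> v = u *m acs i p.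
Proof.
move=> ip v0 vu; have [P [x [y [Pg [_ Pth] _ [Pre _] xy1]]]] := cy_frame ip ltr01.
apply/eqP; rewrite -subr_eq0; apply/eqP.
apply: (contraction_injective (frame_unit Pg) (oner_neq0 _) Pth Pre xy1).
  have uJ : th1 (theta i p) (u *m acs i p) = 0 by apply: acs_ker.
  by rewrite -scaleN1r th1D th1Z v0 uJ mulr0 addr0.
move=> a; transitivity (iprod v (ReU i p) a - iprod (u *m acs i p) (ReU i p) a).
  by rewrite /iprod -sumrB; apply: eq_bigr => b _; rewrite !mxE mulrBl.
by rewrite vu ReU_acs // subrr.
Qed.

Lemma form_pull k (T : tfield M k) i j p : is_form T -> cdom i p -> cdom j p ->
  T i p = pull (jac i j p) (T j p).
Proof. by move=> [_ tT _] ip jp; apply/funext => a; rewrite (tT i j p ip jp). Qed.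

Lemma acs_transform i j p (w : 'rV[R]_7) : cdom i p -> cdom j p ->
  w *m acs i p *m jac i j p = w *m jac i j p *m acs j p.
Proof.
move=> ip jp; apply: acs_unique => //.
  rewrite -th1_pull -(form_pull (@theta_form _ M) ip jp); exact: acs_ker.
have H (a : ix 2) : pull (jac i j p) (iprod (w *m acs i p *m jac i j p) (ReU j p)) a =
   - pull (jac i j p) (iprod (w *m jac i j p) (ImU j p)) a.
  rewrite -!iprod_pull -(form_pull (@ReU_form _ M) ip jp) -(form_pull (@ImU_form _ M) ip jp).
  exact: ReU_acs.
have Ju : jac i j p \in unitmx by have [] := mulmx1_unit (jac_inv ip jp).
apply: (pull_inj Ju) => a; rewrite H -mulN1r -pullZ; apply: eq_pull => b.
by rewrite mulN1r.
Qed.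

(** Norms of forms are computed in [chart_at], which varies from point to point, whereas a segment
    lives in one fixed chart. *)
Lemma metric_transform (h : M -> R) i j p (w : 'rV[R]_7) : cdom i p -> cdom j p ->
  bil (gmetric h j p) (w *m jac i j p) (w *m jac i j p) = bil (gmetric h i p) w w.
Proof.
move=> ip jp.
rewrite -/(gtens (theta j p) (omega j p) (acs j p) (h p)).
rewrite -/(gtens (theta i p) (omega i p) (acs i p) (h p)) !bil_gtens.
rewrite -acs_transform // -bil_pull -(form_pull (@omega_form _ M) ip jp).
by rewrite -th1_pull -(form_pull (@theta_form _ M) ip jp).
Qed.

End ChartIndependence.

(** * Local bounds on the complex structure and the metric *)

Section LocalBounds.
Variables (R : realType) (M : contactCY R).
Implicit Types (i : cidx M) (p : M).

Lemma mx_normP m n (A : 'M[R]_(m, n)) (r : R) : 0 <= r ->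
  `|A| <= r <-> forall a b, `|A a b| <= r.
Proof.
move=> r0; rewrite /Num.norm /= mx_normrE; split=> [/bigmax_leP [_ H] a b|H].
  by have := H (a, b) isT.
by apply/bigmax_leP; split => // -[a b] _ /=; apply: H.
Qed.

Lemma mx_entry_le m n (A : 'M[R]_(m, n)) a b : `|A a b| <= `|A|.
Proof. by have [H _] := mx_normP A (normr_ge0 A); apply: H. Qed.

Lemma near_bounded (T : topologicalType) (f : T -> R) (x : T) :
  {for x, continuous f} -> \forall z \near x, `|f z| <= `|f x| + 1.
Proof.
move=> /cvg_norm cf; have h1 : `|f x| < `|f x| + 1 by rewrite ltrDl.
by apply: filterS (cvgr_lt _ cf _ h1) => z /ltW.
Qed.

Lemma near_forall_fin (T : topologicalType) (I : finType) (P : I -> T -> Prop) (x : T) :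
  (forall a, \forall z \near x, P a z) -> \forall z \near x, forall a, P a z.
Proof. by move=> H; apply: (@filter_forall _ _ (fun a => [set z | P a z]) (nbhs x)). Qed.

Lemma form_continuous k (T : tfield M k) i x a : is_form T -> ccod i x ->
  {for x, continuous (fun z => T i (cinv i z) a)}.
Proof. by move=> [_ _ /(_ i a 0%N) H] /H. Qed.

(* The complex structure J solves J A = C, where A = (Re Upsilon | theta) has
   continuous entries and a right inverse B at x; as A B is close to 1 near x,
   J cannot be large there. *)
Lemma acs_locally_bounded i x : ccod i x -> exists2 K, 0 <= K &
  \forall z \near x, `|acs i (cinv i z)| <= K.
Proof.
move=> ixx.
pose A z : 'M[R]_(7, #|{: ix 2}| + 1) :=
  row_mx (\matrix_(a, l) ReU i (cinv i z) (ix_cons a (enum_val l)))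
         (\col_a theta i (cinv i z) (ix1 a)).
pose C z : 'M[R]_(7, #|{: ix 2}| + 1) :=
  row_mx (\matrix_(a, l) - ImU i (cinv i z) (ix_cons a (enum_val l))) 0.
have iE u (T : tens R 3) s : iprod u T s = \sum_b u 0 b * T (ix_cons b s).
  by apply: eq_bigr => b _; rewrite ix_cat1.
have JA z : ccod i z -> acs i (cinv i z) *m A z = C z.
  move=> iz; have ip : cdom i (cinv i z) by apply: point_dom.
  rewrite mul_mx_row; congr row_mx.
    apply/matrixP => a l; rewrite mxE [RHS]mxE.
    transitivity (iprod (ebase R a *m acs i (cinv i z)) (ReU i (cinv i z)) (enum_val l)).
      by rewrite iE -rowE; apply: eq_bigr => b _; rewrite !mxE.
    rewrite ReU_acs // iE (bigD1 a isT) /= [X in _ + X]big1 => [|b nb].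
      by rewrite addr0 mxE !eqxx mul1r.
    by rewrite mxE eqxx (negPf nb) mul0r.
  apply/matrixP => a l; rewrite [RHS]mxE -[RHS](acs_ker ip (ebase R a)) mxE.
  by rewrite -rowE; apply: eq_bigr => b _; rewrite !mxE.
(* A vector killed by theta and by contraction with Re Upsilon is 0, whence a right inverse at
   [x]. *)
have /row_freeP [B AB] : row_free (A x).
  have ip : cdom i (cinv i x) by apply: point_dom.
  have [P [y1 [y2 [Pg [_ Pth] _ [Pre _] xy1]]]] := cy_frame ip ltr01.
  apply: inj_row_free => u; rewrite mul_mx_row -[RHS]row_mx0 => /eq_row_mx [u1 u2].
  apply: (contraction_injective (frame_unit Pg) (oner_neq0 _) Pth Pre xy1).
    have /(congr1 (fun N : 'M[R]_1 => N 0 0)) := u2; rewrite !mxE => <-.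
    by apply: eq_bigr => a _; rewrite mxE.
  move=> s; have /(congr1 (fun N : 'rV_ _ => N 0 (enum_rank s))) := u1.
  rewrite !mxE => <-; rewrite iE; apply: eq_bigr => a _.
  by rewrite mxE enum_rankK.
have cA a k : {for x, continuous (fun z => A z a k)}.
  rewrite -[k]splitK; case: (fintype.split k) => l /=.
    rewrite (_ : (fun z => _) = fun z => ReU i (cinv i z) (ix_cons a (enum_val l))).
      exact: form_continuous (@ReU_form _ M) ixx.
    by apply/funext => z; rewrite row_mxEl mxE.
  rewrite (_ : (fun z => _) = fun z => theta i (cinv i z) (ix1 a)).
    exact: form_continuous (@theta_form _ M) ixx.
  by apply/funext => z; rewrite row_mxEr mxE.
have cC a k : {for x, continuous (fun z => C z a k)}.
  rewrite -[k]splitK; case: (fintype.split k) => l /=.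
    rewrite (_ : (fun z => _) = fun z => - ImU i (cinv i z) (ix_cons a (enum_val l))).
      exact: cvgN (form_continuous (a := ix_cons a (enum_val l)) (@ImU_form _ M) ixx).
    by apply/funext => z; rewrite row_mxEl mxE.
  rewrite (_ : (fun z => _) = fun=> 0); first exact: cst_continuous.
  by apply/funext => z; rewrite row_mxEr mxE.
have cAB a b : {for x, continuous (fun z => (A z *m B) a b)}.
  rewrite (_ : (fun z => _) = fun z => \sum_k A z a k * B k b); last first.
    by apply/funext => z; rewrite mxE.
  apply: (continuous_at_sum (f := fun k z => A z a k * B k b)) => k.
  exact: (cvgM (cA a k) (cvg_cst (B k b))).
have cCB a b : {for x, continuous (fun z => (C z *m B) a b)}.
  rewrite (_ : (fun z => _) = fun z => \sum_k C z a k * B k b); last first.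
    by apply/funext => z; rewrite mxE.
  apply: (continuous_at_sum (f := fun k z => C z a k * B k b)) => k.
  exact: (cvgM (cC a k) (cvg_cst (B k b))).
pose K := `|C x *m B| + 1.
(* An entry of the product is a sum of 7 terms, each at most [|J| / 14], which gives
   [|J| <= K + |J| / 2]. *)
have n14 : 0 < 14^-1 :> R by rewrite invr_gt0.
have nE : \forall z \near x, forall a b, `|(1%:M - A z *m B) a b| <= 14^-1.
  apply: near_forall_fin => a; apply: near_forall_fin => b.
  have /cvgrPdist_le /(_ _ n14) := cAB a b; rewrite AB.
  by apply: filterS => z; rewrite !mxE.
have nC : \forall z \near x, forall a b, `|(C z *m B) a b| <= K.
  apply: near_forall_fin => a; apply: near_forall_fin => b.
  have cb := near_bounded (cCB a b); move: cb; apply: filterS => z h1; apply: (le_trans h1).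
  by rewrite lerD2r; apply: mx_entry_le.
have K0 : 0 <= K by rewrite addr_ge0.
exists (2 * K); first by rewrite mulr_ge0.
have := near_ccod ixx; apply: filterS3 nE nC => z zE zC iz.
set J := acs i (cinv i z).
have JE : J = C z *m B + J *m (1%:M - A z *m B).
  by rewrite -JA // mulmxBr mulmx1 mulmxA addrC subrK.
have J0 := normr_ge0 J.
suff : `|J| <= K + `|J| / 2 by lra.
apply/mx_normP; first by rewrite addr_ge0 // divr_ge0.
move=> a b; rewrite {1}JE mxE.
apply: le_trans (ler_normD _ _) _; apply: lerD; first exact: zC.
rewrite mxE; apply: le_trans (ler_norm_sum _ _ _) _.
apply: (@le_trans _ _ (\sum_(c < 7) `|J| * 14^-1)).
  apply: ler_sum => c _; rewrite normrM ler_pM //; first exact: mx_entry_le.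
rewrite sumr_const card_ord -[_ *+ 7]mulr_natl.
by rewrite (_ : 7%:R * _ = `|J| / 2) //; field.
Qed.

(** [c] stands for the value of h: quantifying it inside the neighbourhood makes the bound valid up
    to the zeros of h, with no regularity of h there. *)
Lemma metric_locally_bounded i x (w : 'rV[R]_7) : ccod i x -> exists2 K, 0 <= K &
  \forall z \near x, forall c : R,
    bil (gtens (theta i (cinv i z)) (omega i (cinv i z)) (acs i (cinv i z)) c) w w
      <= K * (1 + c ^+ 2).
Proof.
move=> ixx; have [K K0 nJ] := acs_locally_bounded ixx.
pose K1 := \sum_a \sum_b `|omega i (cinv i x) (ix2 a b)| + 1.
pose K2 := \sum_a `|theta i (cinv i x) (ix1 a)| + 1.
have no : \forall z \near x, forall a b, `|omega i (cinv i z) (ix2 a b)| <= K1.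
  apply: near_forall_fin => a; apply: near_forall_fin => b.
  have c := form_continuous (a := ix2 a b) (@omega_form _ M) ixx.
  apply: filterS (near_bounded c) => z h1; apply: (le_trans h1); rewrite lerD2r.
  rewrite (bigD1 a) //= (bigD1 b) //= -addrA lerDl addr_ge0 ?sumr_ge0 // => *.
  by rewrite sumr_ge0.
have nt : \forall z \near x, forall a, `|theta i (cinv i z) (ix1 a)| <= K2.
  apply: near_forall_fin => a.
  have c := form_continuous (a := ix1 a) (@theta_form _ M) ixx.
  apply: filterS (near_bounded c) => z h1; apply: (le_trans h1); rewrite lerD2r.
  by rewrite (bigD1 a) //= lerDl sumr_ge0.
have K10 : 0 <= K1 by rewrite addr_ge0 ?sumr_ge0 // => *; rewrite sumr_ge0.
have K20 : 0 <= K2 by rewrite addr_ge0 ?sumr_ge0.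
pose W := \sum_a `|w 0 a|.
have W0 : 0 <= W by rewrite sumr_ge0.
pose Q1 := \sum_(a < 7) \sum_(b < 7) `|w 0 a| * (W * K) * K1.
have Q10 : 0 <= Q1.
  by rewrite sumr_ge0 // => a _; rewrite sumr_ge0 // => b _; rewrite !mulr_ge0.
pose Q2 := (W * K2) ^+ 2.
exists (Q1 + Q2); first by rewrite addr_ge0 // sqr_ge0.
apply: filterS3 nJ no nt => z zJ zo zt c; rewrite bil_gtens.
set J := acs i (cinv i z) in zJ *.
have b1 : bil (omega i (cinv i z)) w (w *m J) <= Q1.
  apply: le_trans (ler_norm _) _; rewrite bilE.
  apply: le_trans (ler_norm_sum _ _ _) _; apply: ler_sum => a _.
  apply: le_trans (ler_norm_sum _ _ _) _; apply: ler_sum => b _.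
  rewrite !normrM; apply: ler_pM => //; apply: ler_pM => //.
  rewrite mxE; apply: le_trans (ler_norm_sum _ _ _) _; rewrite /W big_distrl /=.
  apply: ler_sum => d _; rewrite normrM ler_wpM2l //.
  apply: le_trans zJ; exact: mx_entry_le.
have b2 : th1 (theta i (cinv i z)) w ^+ 2 <= Q2.
  rewrite -real_normK ?num_real // /Q2 lerXn2r ?nnegrE ?mulr_ge0 //.
  apply: le_trans (ler_norm_sum _ _ _) _; rewrite /W big_distrl /=.
  by apply: ler_sum => a _; rewrite normrM ler_wpM2l.
have c2 := sqr_ge0 c; have Q20 : 0 <= Q2 by rewrite sqr_ge0.
rewrite -expr2 mulrDl !mulrDr !mulr1.
have h1 : c ^+ 2 * th1 (theta i (cinv i z)) w ^+ 2 <= Q2 * c ^+ 2.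
  by rewrite mulrC ler_wpM2r.
have h2 : 0 <= Q1 * c ^+ 2 by rewrite mulr_ge0.
by lra.
Qed.

End LocalBounds.

(** * Zeros of h *)

Section LogarithmicDerivative.
Variables (R : realType) (M : contactCY R) (h : M -> R).
Implicit Types (i j : cidx M) (p q : M).

Lemma line_derive n (x w : 'rV[R]_n) (t : R) : is_derive t 1 (fun s : R => x + s *: w) w.
Proof.
have d : derivable (id : 'rV[R]_n -> 'rV[R]_n) (x + t *: w) w by apply: derivable_id.
by have := is_derive_line d; rewrite derive_id.
Qed.

Lemma derive_ln_curve i (Y : R -> 'rV[R]_7) (u : R) (w : 'rV[R]_7) :
  ccod i (Y u) -> is_derive u 1 Y w ->
  0 < h (cinv i (Y u)) -> differentiable_at h (cinv i (Y u)) ->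
  let G := fun s : R => ln (h (cinv i (Y s))) in
  derivable G u 1 /\
  'D_1 G u ^+ 2 <= norm_dln h (cinv i (Y u)) ^+ 2 *
                   bil (gmetric h i (cinv i (Y u))) w w.
Proof.
move=> iY dY; set q := cinv i (Y u) => hq dq G.
have iq : cdom i q by apply: point_dom.
set j := chart_at q; have jq : cdom j q by apply: chart_atP.
pose Z s := cmap j (cinv i (Y s)); pose w' := w *m jac i j q.
have dZ : is_derive u 1 Z w' by apply: (chart_change iY jq (erefl _) dY).
pose g z := ln (h (cinv j z)).
have dg : differentiable g (cmap j q).
  have dl : differentiable (@ln R) (h (cinv j (cmap j q))).
    by rewrite cmapK //; apply/derivable1_diffP; have [] := is_derive1_ln hq.
  exact: (differentiable_comp (dq j jq) dl).
have dZ' : differentiable Z u by apply/derivable1_diffP; have [] := dZ.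
have dgZ : differentiable g (Z u) by exact: dg.
have nG : \forall s \near u, (g \o Z) s = G s.
  have cY : {for u, continuous Y}.
    by apply: differentiable_continuous; apply/derivable1_diffP; have [] := dY.
  have nj : \forall s \near u, cdom j (cinv i (Y s)) := cY _ (near_cdom iY jq).
  apply: filterS nj => s js.
  by rewrite /G /g /Z /= cmapK.
have dgc : differentiable (g \o Z) u by apply: differentiable_comp.
have dGZ : derivable (g \o Z) u 1 by apply: diff_derivable.
have [dG EG] : is_derive u 1 G ('D_1 (g \o Z) u).
  by apply: (near_eq_is_derive nG); apply: derivableP.
split => //; rewrite EG -(metric_transform h w iq jq) -/w'.
have -> : 'D_1 (g \o Z) u = \sum_b w' 0 b * ext_d (form0 (fun p => ln (h p))) j q (ix1 b).
  rewrite deriveE; last exact: differentiable_comp.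
  rewrite diff_comp //= -(deriveE _ dZ'); have [_ ->] := dZ.
  rewrite [in LHS](row_sum_delta w') linear_sum /=.
  by apply: eq_bigr => b _; rewrite linearZ /= ext_d_form0 ffunE /pd deriveE.
have [P [y1 [y2 [Pg _ _ _ _]]]] := cy_frame jq hq.
exact: (fnorm1_cauchy Pg).
Qed.

End LogarithmicDerivative.

Section VanishingOnAnOrbit.
Variables (R : realType) (M : contactCY R) (h : M -> R).
Implicit Types (i j : cidx M) (p q : M).

Lemma orbit_closed p : closed (flow_orbit (@xi R M) p).
Proof. exact: (compact_closed (@mhausdorff _ M) (@orbit_compact _ M p)). Qed.

(** The supremum of the times spent on the orbit is attained, because the orbit is compact and hence
    closed. *)
Lemma last_orbit_time p i x w (T : R) :
  (forall t, 0 <= t <= T -> ccod i (x + t *: w)) ->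
  flow_orbit (@xi R M) p (cinv i x) -> 0 <= T ->
  ~ flow_orbit (@xi R M) p (cinv i (x + T *: w)) ->
  exists2 s, 0 <= s < T & flow_orbit (@xi R M) p (cinv i (x + s *: w)) /\
    forall t, s < t <= T -> ~ flow_orbit (@xi R M) p (cinv i (x + t *: w)).
Proof.
move=> ci px T0 nT; set O := flow_orbit _ p in px nT *.
pose S : set R := [set t | 0 <= t <= T /\ O (cinv i (x + t *: w))].
have S0 : S 0 by rewrite /S /= lexx T0 scale0r addr0.
have uS : has_sup S by split; [exists 0|exists T => t [/andP[]]].
have ubS t : S t -> t <= sup S by apply: sup_upper_bound.
have s0 : 0 <= sup S by apply: ubS.
have sT : sup S <= T by apply: ge_sup; [exists 0|move=> t [/andP[]]].
have s0T : 0 <= sup S <= T by rewrite s0.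
have Os : O (cinv i (x + sup S *: w)).
  apply: contrapT => nOs.
  have cs : {for sup S, continuous (fun t : R => cinv i (x + t *: w))}.
    apply: (@continuous_comp _ _ _ (fun t : R => x + t *: w) (cinv i)).
      by apply: differentiable_continuous; apply/derivable1_diffP; have [] := line_derive x w (sup S).
    by apply: point_cont; apply: ci.
  have nn : nbhs (cinv i (x + sup S *: w)) (~` O).
    by apply: open_nbhs_nbhs; split => //; apply: closed_openC; apply: orbit_closed.
  have /nbhs_ballP [e /= e0 Be] : \forall t \near sup S, ~ O (cinv i (x + t *: w)) := cs _ nn.
  have [t St tS] := sup_adherent e0 uS.
  have ts := ubS t St; apply: (Be t _ St.2).
  by rewrite /ball /= ger0_norm ?subr_ge0 // ltrBlDl -ltrBlDr.
exists (sup S).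
  rewrite s0 lt_neqAle sT andbT /=; apply/eqP => sE; apply: nT.
  by rewrite -sE.
split => // t /andP[st tT] Ot.
have : S t by split => //; rewrite (le_trans s0 (ltW st)).
by move=> /ubS; rewrite leNgt st.
Qed.

Lemma dln_unbounded p (U : set M) : (forall q : M, 0 <= h q) ->
  h p = 0 -> leaf_continuous_at h p -> leaf_open U -> U p ->
  (forall q : M, (U `\` flow_orbit (@xi R M) p) q -> 0 < h q /\ differentiable_at h q) ->
  ~ bounded_over (U `\` flow_orbit (@xi R M) p) (norm_dln h).
Proof.
set O := flow_orbit _ p => h0 hp ch [oU sU] Up hU [C HC].
(* A point of [U] off the orbit would have h > 0. *)
have Op : O p.
  by apply: contrapT => nOp; have [] := hU p (conj Up nOp); rewrite hp ltxx.
pose i := chart_at p; have ip : cdom i p by apply: chart_atP.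
pose x0 := cmap i p; have ix0 : ccod i x0 by apply: coord_cod.
have x0K : cinv i x0 = p by apply: cmapK.
have V0 : xi i p != 0.
  apply/eqP => V0; have := theta_xi ip; rewrite V0 big1 => [/eqP|a _].
    by rewrite eq_sym oner_eq0.
  by rewrite mxE mul0r.
(* A direction orthogonal to the Reeb vector for the Euclidean product of the chart, hence
   transverse to the flow. *)
have [w w0 Vw] := exists_annihilated (xi i p)^T isT.
have /nbhs_ballP [e /= e0 Be] : \forall z \near x0, ccod i z /\ U (cinv i z).
  apply: filterI; first exact: near_ccod.
  have Ux : nbhs (cinv i x0) U by apply: open_nbhs_nbhs; split; rewrite ?x0K.
  exact: (point_cont ix0 Ux).
have w1 : 0 < `|w| by rewrite normr_gt0.
pose T := e / `|w|; have T0 : 0 < T by rewrite divr_gt0.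
have inB (t : R) : 0 <= t < T -> ccod i (x0 + t *: w) /\ U (cinv i (x0 + t *: w)).
  move=> /andP[t0 tT]; apply: Be.
  rewrite -ball_normE /= opprD addNKr normrN normrZ.
  by rewrite ger0_norm // -ltr_pdivlMr.
have [t1 /andP[t10 t1T] nO] : exists2 t, 0 < t < T & ~ O (cinv i (x0 + t *: w)).
  apply: (orbit_misses_segment (@xi_vfield _ M)) => //; first by rewrite x0K.
  rewrite x0K; have /matrixP /(_ 0 0) := Vw; rewrite !mxE => Vw0; rewrite -[RHS]Vw0.
  by apply: eq_bigr => a _; rewrite mxE mulrC.
have inB1 (t : R) : 0 <= t <= t1 -> ccod i (x0 + t *: w) /\ U (cinv i (x0 + t *: w)).
  by move=> /andP[t0 tt]; apply: inB; rewrite t0 (le_lt_trans tt).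
have [s /andP[s0 st1] [Os ns]] : exists2 s, 0 <= s < t1 & O (cinv i (x0 + s *: w)) /\
    forall t, s < t <= t1 -> ~ O (cinv i (x0 + t *: w)).
  apply: last_orbit_time => //; [|by rewrite x0K|exact: ltW].
  by move=> t /inB1 [].
pose x := x0 + s *: w.
have ix : ccod i x by apply: (inB1 s _).1; rewrite s0 ltW.
have cline : {for s, continuous (fun t : R => x0 + t *: w)}.
  by apply: differentiable_continuous; apply/derivable1_diffP; have [] := line_derive x0 w s.
(* Neighbourhoods in the leaf space are saturated: continuity of h at [p] makes h small near every
   point of the orbit, in particular near the last one on the segment. *)
have hsmall (r : R) : 0 < r -> \forall t \near s, h (cinv i (x0 + t *: w)) < r.
  move=> r0; have [V [[oV sV] Vp Vh]] := ch r r0.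
  have Vx : nbhs (cinv i x) V by apply: open_nbhs_nbhs; split => //; apply: (sV p).
  have nV : \forall z \near x, V (cinv i z) := point_cont ix Vx.
  have nt : \forall t \near s, V (cinv i (x0 + t *: w)) := cline _ nV.
  apply: filterS nt => t /Vh; rewrite hp subr0; exact: le_lt_trans (ler_norm _).
have [K K0 nK] := metric_locally_bounded w ix.
have /nbhs_ballP [d /= d0 Bd] : \forall t \near s,
    h (cinv i (x0 + t *: w)) < 1 /\ forall c : R, bil (gtens (theta i (cinv i (x0 + t *: w)))
   (omega i (cinv i (x0 + t *: w))) (acs i (cinv i (x0 + t *: w))) c) w w <= K * (1 + c ^+ 2).
  by apply: filterI (hsmall 1 ltr01) _; apply: (cline _ nK).
pose t2 := Num.min t1 (s + d / 2).
have st2 : s < t2 by rewrite lt_min st1 /=; lra.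
have t21 : t2 <= t1 by rewrite ge_min lexx.
have t2d : t2 <= s + d / 2 by rewrite ge_min lexx orbT.
pose G t := ln (h (cinv i (x0 + t *: w))).
(* Where h < 1 the squared speed is at most [K * (1 + 1)]; with [C] bounding the norm of d(ln h),
   [L] bounds the derivative of ln h along the segment. *)
pose L := Num.sqrt (C ^+ 2 * (K * (1 + 1))).
have dG (t : R) : s < t <= t2 ->
    [/\ 0 < h (cinv i (x0 + t *: w)), derivable G t 1 & `|'D_1 G t| <= L].
  move=> /andP[st tt2]; have t0 : 0 <= t by lra.
  have tt1 : t <= t1 by lra.
  have [ci Ut] : ccod i (x0 + t *: w) /\ U (cinv i (x0 + t *: w)).
    by apply: inB1; rewrite t0.
  have UO : (U `\` O) (cinv i (x0 + t *: w)) by split=> //; apply: ns; rewrite st.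
  have [ht dht] := hU _ UO; have HCt := HC _ UO.
  have [dGt bG] := derive_ln_curve ci (line_derive x0 w t) ht dht.
  split => //; rewrite -/(G) in bG.
  have : ball s d t by rewrite /ball /= distrC ger0_norm; lra.
  move=> /Bd [] h1 /(_ (h (cinv i (x0 + t *: w)))) bK.
  rewrite -sqrtr_sqr ler_wsqrtr //; apply: (le_trans bG).
  set N := norm_dln h _ in HCt *; set b := bil _ _ _.
  have {}bK : b <= K * (1 + 1).
    apply: (le_trans bK); rewrite ler_wpM2l // lerD2l expr_le1 //; exact: ltW.
  apply: (@le_trans _ _ (N ^+ 2 * (K * (1 + 1)))); first by rewrite ler_wpM2l ?sqr_ge0.
  have K2 : 0 <= K * (1 + 1) by rewrite mulr_ge0.
  have C0 : 0 <= C := le_trans (normr_ge0 _) HCt.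
  by rewrite ler_wpM2r // -real_normK ?num_real // lerXn2r.
(* The Lipschitz bound keeps h at least [m] on []s, t2]], whereas [hsmall] makes h smaller than [m]
   close to [s]. *)
pose m := expR (G t2 - L * (t2 - s)).
have m0 : 0 < m by apply: expR_gt0.
have /nbhs_ballP [d' /= d'0 Bd'] := hsmall m m0.
pose t := Num.min t2 (s + d' / 2).
have st : s < t by rewrite lt_min st2 /=; lra.
have tt2 : t <= t2 by rewrite ge_min lexx.
have td : t <= s + d' / 2 by rewrite ge_min lexx orbT.
have L0 : 0 <= L by apply: sqrtr_ge0.
have : ball s d' t by rewrite /ball /= distrC ger0_norm; lra.
move=> /Bd' /=; apply/negP; rewrite -leNgt.
have [ht _ _] : [/\ 0 < h (cinv i (x0 + t *: w)), derivable G t 1 & `|'D_1 G t| <= L].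
  by apply: dG; rewrite st.
rewrite -[leRHS]lnK ?posrE // ler_expR.
have GG : `|G t2 - G t| <= L * `|t2 - t|.
  apply: (@mvt_le R G (fun u => 'D_1 G u) t t2 L).
  - move=> u /andP[tu ut2]; have [] : [/\ 0 < h (cinv i (x0 + u *: w)), derivable G u 1 & `|'D_1 G u| <= L].
      by apply: dG; lra.
    by move=> _ dGu _; apply: derivableP.
  - by move=> u /andP[tu ut2]; have [] := dG u ltac:(lra).
  - by rewrite tt2 lexx.
  - by rewrite tt2 lexx.
rewrite lerBlDl -lerBlDr; apply: le_trans (ler_norm _) _.
apply: le_trans GG _; rewrite ler_wpM2l // ger0_norm ?subr_ge0 //; lra.
Qed.

End VanishingOnAnOrbit.

(** * Comparison of the two norms, and its consequences *)

Lemma norm_dstar_varphiE (R : realType) (M : contactCY R) (h : M -> R) p :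
  constant_along (@xi R M) h -> 0 < h p -> differentiable_at h p ->
  norm_dstar_varphi h p = Num.sqrt 2 * norm_dln h p.
Proof.
move=> hxi hp dh; have [S S0 [NS ->]] := norm_formula hp dh.
rewrite norm_dln_formula //.
have ip : cdom (chart_at p) p by apply: chart_atP.
move: NS; rewrite (pd_along_constant (@xi_vfield _ M) hxi ip dh) mulr0 expr0n add0r => <-.
rewrite -mulrA -exprMn sqrtrM // sqrtr_sqr ger0_norm //.
by rewrite mulr_ge0 ?norm_d_ge0 // invr_ge0 ltW.
Qed.

Theorem lemma27 (R : realType) (M : contactCY R) (h : M -> R)
    (h_ge0 : forall p : M, 0 <= h p)
    (h_xi : constant_along (@xi R M) h) :
  [/\ (* (i) *)
      (forall p : M, 0 < h p -> differentiable_at h p) ->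
      (bounded_over [set p : M | 0 < h p] (norm_dstar_varphi h) <->
       bounded_over [set p : M | 0 < h p] (norm_dln h)),
      (* (ii) *)
      forall (p : M) (U : set M),
        h p = 0 -> leaf_continuous_at h p ->
        leaf_open U -> U p ->
        (forall q : M, (U `\` flow_orbit (@xi R M) p) q ->
           0 < h q /\ differentiable_at h q) ->
        ~ bounded_over (U `\` flow_orbit (@xi R M) p) (norm_dln h)
    & (* (iii) *)
      forall (p : M) (k : R), k != 0 -> has_order h p k ->
        exists C d : R, 0 < d /\
          forall (x : M) (r : R), leaf_dist p x = r%:E -> 0 < r < d ->
            `|norm_dstar_varphi h x| <= C * r^-1 ].
Proof.
have s2 : 0 < Num.sqrt 2 :> R by rewrite sqrtr_gt0.
split.
- move=> dh; split=> -[C HC].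
    exists ((Num.sqrt 2)^-1 * C) => p /= hp.
    rewrite ler_pdivlMl // -[X in X * _]gtr0_norm // -normrM.
    by rewrite -(norm_dstar_varphiE h_xi hp (dh p hp)); apply: HC.
  exists (Num.sqrt 2 * C) => p /= hp.
  rewrite (norm_dstar_varphiE h_xi hp (dh p hp)) normrM gtr0_norm // ler_pM2l //.
  exact: HC.
- by move=> p U; apply: dln_unbounded.
(* [C / c] comes from dividing the bound [C * r^(k - 1)] on dh by the lower bound [c * r^k] on h. *)
move=> p k _ [c [C [d [c0 d0 H]]]]; exists (Num.sqrt 2 * (C / c)), d; split=> // x r xr rd.
have [dh hl _ hd] := H x r xr rd; have r0 : 0 < r by case/andP: rd.
have rk : 0 < r `^ k by apply: powR_gt0.
have hx : 0 < h x by apply: lt_le_trans hl; apply: mulr_gt0.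
rewrite (norm_dstar_varphiE h_xi hx dh) normrM gtr0_norm // -mulrA ler_pM2l //.
rewrite norm_dln_formula // ger0_norm; last by rewrite mulr_ge0 ?norm_d_ge0 // invr_ge0 ltW.
rewrite ler_pdivrMl //; apply: (le_trans hd).
rewrite powRB ?(gt_eqF r0) ?implybT // powRr1 ?(ltW r0) //.
(* The sign of [C] follows from its bounding a norm at [x]. *)
have Cr : 0 <= C / c * r^-1.
  have : 0 <= C * r `^ (k - 1) := le_trans (norm_d_ge0 h h x) hd.
  rewrite pmulr_lge0 ?powR_gt0 // => C0; rewrite !mulr_ge0 // ?invr_ge0 ltW //.
apply: le_trans (ler_wpM2r Cr hl).
rewrite le_eqVlt; apply/orP; left; apply/eqP; field.
by rewrite !gt_eqF.
Qed.
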